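(* Up to similarity, there are exactly two finite regular polyhedra of index $2$ with directed type whose vertices coincide with those of a regular dodecahedron $S$. These have edges of length $2$. One of these has type $\{5,6\}$, with genus $9$, and is orientable with planar faces in two orbits under $G^+(S)$, being pentagrams of shape $[hl,hl,hl,hl]$ and convex pentagons of shape $[f,f,f,f]$. Its Petrie dual (the other one) has type $\{4,6\}$, with genus $12$, and is non-orientable with non-planar faces in one orbit under $G^+(S)$, and of shape $[hl,f,hl,f]$.
   Context: Maps and polyhedra: a finite map $M$ is a decomposition of a closed compact surface into simply connected faces by edges meeting at vertices, identified with its partially ordered set of vertices, edges, faces; it has type $\{p,q\}$ if each face has $p$ edges and each vertex lies on $q$ edges; it is regular if its automorphism group $\Gamma(M)$ is transitive on flags (mutually incident vertex–edge–face triples). A polyhedron $P$ is a faithful realization of a map $M$ in $\mathbb{E}^3$: vertices, edges, faces correspond bijectively (preserving incidence) to points, line segments, and closed simple sequences of edges; faces may be non-planar; $p,q\ge 3$ and no two edges join the same two vertices. Put $\Gamma(P)=\Gamma(M)$. $G(P)$ is the group of isometries of $\mathbb{E}^3$ preserving $P$, $G^+(P)$ its rotation subgroup. $P$ is a regular polyhedron of index $2$ if $M$ is regular and $G(P)$ has index $2$ in $\Gamma(P)$. $G^+(S)$ denotes the rotation group of $S$. Genus and orientability refer to the underlying surface (non-orientable genus $=2-\chi$). The Petrie dual has the same vertices and edges as $P$, and as faces the Petrie polygons (edge paths such that every two, but no three, consecutive edges lie in a common face). Edge length and type: the length of an edge of $P$ is the distance of its endpoints along edges of $S$ (edges of $S$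 having length $1$). The notion of type concerns regular polyhedra of index $2$ whose vertices form one orbit under $G(P)$ and all of whose edges have the same length: $P$ has directed type if for one (equivalently every) edge with vertices $u,v$ the directed edges $\{u,v\}$ (from $u$ to $v$) and $\{v,u\}$ are not equivalent under $G^+(P)$. Face shapes: project the edges of $P$ from the center of $S$ onto the circumsphere, viewed from outside. When the boundary of a face arrives at a vertex $v$ along a directed edge $\{u,v\}$, it continues along one of the five other edges of $P$ at $v$; these, in counterclockwise order about $v$ starting from the arriving edge, are the changes of direction $hr,sr,f,sl,hl$ (hard right, soft right, forward, soft left, hard left). A face $F$ has shape $[a,b,c,d]$ if, starting along a directed starting edge $\{v_0,v_1\}$ of its boundary, the changes of direction at $v_1,v_2,v_3,\dots$ are $a,b,c,d,a,b,c,d,\dots$. Here the starting edge is required to have left orientation: $\{u,v\}$ of length $2$ has left orientation if the edge path $\{u,w,v\}$ of length $2$ on $S$ bends left at $w$. *)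

(* Defs.v *)
From HB Require Import structures.
From mathcomp Require Import all_boot all_order all_algebra all_fingroup.
From mathcomp Require Import finmap boolp reals.

Set Implicit Arguments.
Unset Strict Implicit.
Unset Printing Implicit Defensive.

Import Order.TTheory GRing.Theory Num.Theory.
Local Open Scope ring_scope.
Local Open Scope fset_scope.

(* The library's norm on 'rV[R]_3 is the sup norm, hence the explicit Euclidean
   distance below. *)
Notation E3 R := 'rV[R]_3.

Section Euclidean.
Variable R : realType.
Implicit Types (u v w x y : E3 R) (g : E3 R -> E3 R).

Definition vec (a b c : R) : E3 R := \row_(k < 3) [:: a; b; c]`_k.

Definition dot u v : R := \sum_k u 0 k * v 0 k.

Definition triple u v w : R := \det (col_mx u (col_mx v w) : 'M_3).

Definition edist x y : R := Num.sqrt (dot (x - y) (x - y)).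

Definition isometry g := forall x y, edist (g x) (g y) = edist x y.

(* A direct isometry preserving a finite set fixes its centroid, so it is a
   rotation. *)
Definition direct g := forall o x y z,
  triple (g x - g o) (g y - g o) (g z - g o) = triple (x - o) (y - o) (z - o).

Definition similarity g :=
  exists2 k : R, 0 < k & forall x y, edist (g x) (g y) = k * edist x y.

End Euclidean.

(* An edge is represented by the pair of its endpoints, a face by the set of
   edges of its boundary. *)
Notation edge R := {fset E3 R}.
Notation face R := {fset {fset E3 R}}.

Record polyhedron (R : realType) := Polyhedron {
  pverts : {fset E3 R};
  pedges : {fset edge R};
  pfaces : {fset face R} }.

Definition cycle_edges (T : choiceType) (s : seq T) : {fset {fset T}} :=
  [fset [fset x; next s x] | x in s].

Definition is_cycle (T : choiceType) (A : {fset {fset T}}) :=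
  exists s : seq T, [/\ uniq s, (3 <= size s)%N & A = cycle_edges s].

Section Polyhedra.
Variable R : realType.
Implicit Types (P Q : polyhedron R) (x y : E3 R) (e : edge R) (f h : face R)
  (g : E3 R -> E3 R).

Definition star P x : {fset edge R} := [fset e in pedges P | x \in e].

Definition face_verts (f : face R) : {fset E3 R} := \bigcup_(e <- f) e.

Definition vertex_figure P x : {fset {fset edge R}} :=
  [fset [fset e in (f : face R) | x \in e]
     | f in [fset f in pfaces P | x \in face_verts f]].

Definition adjacent P : rel (E3 R) := fun x y => [fset x; y] \in pedges P.

(* The last three conditions say that the cell complex obtained by spanning a
   disc in every face boundary is a connected closed surface: every edge is on
   two sides, and every vertex link is one circle.  Faces and vertex-figures
   being cycles of length at least 3 encodes p, q >= 3; simple edges between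
   distinct vertices are built in. *)
Definition is_polyhedron P :=
  [/\ pverts P != fset0,
      forall e, e \in pedges P -> #|` e| = 2%N /\ e `<=` pverts P,
      forall f, f \in pfaces P -> is_cycle f /\ f `<=` pedges P,
      forall e, e \in pedges P -> #|` [fset f in pfaces P | e \in f]| = 2%N
    & (forall x, x \in pverts P -> is_cycle (vertex_figure P x)) /\
      (forall x y, x \in pverts P -> y \in pverts P ->
         exists2 s, path (adjacent P) x s & last x s = y)].

Definition has_type P (p q : nat) :=
  (forall f, f \in pfaces P -> #|` f| = p) /\
  (forall x, x \in pverts P -> #|` star P x| = q).

Definition euler_char P : int :=
  #|` pverts P|%:Z - #|` pedges P|%:Z + #|` pfaces P|%:Z.

(* o f x y means that the face f is oriented so as to traverse the edge xy
   from x to y; the two faces at an edge must traverse it in opposite senses. *)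
Definition orientable P :=
  exists o : face R -> rel (E3 R),
    [/\ forall f x y, f \in pfaces P -> [fset x; y] \in f ->
          o f x y = ~~ o f y x,
        forall f x y z, f \in pfaces P -> [fset x; y] \in f ->
          [fset y; z] \in f -> x != z -> o f x y = o f y z
      & forall f f' x y, f \in pfaces P -> f' \in pfaces P -> f != f' ->
          [fset x; y] \in f -> [fset x; y] \in f' -> o f x y = o f' y x].

Definition has_genus P (k : nat) :=
  euler_char P = 2 - (if `[< orientable P >] then 2 * k%:Z else k%:Z).

(* Automorphisms of the poset of vertices, edges and faces, incidence being
   membership, as triples of permutations. *)
Definition poset_perm P : finGroupType :=
  ({perm pverts P} * {perm pedges P} * {perm pfaces P})%type.

Definition Gamma P : {set poset_perm P} :=
  [set a : poset_perm P |
     [forall x : pverts P, forall e : pedges P,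
        (val (a.1.1 x) \in val (a.1.2 e)) == (val x \in val e)]
  && [forall e : pedges P, forall f : pfaces P,
        (val (a.1.2 e) \in val (a.2 f)) == (val e \in val f)]].

Definition flag P (x : pverts P) (e : pedges P) (f : pfaces P) :=
  (val x \in val e) && (val e \in val f).

Definition regular_map P :=
  forall (x x' : pverts P) (e e' : pedges P) (f f' : pfaces P),
    flag x e f -> flag x' e' f' ->
    exists2 a : poset_perm P, a \in Gamma P &
      [/\ a.1.1 x = x', a.1.2 e = e' & a.2 f = f'].

Definition im_edge g (e : edge R) : edge R := [fset g x | x in e].
Definition im_face g (f : face R) : face R := [fset im_edge g e | e in f].
Definition im_poly g P : polyhedron R :=
  Polyhedron (im_edge g (pverts P)) (im_face g (pedges P))
             [fset im_face g f | f in pfaces P].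

Definition symmetry P g := isometry g /\ im_poly g P = P.
Definition rotation_symmetry P g := symmetry P g /\ direct g.

(* G(P), viewed inside Gamma(P) through its action on the cells of P. *)
Definition G P : {set poset_perm P} :=
  [set a : poset_perm P | `[< exists2 g, symmetry P g &
     [/\ forall x : pverts P, val (a.1.1 x) = g (val x),
         forall e : pedges P, val (a.1.2 e) = im_edge g (val e)
       & forall f : pfaces P, val (a.2 f) = im_face g (val f)] >]].

Definition regular_index2 P :=
  [/\ is_polyhedron P, regular_map P & #|Gamma P : G P|%g = 2%N].

Definition similar_poly P Q := exists2 g, similarity g & im_poly g P = Q.

(* The walk v runs around the polygon periodically. *)
Definition petrie_polygon P (f : face R) :=
  exists v : nat -> E3 R,
    [/\ forall i, [fset v i; v i.+1] \in pedges P /\ v i != v i.+2,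
        forall i, exists2 h, h \in pfaces P &
          ([fset v i; v i.+1] \in h) && ([fset v i.+1; v i.+2] \in h),
        forall i, ~ exists2 h, h \in pfaces P &
          [&& [fset v i; v i.+1] \in h, [fset v i.+1; v i.+2] \in h
            & [fset v i.+2; v i.+3] \in h]
      & forall e, e \in f <-> exists i, e = [fset v i; v i.+1]].

Definition petrie_dual P Q :=
  [/\ pverts Q = pverts P, pedges Q = pedges P
    & forall f, f \in pfaces Q <-> petrie_polygon P f].

End Polyhedra.

Section PlanarFaces.
Variable R : realType.
Implicit Types (f : face R) (n x y z : E3 R).

Definition in_plane f n :=
  n != 0 /\ forall x y, x \in face_verts f -> y \in face_verts f ->
    dot n (x - y) = 0.

Definition planar f := exists n, in_plane f n.

(* Within its plane, the line of each edge has all the other vertices strictly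
   on one side. *)
Definition convex_polygon f :=
  is_cycle f /\
  exists2 n, in_plane f n &
    forall x y z z', [fset x; y] \in f ->
      z \in face_verts f `\` [fset x; y] ->
      z' \in face_verts f `\` [fset x; y] ->
      0 < triple n (y - x) (z - x) * triple n (y - x) (z' - x).

Definition convex_pentagon f := convex_polygon f /\ #|` f| = 5%N.

Definition equilateral f := forall x y z t : E3 R,
  [fset x; y] \in f -> [fset z; t] \in f -> edist x y = edist z t.

(* The star pentagon formed by the diagonals of a regular convex pentagon. *)
Definition pentagram f := exists x0 x1 x2 x3 x4 : E3 R,
  [/\ uniq [:: x0; x1; x2; x3; x4],
      convex_pentagon (cycle_edges [:: x0; x1; x2; x3; x4]),
      equilateral (cycle_edges [:: x0; x1; x2; x3; x4]),
      f = cycle_edges [:: x0; x2; x4; x1; x3]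
    & equilateral f].

End PlanarFaces.

Section Dodecahedron.
Variable R : realType.
Implicit Types (S : {fset E3 R}) (P : polyhedron R) (u v w x y : E3 R).

Definition golden : R := (1 + Num.sqrt 5) / 2.

Definition pm : seq R := [:: 1; -1].

Definition dodecahedron_points : seq (E3 R) :=
  [seq vec p.1 p.2 c | p <- [seq (a, b) | a <- pm, b <- pm], c <- pm]
  ++ [seq vec 0 (a / golden) (b * golden) | a <- pm, b <- pm]
  ++ [seq vec (a / golden) (b * golden) 0 | a <- pm, b <- pm]
  ++ [seq vec (b * golden) 0 (a / golden) | a <- pm, b <- pm].

(* A regular dodecahedron, given by its vertex set (which determines it as a
   convex solid). *)
Definition regular_dodecahedron S :=
  exists2 g : E3 R -> E3 R, similarity g &
    S = [fset g x | x in dodecahedron_points].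

(* The edges of S join the pairs of vertices at minimal distance. *)
Definition S_edge S : rel (E3 R) := fun x y =>
  [&& x \in S, y \in S, x != y
    & [forall z : S, forall t : S,
         (z != t) ==> (edist x y <= edist (val z) (val t))]].

Definition S_length S x y (n : nat) :=
  (exists2 s, path (S_edge S) x s & last x s = y /\ size s = n) /\
  (forall s, path (S_edge S) x s -> last x s = y -> (n <= size s)%N).

Definition edges_of_length S P (n : nat) :=
  forall x y, [fset x; y] \in pedges P -> S_length S x y n.

Definition directed_type S P :=
  [/\ forall x y, x \in pverts P -> y \in pverts P ->
        exists2 g, symmetry P g & g x = y,
      exists n, edges_of_length S P n
    & exists u v, [fset u; v] \in pedges P /\
        ~ exists2 g, rotation_symmetry P g & g u = v /\ g v = u].

Definition directed_on S P :=
  [/\ pverts P = S, regular_index2 P & directed_type S P].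

Definition S_center S : E3 R := (#|` S|%:R)^-1 *: \sum_(x <- S) x.

Definition S_rotation S (g : E3 R -> E3 R) :=
  [/\ isometry g, direct g & im_edge g S = S].

Definition face_orbit S P (f : face R) : {fset face R} :=
  [fset h in pfaces P | `[< exists2 g, S_rotation S g & im_face g f = h >]].

Definition face_orbits S P : {fset {fset face R}} :=
  [fset face_orbit S P f | f in pfaces P].

(* Counterclockwise cyclic order, seen from the tip of n, of the directions
   a, b, c projected along n.  The three successive angles add up to a full
   turn when a, b, c are in this order, so at most one is pi or more; for the
   opposite order (or when two directions agree) at most one is less than pi.
   A determinant is positive when the corresponding angle is less than pi. *)
Definition ccw (n a b c : E3 R) : bool :=
  (2 <= (0 < triple n a b)%R + (0 < triple n b c)%R + (0 < triple n c a)%R)%N.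

Inductive turn := Hr | Sr | Fw | Sl | Hl.

(* The rank of vw among the other edges of P at v, counterclockwise from the
   arriving edge uv, is the number of edges strictly between the two. *)
Definition change_of_direction S P u v w : turn :=
  nth Hl [:: Hr; Sr; Fw; Sl; Hl]
    #|` [fset x in pverts P | adjacent P v x &&
           ccw (v - S_center S) (u - v) (x - v) (w - v)]|.

Definition left_oriented S u v :=
  exists w, [/\ S_edge S u w, S_edge S w v
              & 0 < triple (w - S_center S) (w - u) (v - w)].

Definition has_shape S P (f : face R) (a b c d : turn) :=
  exists v : nat -> E3 R,
    [/\ forall i, [fset v i; v i.+1] \in f /\ v i != v i.+2,
        left_oriented S (v 0%N) (v 1%N)
      & forall i, change_of_direction S P (v i) (v i.+1) (v i.+2)
                  = nth a [:: a; b; c; d] (i %% 4)%N].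

End Dodecahedron.

(* Main.v *)
(** With [golden] the golden ratio, the coordinates of the vertices of S lie in
    Z[golden], so every metric or orientation condition on vertices is decided
    by integer arithmetic.  The distances between vertices take five values, and
    a backtracking search lists the 120 permutations of the vertices preserving
    them: these are the isometries of S, since equal Gram matrices are related by
    an orthogonal map.  The graph joining the vertices at distance 2 on S has
    exactly 240 automorphisms, the additional ones coming from the Galois
    conjugation of Z[golden].

    Let Q be of index 2 and of directed type on S.  Counting flags gives
    |Gamma(Q)| >= 120, so G(Q) has at least 60 elements, hence index at most 2 in
    the full group of S; it then contains all squares and therefore all rotations.
    Only the pairs at distance 2 on S are not reversed by a rotation, and the
    rotations permute them transitively, so they are the edges of Q.  Now there
    are at least 240 flags, and Gamma(Q) consists of all 240 automorphisms of the
    graph.  The angles of Q are invariant under them; the vertex-figures being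
    connected hexagons, they are the angles hl and f.  At an edge the two faces
    either keep the kind of angle or change it, uniformly for all edges by
    flag-transitivity: the faces are the pentagrams and pentagons in the first
    case, and the skew quadrangles in the second. *)

Require Import Defs.
From HB Require Import structures.
From mathcomp Require Import all_boot all_order all_algebra all_fingroup.
From mathcomp Require Import finmap boolp reals.
From mathcomp Require Import ring lra.
Set Implicit Arguments.
Unset Strict Implicit.
Unset Printing Implicit Defensive.
Import Order.TTheory GRing.Theory Num.Theory.
Local Open Scope fset_scope.
Local Open Scope ring_scope.

(** Everything is reduced to lists of numbers below 20. By [dodecahedron_frame] a dodecahedron is
    the image of the twenty standard vertices under [x *m A + b], with [A] a multiple of an
    orthogonal matrix and, S being centrally symmetric, of positive determinant; [pt A b i] is
    vertex [i]. Isometries and graph automorphisms become permutation lists, the two polyhedra the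
    face lists [F1] and [F2], and geometric conditions Boolean tests. That only the angles hl and f
    occur rests on the six neighbours of a vertex, which fall into two triads, the orbits of the
    threefold rotation. Two neighbours in one triad cannot form an angle: all such pairs would then
    be angles and exhaust the two angles at each edge, so that the vertex-figure would be
    disconnected. Between the triads a neighbour has three partners. Two of them give the angles of
    [F1], which are equivalent under the automorphisms; the third alone cannot supply the two angles
    that an edge has at its end. So one angle of [F1] occurs, hence all of them, and they leave room
    for no other. *)

Section Golden.
Variable R : realType.
Notation golden := (golden R).

(** * Exact arithmetic and signs in Z[golden] *)

Lemma golden_gt0 : 0 < golden.
Proof. by rewrite divr_gt0 // addr_gt0 // sqrtr_gt0. Qed.

Lemma golden_sqr : golden * golden = golden + 1.
Proof.
have h5 : Num.sqrt (5 : R) * Num.sqrt 5 = 5 by rewrite -expr2 sqr_sqrtr.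
rewrite /Defs.golden; move: (Num.sqrt 5) h5 => s h5; lra.
Qed.

Lemma golden_inv : golden^-1 = golden - 1.
Proof.
apply: (mulfI (lt0r_neq0 golden_gt0)).
by rewrite divff ?lt0r_neq0 ?golden_gt0 // mulrBr mulr1 golden_sqr addrAC subrr add0r.
Qed.

(* The pair (a, b) stands for a + b * golden. *)
Definition zphi := (int * int)%type.
Definition zadd (p q : zphi) : zphi := (p.1 + q.1, p.2 + q.2).
Definition zsub (p q : zphi) : zphi := (p.1 - q.1, p.2 - q.2).
Definition zmul (p q : zphi) : zphi :=
  (p.1 * q.1 + p.2 * q.2, p.1 * q.2 + p.2 * q.1 + p.2 * q.2).

(* With x = 2 a + b and y = b the sign is that of x + y * sqrt 5. *)
Definition zpos (p : zphi) : bool :=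
  let y := p.2 in let x := p.1 + p.1 + y in
  if 0 <= x then if 0 <= y then (0 < x) || (0 < y) else (5 * (y * y) < x * x)
  else (0 < y) && (x * x < 5 * (y * y)).

Definition zval (p : zphi) : R := p.1%:~R + p.2%:~R * golden.

Lemma zvalD p q : zval (zadd p q) = zval p + zval q.
Proof. by rewrite /zval /= !rmorphD /=; ring. Qed.

Lemma zvalB p q : zval (zsub p q) = zval p - zval q.
Proof. by rewrite /zval /= !rmorphB /=; ring. Qed.

Lemma zvalM p q : zval (zmul p q) = zval p * zval q.
Proof.
rewrite /zval /= !rmorphD !rmorphM /=.
have := golden_sqr; move: golden => g hg.
transitivity (p.1%:~R * q.1%:~R + (p.1%:~R * q.2%:~R + p.2%:~R * q.1%:~R) * g
  + p.2%:~R * q.2%:~R * (g + 1)); first by ring.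
by rewrite -hg; ring.
Qed.

Lemma zval_gt0 p : (0 < zval p) = zpos p.
Proof.
have h5 : Num.sqrt (5 : R) * Num.sqrt 5 = 5 by rewrite -expr2 sqr_sqrtr.
have s0 : 0 < Num.sqrt (5 : R) by rewrite sqrtr_gt0.
(* Doubling clears the denominator of [golden]: 2 (a + b golden) = (2 a + b) + b sqrt 5. *)
have -> : zval p = ((p.1 + p.1 + p.2)%:~R + p.2%:~R * Num.sqrt 5) / 2.
  by rewrite /zval /Defs.golden !rmorphD /=; field.
rewrite pmulr_lgt0 ?invr_gt0 // /zpos /=.
have main (x y : R) : (0 < x + y * Num.sqrt 5) =
    (if 0 <= x then if 0 <= y then (0 < x) || (0 < y) else 5 * (y * y) < x * x
     else (0 < y) && (x * x < 5 * (y * y))); last first.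
  by rewrite main -!(ltr_int R) -!(ler_int R) !rmorphM.
move: (Num.sqrt (5 : R)) h5 s0 => s h5 s0.
(* With t = y sqrt 5 the sign of x + t is clear when x and t agree in sign; otherwise it is decided
   by comparing the squares of x and t. *)
have E2 : (5 * (y * y) = (y * s) * (y * s)) by rewrite mulrACA h5 mulrC.
rewrite E2; set t := y * s.
have yt : (0 <= y) = (0 <= t) by rewrite pmulr_lge0.
have yt' : (0 < y) = (0 < t) by rewrite pmulr_lgt0.
rewrite yt yt' /=; case: (lerP 0 x) => hx; case: (lerP 0 t) => ht /=.
- apply/idP/orP => [h|]; last by case=> h; lra.
  by case: (ltP 0 x) => h'; [left|right; lra].
- rewrite -!expr2 -(sqrrN t) ltr_pXn2r ?nnegrE //; last by rewrite oppr_ge0 ltW.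
  by rewrite -subr_gt0 opprK addrC addrC.
- rewrite -!expr2 -(sqrrN x) ltr_pXn2r ?nnegrE //; last by rewrite oppr_ge0 ltW.
  case: (ltP 0 t) => h; first by rewrite -[RHS]subr_gt0 opprK addrC.
  by apply/negbTE; rewrite -leNgt; lra.
- by rewrite (ltNge 0 t) (ltW ht) /=; apply/negbTE; rewrite -leNgt; lra.
Qed.

Lemma zval0 : zval (0, 0) = 0. Proof. by rewrite /zval mul0r addr0. Qed.

Definition zvec := (zphi * zphi * zphi)%type.
Definition zvval (v : zvec) : E3 R := vec (zval v.1.1) (zval v.1.2) (zval v.2).
Definition zvsub (u v : zvec) : zvec :=
  (zsub u.1.1 v.1.1, zsub u.1.2 v.1.2, zsub u.2 v.2).
Definition zdot (u v : zvec) : zphi :=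
  zadd (zmul u.1.1 v.1.1) (zadd (zmul u.1.2 v.1.2) (zmul u.2 v.2)).
Definition ztriple (u v w : zvec) : zphi :=
  zadd (zsub (zmul u.1.1 (zsub (zmul v.1.2 w.2) (zmul v.2 w.1.2)))
             (zmul u.1.2 (zsub (zmul v.1.1 w.2) (zmul v.2 w.1.1))))
       (zmul u.2 (zsub (zmul v.1.1 w.1.2) (zmul v.1.2 w.1.1))).

Lemma zvvalB u v : zvval (zvsub u v) = zvval u - zvval v.
Proof.
apply/rowP => i; rewrite !mxE.
by case: i => -[|[|[|]]] //= _; rewrite zvalB.
Qed.

Lemma zdotE u v : dot (zvval u) (zvval v) = zval (zdot u v).
Proof.
rewrite /dot !big_ord_recl big_ord0 !mxE /= !zvalD !zvalM.
by rewrite addr0.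
Qed.

Lemma triple_vec (a b c d e f p q r : R) :
  triple (vec a b c) (vec d e f) (vec p q r) =
  a * (e * r - f * q) - b * (d * r - f * p) + c * (d * q - e * p).
Proof.
have -> : triple (vec a b c) (vec d e f) (vec p q r) =
  \det (\matrix_(i < 3, j < 3) (nth [::] [:: [:: a; b; c]; [:: d; e; f]; [:: p; q; r]] i)`_j).
  rewrite /triple; congr (\det _); apply/matrixP => i j; rewrite !mxE.
  case: splitP => k ik; first by rewrite mxE ik (ord1 k).
  by rewrite mxE; case: splitP => l kl; rewrite mxE ik kl (ord1 l).
rewrite !(expand_det_row _ ord0) !(big_ord_recl, big_ord0) /cofactor.
rewrite !(expand_det_row _ ord0) !(big_ord_recl, big_ord0) /cofactor !det_mx11 !mxE /=.
by rewrite /bump /= !addn0 !expr0 !expr1 /=; ring.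
Qed.

Lemma ztripleE u v w : triple (zvval u) (zvval v) (zvval w) = zval (ztriple u v w).
Proof. by rewrite triple_vec !zvalD !zvalM !zvalB !zvalM !zvalB !zvalM. Qed.

End Golden.

(** * Similarities of space as affine maps *)

Section Affine.
Variable R : realType.
Implicit Types (u v w x y o b c : E3 R) (A B M : 'M[R]_3) (k : R).

Lemma dotE u v : dot u v = (u *m v^T) 0 0.
Proof. by rewrite mxE; apply: eq_bigr => i _; rewrite mxE. Qed.

Lemma dotC u v : dot u v = dot v u.
Proof. by apply: eq_bigr => i _; rewrite mulrC. Qed.

Lemma dotBl u v w : dot (u - v) w = dot u w - dot v w.
Proof. by rewrite !dotE mulmxBl !mxE. Qed.

Lemma dotBr u v w : dot w (u - v) = dot w u - dot w v.
Proof. by rewrite !(dotC w) dotBl. Qed.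

Lemma dot_ge0 u : 0 <= dot u u.
Proof. by apply: sumr_ge0 => i _; rewrite -expr2 sqr_ge0. Qed.

Lemma dot_eq0 u : dot u u = 0 -> u = 0.
Proof.
move=> h; apply/rowP => i; rewrite mxE; apply/eqP.
rewrite -sqrf_eq0 expr2; apply/eqP; apply: (psumr_eq0P _ h) => // j _.
by rewrite -expr2 sqr_ge0.
Qed.

Lemma dot_delta u i : dot u (delta_mx 0 i) = u 0 i.
Proof.
rewrite /dot (bigD1 i) //= big1 ?addr0 => [|j ji]; first by rewrite !mxE !eqxx mulr1.
by rewrite !mxE (negbTE ji) andbF mulr0.
Qed.

(** Points are row vectors and matrices act on the right: [A] is k times an orthogonal matrix. *)
Definition scaling k A := 0 < k /\ A *m A^T = (k ^+ 2)%:M.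

Lemma dot_scaling k A u v : scaling k A -> dot (u *m A) (v *m A) = k ^+ 2 * dot u v.
Proof.
case=> _ h; rewrite !dotE trmx_mul mulmxA -(mulmxA u) h mul_mx_scalar -scalemxAl.
by rewrite mxE.
Qed.

Lemma edist_scaling k A b u v : scaling k A ->
  edist (u *m A + b) (v *m A + b) = k * edist u v.
Proof.
move=> kA; rewrite /edist opprD addrACA subrr addr0 -mulmxBl (dot_scaling _ _ kA).
by rewrite sqrtrM ?sqr_ge0 // sqrtr_sqr ger0_norm // ltW //; case: kA.
Qed.

Lemma triple_mulmx A u v w :
  triple (u *m A) (v *m A) (w *m A) = triple u v w * \det A.
Proof. by rewrite /triple -[in RHS]det_mulmx -!mul_col_mx. Qed.

Lemma edist_sqr x y : edist x y ^+ 2 = dot (x - y) (x - y).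
Proof. by rewrite sqr_sqrtr ?dot_ge0. Qed.

Lemma edist0_eq x y : edist x y = 0 -> x = y.
Proof.
by move=> h; apply/eqP; rewrite -subr_eq0; apply/eqP/dot_eq0; rewrite -edist_sqr h expr0n.
Qed.

Lemma edistxx x : edist x x = 0.
Proof. by rewrite /edist subrr dotE mul0mx mxE sqrtr0. Qed.

Lemma scaling_tr k A : scaling k A -> A^T *m A = (k ^+ 2)%:M.
Proof.
move=> [k0 AA]; have k2 : k ^+ 2 != 0 by rewrite expf_neq0 // lt0r_neq0.
have /mulmx1C : A *m ((k ^+ 2)^-1 *: A^T) = 1%:M.
  by rewrite -scalemxAr AA scale_scalar_mx mulVf.
by rewrite -scalemxAl => e; rewrite -scalemx1 -e scalerA divff // scale1r.
Qed.

(** After subtracting [g 0], polarization shows that all dot products are multiplied by k squared.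
    The matrix [A] of the images of the unit vectors then satisfies [h x *m A^T = k ^+ 2 *: x], and
    multiplying by [A] on the right recovers [h x]. *)
Lemma similarity_affine g k : 0 < k -> (forall x y, edist (g x) (g y) = k * edist x y) ->
  exists2 A, scaling k A & forall x, g x = x *m A + g 0.
Proof.
move=> k0 gk; pose h x := g x - g 0.
have hB x y : dot (h x - h y) (h x - h y) = k ^+ 2 * dot (x - y) (x - y).
  by rewrite /h opprB addrA subrK -!edist_sqr gk exprMn.
have h0 : h 0 = 0 by rewrite /h subrr.
have gE x : g x = h x + g 0 by rewrite /h subrK.
clearbody h.
have hN x : dot (h x) (h x) = k ^+ 2 * dot x x by have := hB x 0; rewrite h0 !subr0.
have hd x y : dot (h x) (h y) = k ^+ 2 * dot x y.
  have := hB x y; rewrite !dotBl !dotBr !hN (dotC (h y)) (dotC y); lra.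
pose A := \matrix_(i, j) h (delta_mx 0 i) 0 j.
have rA i : row i A = h (delta_mx 0 i) by apply/rowP => j; rewrite !mxE.
have hA x : h x *m A^T = k ^+ 2 *: x.
  apply/rowP => j; rewrite !mxE -(dot_delta x) -hd.
  by apply: eq_bigr => i _; rewrite !mxE.
have AA : A *m A^T = (k ^+ 2)%:M.
  by apply/row_matrixP => i; rewrite row_mul rA hA rowE mul_mx_scalar.
have k2 : k ^+ 2 != 0 by rewrite expf_neq0 // lt0r_neq0.
exists A; first by split.
move=> x; rewrite gE; congr (_ + _).
by apply: (scalerI k2); rewrite scalemxAl -(hA x) -mulmxA (scaling_tr (conj k0 AA)) mul_mx_scalar.
Qed.

Lemma isometry_affine g : Defs.isometry g ->
  exists2 A, scaling 1 A & forall x, g x = x *m A + g 0.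
Proof. by move=> gi; apply: similarity_affine => // x y; rewrite gi mul1r. Qed.

(** An isometry multiplies every triple product by the determinant of its linear part, so one
    nondegenerate triple that is preserved forces this determinant to be 1. *)
Lemma isometry_direct g o x y z : Defs.isometry g ->
  triple (x - o) (y - o) (z - o) != 0 ->
  triple (g x - g o) (g y - g o) (g z - g o) = triple (x - o) (y - o) (z - o) ->
  direct g.
Proof.
move=> /isometry_affine [A _ gA] t0; have gB u v : g u - g v = (u - v) *m A.
  by rewrite (gA u) (gA v) opprD addrACA subrr addr0 mulmxBl.
rewrite !gB triple_mulmx -[X in _ = X -> _]mulr1 => /(mulfI t0) d1 o' x' y' z'.
by rewrite !gB triple_mulmx d1 mulr1.
Qed.

Lemma scaling_det k A : scaling k A -> \det A != 0.
Proof.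
case=> k0 /(congr1 determinant); rewrite det_mulmx det_scalar det_tr => h.
apply/eqP => d0; move: h; rewrite d0 mul0r => /esym/eqP.
by rewrite expf_eq0 /= expf_eq0 /= (gt_eqF k0).
Qed.

Lemma scaling_mul k l A B : scaling k A -> scaling l B -> scaling (k * l) (A *m B).
Proof.
move=> [k0 AA] [l0 BB]; split; first exact: mulr_gt0.
rewrite trmx_mul mulmxA -(mulmxA A) BB mul_mx_scalar -scalemxAl AA.
by rewrite scale_scalar_mx exprMn mulrC.
Qed.

(** The inverse of [A] is its transpose divided by k squared, so the map from one frame to another
    is explicit. It yields isometries when both frames have the same ratio, and similarities between
    different dodecahedra. *)
Lemma scaling_map k l A B b c : scaling k A -> scaling l B ->
  exists2 g : E3 R -> E3 R, (forall x y, edist (g x) (g y) = l / k * edist x y) &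
    forall u, g (u *m A + b) = u *m B + c.
Proof.
move=> kA lB; have k0 := proj1 kA; have k2 : k ^+ 2 != 0 by rewrite expf_neq0 // lt0r_neq0.
pose C := (k ^+ 2)^-1 *: A^T.
have sC : scaling k^-1 C.
  split; first by rewrite invr_gt0.
  rewrite /C linearZ /= trmxK -scalemxAl -scalemxAr (scaling_tr kA) !scale_scalar_mx.
  by rewrite mulVf // mulr1 exprVn.
exists (fun x => (x - b) *m (C *m B) + c) => [x y|u].
  by rewrite (edist_scaling _ _ _ (scaling_mul sC lB)) (mulrC l) /edist opprB addrA subrK.
rewrite addrK mulmxA -(mulmxA u) /C -scalemxAr (proj2 kA) scale_scalar_mx mulVf //.
by rewrite mulmx1.
Qed.

End Affine.

(** * Vertices, symmetries and candidate faces as lists of numbers *)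

Definition coords : seq zvec :=
  let o : zphi := (0, 0) in let e : zphi := (1, 0) in let e' : zphi := (-1, 0) in
  let f : zphi := (0, 1) in let f' : zphi := (0, -1) in
  let h : zphi := (-1, 1) in let h' : zphi := (1, -1) in
  [:: (e, e, e); (e, e, e'); (e, e', e); (e, e', e');
      (e', e, e); (e', e, e'); (e', e', e); (e', e', e');
      (o, h, f); (o, h, f'); (o, h', f); (o, h', f');
      (h, f, o); (h, f', o); (h', f, o); (h', f', o);
      (f, o, h); (f', o, h); (f, o, h'); (f', o, h')].

Definition dz (i : nat) : zvec := nth ((0, 0), (0, 0), (0, 0)) coords i.

Definition zdist2 (i j : nat) : zphi := let v := zvsub (dz i) (dz j) in zdot v v.

(* The squared distances of vertices at graph distance 0, ..., 5. *)
Definition sqdists : seq zphi :=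
  [:: (0, 0); (8, -4); (4, 0); (8, 0); (4, 4); (12, 0)].

Local Open Scope nat_scope.

Definition vtx := iota 0 20.

(** On a dodecahedron the Euclidean distance of two vertices determines their graph distance, so the
    table is filled by looking up squared distances; [D_step] and [D_lipschitz] then confirm that it
    is the graph distance. *)
Definition dist_table : seq (seq nat) :=
  Eval vm_compute in [seq [seq index (zdist2 i j) sqdists | j <- vtx] | i <- vtx].

Definition D (i j : nat) : nat := nth 0 (nth [::] dist_table i) j.

Section Search.
Variable r : nat -> nat -> nat.

(** [p] holds the images chosen so far, the latest first, so its head is the image of [size p']; [v]
    is the proposed image of [k]. Nested [if] avoids the strict evaluation of both arguments of [&&]
    during computation, here and in later tests. *)
Fixpoint fits (k v : nat) (p : seq nat) : bool :=
  if p is w :: p' then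
    if w == v then false else
    if r (size p') k == r w v then fits k v p' else false
  else true.

Fixpoint search (k : nat) : seq (seq nat) :=
  if k is k'.+1 then
    flatten [seq [seq v :: p | v <- [seq v <- vtx | fits k' v p]] | p <- search k']
  else [:: [::]].

(** Every initial segment of an injection preserving [r] passes the tests of [fits], hence survives
    its stage of the search. Segments appear reversed because the search adds new images in
    front. *)
Lemma search_complete (f : nat -> nat) n : n <= 20 ->
  (forall i, i < 20 -> f i < 20) ->
  (forall i j, i < 20 -> j < 20 -> f i = f j -> i = j) ->
  (forall i j, i < 20 -> j < 20 -> r (f i) (f j) = r i j) ->
  rev [seq f i | i <- iota 0 n] \in search n.
Proof.
move=> n20 fV fI fr; elim: n n20 => [|n IHn] n20 //.
have -> : rev [seq f i | i <- iota 0 n.+1] = f n :: rev [seq f i | i <- iota 0 n].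
  by rewrite -addn1 iotaD add0n map_cat rev_cat.
apply/flattenP; exists [seq v :: rev [seq f i | i <- iota 0 n]
  | v <- [seq v <- vtx | fits n v (rev [seq f i | i <- iota 0 n])]].
  exact/map_f/IHn/ltnW.
apply: map_f; rewrite mem_filter mem_iota /= fV // andbT.
suff H m : m <= n -> fits n (f n) (rev [seq f i | i <- iota 0 m]) by exact: H.
elim: m => [|m IHm] mn //.
have -> : rev [seq f i | i <- iota 0 m.+1] = f m :: rev [seq f i | i <- iota 0 m].
  by rewrite -addn1 iotaD add0n map_cat rev_cat.
have m20 : m < 20 := ltn_trans mn n20.
rewrite /= size_rev size_map size_iota fr // eqxx.
case: eqP => [/fI e|_]; first by move: mn; rewrite e // ltnn.
exact: IHm (ltnW mn).
Qed.

Lemma search_code (f : nat -> nat) :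
  (forall i, i < 20 -> f i < 20) ->
  (forall i j, i < 20 -> j < 20 -> f i = f j -> i = j) ->
  (forall i j, i < 20 -> j < 20 -> r (f i) (f j) = r i j) ->
  [seq f i | i <- vtx] \in [seq rev p | p <- search 20].
Proof.
move=> fV fI fr; apply/mapP; exists (rev [seq f i | i <- vtx]); last by rewrite revK.
exact: search_complete.
Qed.

End Search.

Definition isoms : seq (seq nat) := Eval vm_compute in [seq rev p | p <- search D 20].

Definition D2 (i j : nat) : nat := D i j == 2.

Definition autos : seq (seq nat) := Eval vm_compute in [seq rev p | p <- search D2 20].

Definition ap (s : seq nat) (i : nat) : nat := nth 0 s i.

(** The diagonals of the twelve faces of S. In this table and those of [pentagons] and [F2], each
    list starts with a left-oriented side, as the notion of shape demands. *)
Definition pentagrams : seq (seq nat) :=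
  [:: [:: 0; 10; 16; 8; 2]; [:: 0; 14; 8; 12; 4]; [:: 0; 18; 12; 16; 1];
      [:: 1; 3; 9; 18; 11]; [:: 1; 5; 12; 9; 14]; [:: 2; 3; 16; 13; 18];
      [:: 2; 6; 13; 10; 15]; [:: 3; 15; 11; 13; 7]; [:: 4; 5; 17; 14; 19];
      [:: 4; 6; 8; 17; 10]; [:: 5; 11; 19; 9; 7]; [:: 6; 19; 15; 17; 7]].

Definition pentagons : seq (seq nat) :=
  [:: [:: 0; 10; 15; 11; 1]; [:: 0; 14; 19; 15; 2]; [:: 0; 18; 11; 19; 4];
      [:: 1; 3; 15; 17; 14]; [:: 1; 5; 17; 10; 16]; [:: 2; 3; 9; 14; 8];
      [:: 2; 6; 19; 9; 18]; [:: 3; 16; 8; 17; 7]; [:: 4; 5; 11; 13; 10];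
      [:: 4; 6; 13; 18; 12]; [:: 5; 12; 16; 13; 7]; [:: 6; 8; 12; 9; 7]].

Definition F1 := pentagrams ++ pentagons.

(** The Petrie polygons of [F1], as [petrie_dual12] confirms; each list is arranged so that its
    first turn is hl. *)
Definition F2 : seq (seq nat) :=
  [:: [:: 0; 10; 16; 1]; [:: 0; 14; 8; 2]; [:: 0; 18; 12; 4]; [:: 1; 0; 18; 11];
      [:: 1; 3; 9; 14]; [:: 1; 5; 12; 16]; [:: 2; 0; 10; 15]; [:: 2; 3; 16; 8];
      [:: 2; 6; 13; 18]; [:: 3; 9; 18; 2]; [:: 3; 15; 11; 1]; [:: 3; 16; 13; 7];
      [:: 4; 0; 14; 19]; [:: 4; 5; 17; 10]; [:: 4; 6; 8; 12]; [:: 5; 11; 19; 4];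
      [:: 5; 12; 9; 7]; [:: 5; 17; 14; 1]; [:: 6; 8; 17; 7]; [:: 6; 13; 10; 4];
      [:: 6; 19; 15; 2]; [:: 7; 3; 15; 17]; [:: 7; 5; 11; 13]; [:: 7; 6; 19; 9];
      [:: 8; 17; 10; 16]; [:: 9; 18; 11; 19]; [:: 12; 9; 14; 8]; [:: 13; 10; 15; 11];
      [:: 16; 13; 18; 12]; [:: 17; 14; 19; 15]].

Local Open Scope fset_scope.
Local Open Scope ring_scope.

(** * Images of finite sets *)

Section FinSets.
Variables (K L : choiceType).
Implicit Types (A B V : {fset K}) (h : K -> L).

(** Injectivity is asked on a set [V] only, since the maps that realize permutation lists ([vmap])
    are injective on the vertices but not on the whole space. *)
Lemma mem_im_in h V A x : {in V &, injective h} -> A `<=` V -> x \in V ->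
  (h x \in [fset h y | y in A]) = (x \in A).
Proof.
move=> hI /fsubsetP AV xV; apply/imfsetP/idP => [[y yA /hI]|xA]; last by exists x.
by move=> ->//; apply: AV.
Qed.

Lemma im_inj_in h V A B : {in V &, injective h} -> A `<=` V -> B `<=` V ->
  [fset h x | x in A] = [fset h x | x in B] -> A = B.
Proof.
move=> hI AV BV /fsetP e; apply/fsetP => x.
case: (boolP (x \in V)) => xV.
  by rewrite -(mem_im_in hI AV xV) e (mem_im_in hI BV xV).
have nx C : C `<=` V -> (x \in C) = false.
  by move=> /fsubsetP CV; apply/negbTE; apply: contra xV; exact: CV.
by rewrite !nx.
Qed.

Lemma card_fset_sub A (p : pred K) : #|` [fset x in A | p x]| = #|[pred x : A | p (val x)]|.
Proof.
have -> : [fset x in A | p x] = [fset val x | x in [pred x : A | p (val x)]].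
  apply/fsetP => x; rewrite !inE; apply/andP/imfsetP => /= [[xA px]|[y yp ->]].
    by exists [` xA].
  by split; [exact: valP | exact: yp].
rewrite card_imfset; last exact: val_inj.
by rewrite cardE.
Qed.

End FinSets.

Lemma imfset_perm (K : choiceType) (A : {fset K}) (h : K -> K) :
  {in A &, injective h} -> [fset h x | x in A] = A ->
  exists p : {perm A}, forall x, val (p x) = h (val x).
Proof.
move=> hI hA; have hin (x : A) : h (val x) \in A.
  by rewrite -[X in _ \in X]hA; apply: in_imfset; exact: valP.
have fI : injective (fun x : A => [` hin x]).
  by move=> x y /(congr1 val) /= /hI e; apply/val_inj/e; exact: valP.
by exists (perm fI) => x; rewrite permE.
Qed.

(** * Automorphisms, symmetries and flags *)

Section Automorphisms.
Variable R : realType.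
Implicit Types (P Q : polyhedron R) (g h : E3 R -> E3 R).

Lemma im_edge2 h x y : im_edge h [fset x; y] = [fset h x; h y].
Proof. by rewrite /im_edge imfsetU !imfset_fset1. Qed.

Lemma im_edge_comp g h e : im_edge g (im_edge h e) = im_edge (g \o h) e.
Proof. by rewrite /im_edge -imfset_comp. Qed.

Lemma im_face_comp g h f : im_face g (im_face h f) = im_face (g \o h) f.
Proof.
rewrite /im_face -imfset_comp; apply: eq_imfset => // e /=.
exact: im_edge_comp.
Qed.

Lemma im_poly_comp g h P : im_poly g (im_poly h P) = im_poly (g \o h) P.
Proof.
rewrite /im_poly /=; congr Polyhedron; [exact: im_edge_comp | exact: im_face_comp |].
by rewrite -imfset_comp; apply: eq_imfset => // f /=; exact: im_face_comp.
Qed.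

Lemma eq_im_edge h h' (e : edge R) : {in e, h =1 h'} -> im_edge h e = im_edge h' e.
Proof. by move=> hh; apply: eq_in_imfset. Qed.

Lemma eq_im_face h h' (f : face R) :
  (forall e x, e \in f -> x \in e -> h x = h' x) -> im_face h f = im_face h' f.
Proof. by move=> hh; apply: eq_in_imfset => e ef; apply: eq_im_edge => x; exact: hh. Qed.

Lemma im_edge_id (e : edge R) : im_edge id e = e.
Proof. by apply/fsetP => x; apply/imfsetP/idP => [[y ye ->]|xe] //; exists x. Qed.

Lemma im_face_id (f : face R) : im_face id f = f.
Proof.
apply/fsetP => x; apply/imfsetP/idP => [[y ye ->]|xe]; first by rewrite im_edge_id.
by exists x => //; rewrite im_edge_id.
Qed.

Lemma im_poly_id P : im_poly id P = P.
Proof.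
case: P => V E F; rewrite /im_poly /= im_edge_id im_face_id; congr Polyhedron.
apply/fsetP => x; apply/imfsetP/idP => [[y ye ->]|xe]; first by rewrite im_face_id.
by exists x => //; rewrite im_face_id.
Qed.

Lemma isometry_inj g : Defs.isometry g -> injective g.
Proof. by move=> gi x y e; apply: edist0_eq; rewrite -gi e edistxx. Qed.

Lemma symmetry_id P : Defs.symmetry P id.
Proof. by split; [move=> x y | exact: im_poly_id]. Qed.

Lemma symmetry_comp P g h :
  Defs.symmetry P g -> Defs.symmetry P h -> Defs.symmetry P (g \o h).
Proof.
move=> [gi gP] [hi hP]; split; first by move=> x y /=; rewrite gi hi.
by rewrite -im_poly_comp hP.
Qed.

Definition subcomplex P :=
  (forall e, e \in pedges P -> e `<=` pverts P) /\
  (forall f, f \in pfaces P -> f `<=` pedges P).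

Lemma polyhedron_subcomplex P : is_polyhedron P -> subcomplex P.
Proof. by case=> _ hE hF _ _; split=> [e /hE []|f /hF []]. Qed.

(** Extending the vertex permutation by the identity makes it a map of space, so that [im_edge],
    [im_face] and [im_poly] serve for automorphisms as well as for symmetries. *)
Definition vact P (a : poset_perm P) (x : E3 R) : E3 R :=
  if insub x is Some y then val (a.1.1 y) else x.

Lemma vactE P (a : poset_perm P) (x : pverts P) : vact a (val x) = val (a.1.1 x).
Proof. by rewrite /vact valK. Qed.

Lemma vact_in P (a : poset_perm P) x : x \in pverts P -> vact a x \in pverts P.
Proof. by move=> xP; rewrite (vactE a [` xP]); exact: valP. Qed.

Lemma vact_inj P (a : poset_perm P) : {in pverts P &, injective (vact a)}.
Proof.
move=> x y xP yP; rewrite (vactE a [` xP]) (vactE a [` yP]) => /val_inj /perm_inj.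
by move/(congr1 val).
Qed.

Lemma vactM P (a b : poset_perm P) x :
  x \in pverts P -> vact (a * b)%g x = vact b (vact a x).
Proof. by move=> xP; rewrite (vactE _ [` xP]) (vactE a [` xP]) vactE permM. Qed.

Lemma vact1 P x : vact (1%g : poset_perm P) x = x.
Proof. by rewrite /vact; case: insubP => //= u _ <-; rewrite perm1. Qed.

Lemma GammaP P (a : poset_perm P) :
  reflect ((forall (x : pverts P) (e : pedges P),
              (val (a.1.1 x) \in val (a.1.2 e)) = (val x \in val e)) /\
           (forall (e : pedges P) (f : pfaces P),
              (val (a.1.2 e) \in val (a.2 f)) = (val e \in val f)))
          (a \in Gamma P).
Proof.
rewrite inE; apply: (iffP andP) => [[h1 h2]|[h1 h2]]; split.
- by move=> x e; move/forallP/(_ x)/forallP/(_ e)/eqP: h1.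
- by move=> x e; move/forallP/(_ x)/forallP/(_ e)/eqP: h2.
- by apply/forallP => x; apply/forallP => e; rewrite h1.
- by apply/forallP => x; apply/forallP => e; rewrite h2.
Qed.

Lemma Gamma_group_set P : group_set (Gamma P).
Proof.
apply/group_setP; split.
  by apply/GammaP; split=> [x e|e f]; rewrite !perm1.
move=> a b /GammaP [a1 a2] /GammaP [b1 b2]; apply/GammaP.
by split=> [x e|e f]; rewrite !permM ?b1 ?b2.
Qed.

Section Act.
Variable P : polyhedron R.
Hypothesis sP : subcomplex P.

Lemma Gamma_edge (a : poset_perm P) (e : pedges P) :
  a \in Gamma P -> val (a.1.2 e) = im_edge (vact a) (val e).
Proof.
move=> /GammaP [a1 _]; apply/fsetP => y; apply/idP/imfsetP => /= [ye|[x xe ->]].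
  have yP : y \in pverts P by move: y ye; apply/fsubsetP; apply: (proj1 sP); exact: valP.
  have ey : y = val (a.1.1 (a.1.1^-1%g [` yP])) by rewrite permKV.
  exists (val (a.1.1^-1%g [` yP])); last by rewrite vactE.
  by rewrite -a1 -ey.
have xP : x \in pverts P by move: x xe; apply/fsubsetP; apply: (proj1 sP); exact: valP.
by rewrite (vactE a [` xP]) a1.
Qed.

Lemma Gamma_face (a : poset_perm P) (f : pfaces P) :
  a \in Gamma P -> val (a.2 f) = im_face (vact a) (val f).
Proof.
move=> aG; have /GammaP [_ a2] := aG; apply/fsetP => y; apply/idP/imfsetP => /= [ye|[x xe ->]].
  have yP : y \in pedges P by move: y ye; apply/fsubsetP; apply: (proj2 sP); exact: valP.
  have ey : y = val (a.1.2 (a.1.2^-1%g [` yP])) by rewrite permKV.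
  exists (val (a.1.2^-1%g [` yP])); last by rewrite -Gamma_edge // permKV.
  by rewrite -a2 -ey.
have xP : x \in pedges P by move: x xe; apply/fsubsetP; apply: (proj2 sP); exact: valP.
by rewrite -(Gamma_edge [` xP] aG) a2.
Qed.

Lemma Gamma_im (a : poset_perm P) : a \in Gamma P -> im_poly (vact a) P = P.
Proof.
move=> aG; case E: P a aG sP => [V E' F]; rewrite -E => {V E' F E} a aG _.
have e1 : im_edge (vact a) (pverts P) = pverts P.
  apply/fsetP => y; apply/imfsetP/idP => /= [[x xP ->]|yP]; first exact: vact_in.
  by exists (val (a.1.1^-1%g [` yP])); [exact: valP | rewrite vactE permKV].
have e2 : im_face (vact a) (pedges P) = pedges P.
  apply/fsetP => y; apply/imfsetP/idP => /= [[x xP ->]|yP].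
    by rewrite -(Gamma_edge [` xP] aG); exact: valP.
  exists (val (a.1.2^-1%g [` yP])); first exact: valP.
  by rewrite -Gamma_edge // permKV.
have e3 : [fset im_face (vact a) f | f in pfaces P] = pfaces P.
  apply/fsetP => y; apply/imfsetP/idP => /= [[x xP ->]|yP].
    by rewrite -(Gamma_face [` xP] aG); exact: valP.
  exists (val (a.2^-1%g [` yP])); first exact: valP.
  by rewrite -Gamma_face // permKV.
by rewrite /im_poly e1 e2 e3; case: (P).
Qed.

(** Edges are sets of vertices and faces sets of edges, so the action on the vertices determines the
    two other permutations. *)
Lemma Gamma_eq (a b : poset_perm P) : a \in Gamma P -> b \in Gamma P ->
  {in pverts P, vact a =1 vact b} -> a = b.
Proof.
move=> aG bG ab.
have eV : a.1.1 = b.1.1.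
  by apply/permP => x; apply/val_inj; rewrite -!vactE; apply: ab; exact: valP.
have abe (e : pedges P) x : x \in val e -> vact a x = vact b x.
  move=> xe; apply: ab; move: x xe; apply/fsubsetP; apply: (proj1 sP); exact: valP.
have eE : a.1.2 = b.1.2.
  apply/permP => e; apply/val_inj; rewrite !Gamma_edge //.
  by apply: eq_im_edge => x; exact: abe.
have eF : a.2 = b.2.
  apply/permP => f; apply/val_inj; rewrite !Gamma_face //.
  apply: eq_im_face => e x ef.
  have eP : e \in pedges P by move: e ef; apply/fsubsetP; apply: (proj2 sP); exact: valP.
  exact: (abe [` eP]).
by case: a b eV eE eF {aG bG ab abe} => [[? ?] ?] [[? ?] ?] /= -> -> ->.
Qed.

Lemma Gamma_of h : {in pverts P &, injective h} -> im_poly h P = P ->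
  exists2 a, a \in Gamma P & {in pverts P, vact a =1 h}.
Proof.
move=> hI hP; have [sE sF] := sP.
have hV : [fset h x | x in pverts P] = pverts P by rewrite -[RHS](congr1 (@pverts R) hP).
have hE : [fset im_edge h x | x in pedges P] = pedges P.
  by rewrite -[RHS](congr1 (@pedges R) hP).
have hF : [fset im_face h x | x in pfaces P] = pfaces P.
  by rewrite -[RHS](congr1 (@pfaces R) hP).
have IE : {in pedges P &, injective (im_edge h)}.
  by move=> e e' eP e'P; apply: im_inj_in hI _ _; apply: sE.
have IF : {in pfaces P &, injective (im_face h)}.
  by move=> f f' fP f'P; apply: im_inj_in IE _ _; apply: sF.
have [p pE] := imfset_perm hI hV.
have [q qE] := imfset_perm IE hE.
have [r rE] := imfset_perm IF hF.
exists ((p, q), r); last by move=> x xP; rewrite (vactE _ [` xP]) pE.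
apply/GammaP; split=> [x e|e f] /=.
  rewrite pE qE; apply: (mem_im_in hI); last exact: valP.
  by apply: sE; exact: valP.
rewrite qE rE; apply: (mem_im_in IE); last exact: valP.
by apply: sF; exact: valP.
Qed.

Lemma GP (a : poset_perm P) :
  a \in G P <-> a \in Gamma P /\ exists2 g, Defs.symmetry P g & {in pverts P, vact a =1 g}.
Proof.
rewrite inE; split=> [/asboolP [g gS [gV gE gF]]|[aG [g gS ag]]].
  have gI := isometry_inj (proj1 gS).
  split; last by exists g => // x xP; rewrite (vactE _ [` xP]) gV.
  apply/GammaP; split=> [x e|e f]; first by rewrite gV gE mem_imfset.
  rewrite gE gF mem_imfset //= => e1 e2; apply: (im_inj_in (V := e1 `|` e2)).
  - by move=> ? ? _ _; exact: gI.
  - exact: fsubsetUl.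
  - exact: fsubsetUr.
apply/asboolP; exists g => //; split=> [x|e|f].
- by rewrite -vactE ag //; exact: valP.
- rewrite Gamma_edge //; apply: eq_im_edge => x xe; apply: ag.
  by move: x xe; apply/fsubsetP; apply: (proj1 sP); exact: valP.
- rewrite Gamma_face //; apply: eq_im_face => e x ef xe; apply: ag.
  move: x xe; apply/fsubsetP; apply: (proj1 sP).
  by move: e ef; apply/fsubsetP; apply: (proj2 sP); exact: valP.
Qed.

Lemma G_group_set : group_set (G P).
Proof.
apply/group_setP; split.
  apply/GP; split; first exact: (group1 (group (Gamma_group_set P))).
  by exists id => [|x _]; [exact: symmetry_id | rewrite vact1].
move=> a b /GP [aG [g gS ag]] /GP [bG [h hS bh]]; apply/GP; split.
  exact: (@groupM _ (group (Gamma_group_set P)) a b aG bG).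
exists (h \o g) => [|x xP]; first exact: symmetry_comp.
by rewrite vactM // bh ?vact_in // ag.
Qed.

Lemma G_sub_Gamma : G P \subset Gamma P.
Proof. by apply/subsetP => a /GP []. Qed.

End Act.

Definition flags P : {set pverts P * pedges P * pfaces P} :=
  [set t : pverts P * pedges P * pfaces P | flag t.1.1 t.1.2 t.2].

(** By transitivity, sending an automorphism to the image of one fixed flag is onto the flags. *)
Lemma regular_flags_le P : regular_map P -> (#|flags P| <= #|Gamma P|)%N.
Proof.
move=> rP; have [->|[t0]] := set_0Vmem (flags P); first by rewrite cards0.
rewrite inE => t0f.
apply: leq_trans (leq_imset_card (fun a : poset_perm P =>
  (a.1.1 t0.1.1, a.1.2 t0.1.2, a.2 t0.2)) _).
apply/subset_leq_card/subsetP => t; rewrite inE => tf.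
have [a aG [e1 e2 e3]] := rP _ _ _ _ _ _ t0f tf.
by apply/imsetP; exists a => //; rewrite e1 e2 e3; case: t {tf e1 e2 e3} => [[]].
Qed.

(** A vertex lies on at least m edges, and each of these on two faces. *)
Lemma flags_ge P m :
  (forall e, e \in pedges P -> #|` [fset f in pfaces P | e \in f]| = 2%N) ->
  (forall x, x \in pverts P -> m <= #|` star P x|)%N ->
  (#|` pverts P| * (m * 2) <= #|flags P|)%N.
Proof.
move=> hE hV.
have -> : #|flags P| = (\sum_(x : pverts P) \sum_(e : pedges P | val x \in val e)
    \sum_(f : pfaces P | val e \in val f) 1)%N.
  rewrite -sum1dep_card pair_big_dep /= pair_big_dep /=.
  by apply: eq_bigl => -[[x e] f].
rewrite cardfE -sum_nat_const; apply: leq_sum => x _.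
apply: leq_trans (_ : \sum_(e : pedges P | val x \in val e) 2 <= _)%N.
  rewrite sum_nat_const leq_mul2r /=; apply: leq_trans (hV _ (valP x)) _.
  by rewrite /star card_fset_sub.
apply: leq_sum => e _; have := hE _ (valP e); rewrite sum1_card card_fset_sub => h2.
rewrite -[X in (X <= _)%N]h2.
by apply: subset_leq_card; apply/subsetP.
Qed.

End Automorphisms.

(** * Cycles described by their edges *)

Section Cycles.
Variable T : choiceType.
Implicit Types (s : seq T) (x y z : T) (A : {fset {fset T}}).

Lemma fset2_eq x y z t :
  [fset x; y] = [fset z; t] <-> (x = z /\ y = t) \/ (x = t /\ y = z).
Proof.
split=> [/fsetP e|[[-> ->]|[-> ->]]] //; last exact: fsetUC.
have := e x; have := e y; have := e z; have := e t; rewrite !inE !eqxx !(eq_sym _ x) !(eq_sym _ y) /=.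
rewrite !orbT /=.
case: (eqVneq x z) => [xz|_]; case: (eqVneq y t) => [yt|_]; case: (eqVneq x t) => [xt|_];
  case: (eqVneq y z) => [yz|_] //=; subst; auto.
Qed.

Lemma card_fset2 x y : #|` [fset x; y]| = 2%N -> x != y.
Proof. by rewrite cardfs2; case: eqP. Qed.

Lemma cycle_edgesP s x y : uniq s ->
  reflect (x \in s /\ (y = next s x \/ y = prev s x)) ([fset x; y] \in cycle_edges s).
Proof.
move=> us; apply: (iffP idP) => [/imfsetP [z /= zs /fset2_eq [[-> ->]|[-> ->]]]|].
- by split=> //; left.
- by rewrite mem_next; split=> //; right; rewrite prev_next.
- case=> xs [->|->]; apply/imfsetP; first by exists x.
  by exists (prev s x); rewrite /= ?mem_prev // next_prev // fsetUC.
Qed.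

Lemma next_next s x : uniq s -> (3 <= size s)%N -> x \in s ->
  [/\ next s x != x, next s (next s x) != x & next s x != prev s x].
Proof.
move=> us s3 xs; suff [h1 h2] : next s x != x /\ next s (next s x) != x.
  by split=> //; apply: contra_neq h2 => ->; rewrite next_prev.
have /rot_to [i s' E] := xs.
rewrite -!(next_rot i us) E; have := rot_uniq i s; rewrite us E.
have := size_rot i s; rewrite E; case: s' {E} => [|y [|z t]] sz; try by rewrite -sz in s3.
rewrite !cons_uniq !inE !negb_or /= !eqxx => /andP [/and3P [xy xz _] _].
by rewrite (eq_sym y x) (negbTE xy) eq_sym xz.
Qed.

Lemma cycle_deg A x y z z' : is_cycle A -> [fset x; y] \in A -> [fset y; z] \in A ->
  [fset y; z'] \in A -> x != z -> x != z' -> z = z'.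
Proof.
case=> s [us s3 ->]; rewrite fsetUC => /(cycle_edgesP _ _ us) [ys hx].
move=> /(cycle_edgesP _ _ us) [_ hz] /(cycle_edgesP _ _ us) [_ hz'].
by move: hx hz hz' => [->|->] [->|->] [->|->] //; rewrite eqxx.
Qed.

Lemma cycle_ext A x y : is_cycle A -> [fset x; y] \in A ->
  exists2 z, x != z & [fset y; z] \in A.
Proof.
case=> s [us s3 ->]; rewrite fsetUC => /(cycle_edgesP _ _ us) [ys hx].
have [_ _ np] := next_next us s3 ys.
case: hx => ->; [exists (prev s y) | exists (next s y)] => //.
- by apply/(cycle_edgesP _ _ us); split=> //; right.
- by rewrite eq_sym.
- by apply/(cycle_edgesP _ _ us); split=> //; left.
Qed.

Lemma cycle_edge A e : is_cycle A -> e \in A -> exists x y, x != y /\ e = [fset x; y].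
Proof.
case=> s [us s3 ->] /imfsetP [x /= xs ->]; have [nx _ _] := next_next us s3 xs.
by exists x, (next s x); rewrite eq_sym.
Qed.

Lemma cycle_edge_at A e x : is_cycle A -> e \in A -> x \in e ->
  exists2 y, x != y & e = [fset x; y].
Proof.
move=> cA /(cycle_edge cA) [a [b [ab ->]]]; rewrite !inE => /orP [/eqP->|/eqP->].
  by exists b.
by exists a; [rewrite eq_sym | rewrite fsetUC].
Qed.

Lemma cycle_corner A x y z : is_cycle A -> x != z -> [fset x; y] \in A ->
  [fset y; z] \in A -> [fset e in A | y \in e] = [fset [fset x; y]; [fset y; z]].
Proof.
move=> cA xz xA zA; apply/fsetP => e; rewrite !inE /=; apply/andP/orP => [[eA ye]|].
  have [w yw ew] := cycle_edge_at cA eA ye; rewrite ew in eA *.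
  case: (eqVneq x w) => [->|xw]; first by left; rewrite fsetUC.
  by right; rewrite (cycle_deg cA xA zA eA).
by case=> /eqP->; rewrite ?xA ?zA !inE eqxx ?orbT.
Qed.

(** This is the connectedness of a cycle; it is applied to vertex-figures. *)
Lemma cycle_const A (C : pred T) : is_cycle A ->
  (forall x y, [fset x; y] \in A -> C x = C y) ->
  forall x y e e', e \in A -> x \in e -> e' \in A -> y \in e' -> C x = C y.
Proof.
case=> s [us s3 ->] hC.
have cs : path.cycle (fun a b => C a == C b) s.
  apply: (cycle_from_next us) => x xs; apply/eqP/hC/cycle_edgesP => //; split=> //; by left.
have ts : transitive (fun a b => C a == C b) by move=> a b c /eqP -> /eqP ->.
have [c cC] : exists c, forall x, x \in s -> C x = c.
  case: s cs {us s3 hC} => [|a s] /=; first by exists true.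
  rewrite rcons_path => /andP [/(order_path_min ts) /allP h _]; exists (C a) => x.
  by rewrite inE => /orP [/eqP->|/h /eqP ->].
have inS x e : e \in cycle_edges s -> x \in e -> x \in s.
  by case/imfsetP => a /= as_ ->; rewrite !inE => /orP [] /eqP ->; rewrite ?mem_next.
by move=> x y e e' eA xe e'A ye'; rewrite !cC //; [exact: inS ye' | exact: inS xe].
Qed.

Lemma cycle_walk A : is_cycle A -> exists v : nat -> T,
  (forall i, [fset v i; v i.+1] \in A /\ v i != v i.+2) /\
  (forall e, e \in A <-> exists i, e = [fset v i; v i.+1]).
Proof.
case=> -[|a s] [us s3 ->] //; set t := a :: s in us s3 *.
pose v i := iter i (next t) a.
have vt i : v i \in t.
  by elim: i => [|i IH]; [rewrite inE eqxx | rewrite /v iterS mem_next].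
have ve i : [fset v i; v i.+1] \in cycle_edges t.
  by apply/cycle_edgesP => //; split=> //; left.
exists v; split=> [i|e].
  by split=> //; rewrite eq_sym; have [] := next_next us s3 (vt i).
split=> [/imfsetP [x /= xt ->]|[i ->]] //.
suff [i ->] : exists i, x = v i by exists i.
suff vn i : (i < size t)%N -> v i = nth a t i.
  by exists (index x t); rewrite vn ?nth_index ?index_mem.
elim: i => [|i IH] it //; rewrite /v iterS -/(v i) IH 1?ltnW // next_nth mem_nth 1?ltnW //.
by rewrite index_uniq // ltnW.
Qed.

End Cycles.

(** * Angles of faces and connectedness of vertex-figures *)

Section Surface.
Variables (R : realType) (P : polyhedron R).
Implicit Types (x y z : E3 R) (e : edge R) (f : face R).
Hypothesis polyP : is_polyhedron P.

Definition angle x y z :=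
  x != z /\ exists2 f, f \in pfaces P & [fset x; y] \in f /\ [fset y; z] \in f.

Let hE e : e \in pedges P -> #|` e| = 2%N /\ e `<=` pverts P.
Proof. by case: polyP => _ h _ _ _; exact: h. Qed.
Let hF f : f \in pfaces P -> is_cycle f /\ f `<=` pedges P.
Proof. by case: polyP => _ _ h _ _; exact: h. Qed.
Let hEF e : e \in pedges P -> #|` [fset f in pfaces P | e \in f]| = 2%N.
Proof. by case: polyP => _ _ _ h _; exact: h. Qed.
Let hVF x : x \in pverts P -> is_cycle (vertex_figure P x).
Proof. by case: polyP => _ _ _ _ [h _]; exact: h. Qed.

Lemma face_edge f e : f \in pfaces P -> e \in f -> e \in pedges P.
Proof. by move=> /hF [_ /fsubsetP h]; exact: h. Qed.

Lemma edge_vert x y : [fset x; y] \in pedges P ->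
  [/\ x \in pverts P, y \in pverts P & x != y].
Proof.
move=> /hE [/card_fset2 xy /fsubsetP h].
by split=> //; apply: h; rewrite !inE eqxx ?orbT.
Qed.

Lemma angle_corner f x y z : f \in pfaces P -> x != z -> [fset x; y] \in f ->
  [fset y; z] \in f -> [fset e in f | y \in e] = [fset [fset x; y]; [fset y; z]].
Proof. by move=> fP; apply: cycle_corner; have [] := hF fP. Qed.

Lemma corner_figure f x y z : f \in pfaces P -> x != z -> [fset x; y] \in f ->
  [fset y; z] \in f -> [fset [fset x; y]; [fset y; z]] \in vertex_figure P y.
Proof.
move=> fP xz xf zf; apply/imfsetP; exists f; last by rewrite (angle_corner fP xz).
rewrite !inE fP /=; apply/bigfcupP; exists [fset x; y]; first by rewrite xf.
by rewrite !inE eqxx orbT.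
Qed.

Lemma figureP y e e' : [fset e; e'] \in vertex_figure P y ->
  exists2 f, f \in pfaces P & [fset d in f | y \in d] = [fset e; e'].
Proof.
by case/imfsetP => f; rewrite !inE => /andP [fP _] ->; exists f.
Qed.

Lemma two_faces e f f' f'' : f \in pfaces P -> f' \in pfaces P -> f'' \in pfaces P ->
  e \in f -> e \in f' -> e \in f'' -> f != f' -> f'' = f \/ f'' = f'.
Proof.
move=> fP f'P f''P ef ef' ef'' ff'; have eP := face_edge fP ef.
have : [fset f; f'] = [fset f in pfaces P | e \in f].
  apply/eqP; rewrite eqEfcard hEF // cardfs2 ff' andbT.
  by apply/fsubsetP => g; rewrite !inE => /orP [] /eqP ->; apply/andP.
move/fsetP/(_ f''); rewrite !inE f''P ef'' /= => /orP [] /eqP ->; by [left|right].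
Qed.

(** Suppose two faces share the angle at y. They are the only faces at the edge xy, and both join xy
    to yz in the vertex-figure of y. Hence xy has a single neighbour in that cycle, which is
    impossible. *)
Lemma angle_face f f' x y z : f \in pfaces P -> f' \in pfaces P -> x != z ->
  [fset x; y] \in f -> [fset y; z] \in f -> [fset x; y] \in f' -> [fset y; z] \in f' ->
  f = f'.
Proof.
move=> fP f'P xz xf zf xf' zf'; apply/eqP/negPn/negP => ff'.
have [_ yP _] := edge_vert (face_edge fP xf).
have vf := corner_figure fP xz xf zf; rewrite fsetUC in vf.
have [e'' ne vf''] := cycle_ext (hVF yP) vf.
have [f'' f''P Ef''] := figureP vf''.
have : [fset x; y] \in [fset d in f'' | y \in d] by rewrite Ef'' !inE eqxx.
rewrite !inE /= => /andP [xf'' _].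
have E : [fset [fset x; y]; [fset y; z]] = [fset [fset x; y]; e''].
  rewrite -Ef''; case: (two_faces fP f'P f''P xf xf' xf'' ff') => ->.
    by rewrite (angle_corner fP xz).
  by rewrite (angle_corner f'P xz).
by case/fset2_eq: E => [[_ e]|[e1 e2]]; move: ne; rewrite ?e ?e2 -?e1 ?eqxx.
Qed.

Lemma edge_angles x y : [fset x; y] \in pedges P ->
  exists z1 z2, [/\ angle x y z1, angle x y z2, z1 != z2
    & forall z, angle x y z -> z = z1 \/ z = z2].
Proof.
move=> xyP; have := hEF xyP; set B := [fset f in _ | _] => cB.
have [f1 f1B] : exists f, f \in B by apply/fset0Pn; rewrite -cardfs_eq0 cB.
have [f2 f2B] : exists f, f \in B `\ f1.
  by apply/fset0Pn; rewrite -cardfs_eq0; have := cardfsD1 f1 B; rewrite cB f1B add1n => -[/esym ->].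
move: f1B f2B; rewrite !inE => /andP [f1P e1] /and3P [f21 f2P e2].
have [z1 n1 a1] := cycle_ext (proj1 (hF f1P)) e1.
have [z2 n2 a2] := cycle_ext (proj1 (hF f2P)) e2.
exists z1, z2; split.
- by split=> //; exists f1.
- by split=> //; exists f2.
- apply: contraNneq f21 => z12; rewrite z12 in a1 n1.
  by rewrite (angle_face f2P f1P n1 e2 a2 e1 a1).
move=> z [xz [f fP [h1 h2]]]; rewrite eq_sym in f21.
case: (two_faces f1P f2P fP e1 e2 h1 f21) => E; rewrite E in h1 h2.
  by left; apply: (cycle_deg (proj1 (hF f1P)) h1 h2 a1).
by right; apply: (cycle_deg (proj1 (hF f2P)) h1 h2 a2).
Qed.

Lemma angle_const y (C : pred (E3 R)) :
  (forall x z, angle x y z -> C x = C z) ->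
  forall x z, [fset x; y] \in pedges P -> [fset z; y] \in pedges P -> C x = C z.
Proof.
move=> hC x z xP zP; have [_ yP _] := edge_vert xP.
(* [C] is transported to the edges at y, which are the vertices of the vertex-figure. *)
pose C' (e : edge R) := `[< exists2 w, e = [fset w; y] & C w >].
have C'E w : w != y -> C' [fset w; y] = C w.
  move=> wy; apply/asboolP/idP => [[w' /fset2_eq [[-> _]|[e e']]]|] //; last by exists w.
  by rewrite e eqxx in wy.
have inVF w : [fset w; y] \in pedges P ->
    exists e, [fset [fset w; y]; e] \in vertex_figure P y.
  move=> wP; have [z1 [_ [[wz [f fP [h1 h2]]] _ _ _]]] := edge_angles wP.
  by exists [fset y; z1]; exact: corner_figure fP wz h1 h2.
have cC' e e' : [fset e; e'] \in vertex_figure P y -> C' e = C' e'.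
  move=> vf; have [f fP E] := figureP vf; have [cf _] := hF fP.
  have /[!inE]/= /andP [ef ye] : e \in [fset d in f | y \in d] by rewrite E !inE eqxx.
  have /[!inE]/= /andP [e'f ye'] : e' \in [fset d in f | y \in d] by rewrite E !inE eqxx orbT.
  have [w yw ew] := cycle_edge_at cf ef ye; have [w' yw' ew'] := cycle_edge_at cf e'f ye'.
  rewrite ew ew' fsetUC (fsetUC [fset y]) !C'E 1?eq_sym //.
  case: (eqVneq w w') => [->|ww'] //; apply: hC; split=> //; exists f => //.
  by rewrite -ew' fsetUC -ew.
have [e1 v1] := inVF _ xP; have [e2 v2] := inVF _ zP.
rewrite -(C'E x) -?(C'E z); try by have [] := edge_vert xP; have [] := edge_vert zP.
by apply: (cycle_const (hVF yP) cC' v1 _ v2 _); rewrite !inE eqxx.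
Qed.

(** The vertex-figure has at least three vertices, and each of them is an edge at x. *)
Lemma star_ge3 x : x \in pverts P -> (3 <= #|` star P x|)%N.
Proof.
move=> xP; have [s [us s3 E]] := hVF xP; apply: leq_trans s3 _.
apply: (uniq_leq_size us) => e es.
have : [fset e; next s e] \in vertex_figure P x.
  by rewrite E; apply/imfsetP; exists e.
case/figureP => f fP Ef.
have /[!inE]/= /andP [ef xe] : e \in [fset d in f | x \in d] by rewrite Ef !inE eqxx.
by rewrite (face_edge fP ef).
Qed.

End Surface.

(** * Finite checks on the twenty vertices *)

Lemma all20 (p : pred nat) : all p vtx -> forall i, (i < 20)%N -> p i.
Proof. by move=> /allP h i i20; apply: h; rewrite mem_iota. Qed.

Lemma all20_2 (p : nat -> nat -> bool) : all (fun i => all (p i) vtx) vtx ->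
  forall i j, (i < 20)%N -> (j < 20)%N -> p i j.
Proof. by move=> h i j i20 j20; apply: (all20 (all20 h i20)). Qed.

(** The standard vertices have squared length 3, so the dot product of two of them is 3 minus half
    their squared distance. *)
Definition gram_values : seq zphi :=
  [:: (3, 0); (-1, 2); (1, 0); (-1, 0); (1, -2); (-3, 0)].

Lemma D_sqdist i j : (i < 20)%N -> (j < 20)%N -> zdist2 i j = nth (0, 0) sqdists (D i j).
Proof.
by move=> i20 j20; apply/eqP; move: i j i20 j20; apply: all20_2; vm_compute.
Qed.

Lemma D_gram i j : (i < 20)%N -> (j < 20)%N ->
  zdot (dz i) (dz j) = nth (0, 0) gram_values (D i j).
Proof.
by move=> i20 j20; apply/eqP; move: i j i20 j20; apply: all20_2; vm_compute.
Qed.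

Lemma D_lt6 i j : (i < 20)%N -> (j < 20)%N -> (D i j < 6)%N.
Proof. by move: i j; apply: all20_2; vm_compute. Qed.

Lemma D_eq0 i j : (i < 20)%N -> (j < 20)%N -> (D i j == 0%N) = (i == j).
Proof.
by move=> i20 j20; apply/(@eqP bool); move: i j i20 j20; apply: all20_2; vm_compute.
Qed.

Lemma D_sym i j : (i < 20)%N -> (j < 20)%N -> D i j = D j i.
Proof.
by move=> i20 j20; apply/eqP; move: i j i20 j20; apply: all20_2; vm_compute.
Qed.

(** A first step of a shortest path. By induction it gives a path of length [D i j], while
    [D_lipschitz] bounds every path from below. *)
Lemma D_step i j : (i < 20)%N -> (j < 20)%N -> i != j ->
  exists l, [/\ (l < 20)%N, D i l = 1%N & D i j = (D l j).+1].
Proof.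
move=> i20 j20 ij.
have /hasP [l] : has (fun l => (D i l == 1%N) && (D i j == (D l j).+1)) vtx.
  move: i j i20 j20 ij; suff h : forall i j, (i < 20)%N -> (j < 20)%N ->
    (i != j) ==> has (fun l => (D i l == 1%N) && (D i j == (D l j).+1)) vtx.
    by move=> i j i20 j20; apply/implyP/h.
  by apply: all20_2; vm_compute.
by rewrite mem_iota => /= l20 /andP [/eqP h1 /eqP h2]; exists l.
Qed.

Lemma D_lipschitz i j l : (i < 20)%N -> (j < 20)%N -> (l < 20)%N ->
  D i l = 1%N -> (D i j <= (D l j).+1)%N.
Proof.
move=> i20 j20 l20 /eqP; apply/implyP; move: l l20; apply: all20.
by move: i j i20 j20; apply: all20_2; vm_compute.
Qed.

Definition codes_ok (s : seq nat) :=
  (size s == 20%N) && all (fun i => ap s i < 20)%N vtx &&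
  all (fun i => all (fun j => D (ap s i) (ap s j) == D i j) vtx) vtx.

Lemma isoms_ok s : s \in isoms -> codes_ok s.
Proof. by move: s; apply/allP; vm_compute. Qed.

Lemma isoms_lt s i : s \in isoms -> (i < 20)%N -> (ap s i < 20)%N.
Proof. by move=> /isoms_ok /andP [/andP [_ h] _]; move: i; apply: all20. Qed.

Lemma isoms_D s i j : s \in isoms -> (i < 20)%N -> (j < 20)%N ->
  D (ap s i) (ap s j) = D i j.
Proof.
by move=> /isoms_ok /andP [_ h] i20 j20; apply/eqP; move: i j i20 j20; apply: all20_2.
Qed.

Lemma isomsE : isoms = [seq rev p | p <- search D 20].
Proof. by vm_cast_no_check (erefl isoms). Qed.

Lemma autosE : autos = [seq rev p | p <- search D2 20].
Proof. by vm_cast_no_check (erefl autos). Qed.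

Definition zeq (p q : zphi) : bool := ~~ zpos (zsub p q) && ~~ zpos (zsub q p).

(** The signed volume spanned by the images of vertices 0, 1, 2 as seen from that of vertex 4. An
    isometry preserves it up to sign, and [vtx] is the code of the identity, so comparison with
    [orient vtx] singles out the rotations. *)
Definition orient (s : seq nat) : zphi :=
  ztriple (zvsub (dz (ap s 0)) (dz (ap s 4))) (zvsub (dz (ap s 1)) (dz (ap s 4)))
          (zvsub (dz (ap s 2)) (dz (ap s 4))).

Definition rots : seq (seq nat) :=
  Eval vm_compute in [seq s <- isoms | zeq (orient s) (orient vtx)].

Lemma rotsE : rots = [seq s <- isoms | zeq (orient s) (orient vtx)].
Proof. by vm_cast_no_check (erefl rots). Qed.

Section Values.
Variable R : realType.

Lemma zval_eq p q : (zval R p == zval R q) = zeq p q.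
Proof. by rewrite /zeq -!(zval_gt0 R) !zvalB !subr_gt0 -!leNgt eq_le andbC. Qed.

Lemma triple_rows (u : 'I_3 -> E3 R) :
  \det (\matrix_i u i) = triple (u 0) (u 1) (u (lift 0 (lift 0 0))).
Proof.
rewrite /triple; congr (\det _); apply/matrixP => i j; rewrite !mxE.
case: splitP => l il.
  by rewrite (ord1 l) in il *; congr (u _ _ _); apply/val_inj.
rewrite mxE; case: splitP => m lm.
  by rewrite (ord1 m) in lm *; congr (u _ _ _); apply/val_inj; rewrite /= il lm.
by rewrite (ord1 m) in lm *; congr (u _ _ _); apply/val_inj; rewrite /= il lm.
Qed.

(* A linear map is determined by the images of the first three vertices;
   equality of the Gram matrices makes it orthogonal and correct on the others. *)
Lemma isoms_linear s : s \in isoms -> exists2 M : 'M[R]_3, scaling 1 M &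
  forall i, (i < 20)%N -> zvval R (dz i) *m M = zvval R (dz (ap s i)).
Proof.
move=> sI; pose d i := zvval R (dz i).
have gram i j : (i < 20)%N -> (j < 20)%N -> dot (d (ap s i)) (d (ap s j)) = dot (d i) (d j).
  by move=> i20 j20; rewrite !zdotE !D_gram ?isoms_lt // isoms_D.
have o20 (i : 'I_3) : (i < 20)%N by apply: (leq_trans (ltn_ord i)).
pose B := \matrix_(i < 3) d i; pose B' := \matrix_(i < 3) d (ap s i).
have BB : B' *m B'^T = B *m B^T.
  apply/matrixP => i j; rewrite !mxE.
  transitivity (dot (d (ap s i)) (d (ap s j))); first by apply: eq_bigr => l _; rewrite !mxE.
  by rewrite gram //; apply: eq_bigr => l _; rewrite !mxE.
have dB : \det B != 0.
  rewrite triple_rows ztripleE -(zval0 R) zval_eq; by vm_compute.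
have dB' : \det B' != 0.
  apply: contra dB => /eqP e; have := congr1 determinant BB.
  by rewrite !det_mulmx e mul0r det_tr => /esym/eqP; rewrite mulf_eq0 orbb.
have uB : B \in unitmx by rewrite unitmxE unitfE.
have uB' : B'^T \in unitmx by rewrite unitmx_tr unitmxE unitfE.
exists (invmx B *m B').
  split=> //; rewrite trmx_mul mulmxA -(mulmxA _ B') BB !mulmxA mulVmx // mul1mx.
  by rewrite -trmx_mul mulVmx // trmx1 expr1n.
move=> i i20; apply: (can_inj (mulmxK uB')).
rewrite -!mulmxA BB (mulmxA (invmx B)) mulVmx // mul1mx.
apply/rowP => j; rewrite !mxE.
transitivity (dot (d i) (d j)); first by apply: eq_bigr => l _; rewrite !mxE.
by rewrite -gram //; apply: eq_bigr => l _; rewrite !mxE.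
Qed.

End Values.

(* Locked, as conversion would otherwise evaluate coordinates. *)
HB.lock Definition pt (R : realType) (A : 'M[R]_3) (b : E3 R) (i : nat) : E3 R :=
  zvval R (dz i) *m A + b.

HB.lock Definition idx (R : realType) (A : 'M[R]_3) (b : E3 R) (x : E3 R) : nat :=
  index x [seq pt A b i | i <- vtx].

(** * A dodecahedron in a frame: distances, center and codes of isometries *)

Section Frame.
Variables (R : realType) (k : R) (A : 'M[R]_3) (b : E3 R).
Hypothesis kA : scaling k A.

Local Notation pt := (pt A b).
Local Notation idx := (idx A b).

Lemma ptE i : pt i = zvval R (dz i) *m A + b.
Proof. by rewrite pt.unlock. Qed.

Definition pts : seq (E3 R) := [seq pt i | i <- vtx].

Definition dodeca : {fset E3 R} := [fset x in pts].

Lemma dist_pt i j : (i < 20)%N -> (j < 20)%N ->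
  edist (pt i) (pt j) = k * Num.sqrt (zval R (nth (0, 0) sqdists (D i j))).
Proof.
by move=> i20 j20; rewrite !ptE (edist_scaling _ _ _ kA) /edist -zvvalB zdotE -D_sqdist.
Qed.

(** The entries of [sqdists] increase, so distances compare as their positions in that list. *)
Lemma dist_pt_le i j i' j' : (i < 20)%N -> (j < 20)%N -> (i' < 20)%N -> (j' < 20)%N ->
  (edist (pt i) (pt j) <= edist (pt i') (pt j')) = (D i j <= D i' j')%N.
Proof.
move=> i20 j20 i'20 j'20; rewrite !dist_pt // ler_pM2l; last by case: kA.
have := D_lt6 i20 j20; have := D_lt6 i'20 j'20.
move: (D i j) (D i' j') => c c' c'6 c6.
have [h0 h1] : (~~ zpos (zsub (0, 0) (nth (0, 0) sqdists c'))) /\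
    (zpos (zsub (nth (0, 0) sqdists c) (nth (0, 0) sqdists c')) = (c' < c)%N).
  by case: c c' c6 c'6 => [|[|[|[|[|[|//]]]]]] [|[|[|[|[|[|//]]]]]] _ _; vm_compute.
rewrite ler_sqrt; last by rewrite leNgt -subr_gt0 -[X in X - _](zval0 R) -zvalB zval_gt0.
by rewrite leNgt -subr_gt0 -zvalB zval_gt0 h1 -leqNgt.
Qed.

Lemma dist_pt_eq i j i' j' : (i < 20)%N -> (j < 20)%N -> (i' < 20)%N -> (j' < 20)%N ->
  (edist (pt i) (pt j) == edist (pt i') (pt j')) = (D i j == D i' j').
Proof. by move=> *; rewrite eq_le !dist_pt_le // eqn_leq. Qed.

Lemma pt_inj i j : (i < 20)%N -> (j < 20)%N -> pt i = pt j -> i = j.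
Proof.
move=> i20 j20 e; apply/eqP; rewrite -D_eq0 //.
have : edist (pt i) (pt j) == edist (pt i) (pt i) by rewrite e.
by rewrite dist_pt_eq // => /eqP ->; rewrite D_eq0.
Qed.

Lemma pts_uniq : uniq pts.
Proof.
rewrite map_inj_in_uniq ?iota_uniq // => i j; rewrite !mem_iota /= => i20 j20.
exact: pt_inj.
Qed.

Lemma mem_dodeca x : (x \in dodeca) = (x \in pts).
Proof. by apply/imfsetP/idP => [[y /= ys ->]|xs] //; exists x. Qed.

Lemma pt_in i : (i < 20)%N -> pt i \in dodeca.
Proof. by move=> i20; rewrite mem_dodeca; apply/mapP; exists i; rewrite ?mem_iota. Qed.

Lemma dodecaP x : x \in dodeca -> exists2 i, (i < 20)%N & x = pt i.
Proof. by rewrite mem_dodeca => /mapP [i]; rewrite mem_iota => /= i20 ->; exists i. Qed.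

Lemma idxK i : (i < 20)%N -> idx (pt i) = i.
Proof.
move=> i20; rewrite idx.unlock -/pts -[pt i](_ : nth 0 pts i = _) ?index_uniq ?pts_uniq ?size_map ?size_iota //.
by rewrite (nth_map 0%N) ?size_iota // nth_iota.
Qed.

Lemma ptK x : x \in dodeca -> pt (idx x) = x.
Proof. by move=> /dodecaP [i i20 ->]; rewrite idxK. Qed.

Lemma idx_lt x : x \in dodeca -> (idx x < 20)%N.
Proof. by move=> /dodecaP [i i20 ->]; rewrite idxK. Qed.

Lemma card_dodeca : #|` dodeca| = 20%N.
Proof.
rewrite /dodeca card_fseq undup_id ?pts_uniq //.
Qed.

Lemma S_edge_pt i j : (i < 20)%N -> (j < 20)%N -> S_edge dodeca (pt i) (pt j) = (D i j == 1%N).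
Proof.
move=> i20 j20; rewrite /S_edge !pt_in //=; apply/andP/eqP => [[ij /forallP h]|ij].
  (* Vertices 0 and 8 are adjacent on S; comparison with them leaves 1 as the only value for
     distinct vertices. *)
  have := h [` pt_in (isT : 0 < 20)%N] => /forallP /(_ [` pt_in (isT : 8 < 20)%N]) /=.
  rewrite -(inj_eq val_inj) /=.
  have -> : pt 0 != pt 8 by apply/eqP => /pt_inj -/(_ isT isT).
  rewrite dist_pt_le //= (_ : D 0 8 = 1%N) //.
  case: (D i j) (D_eq0 i20 j20) => [|[|]] //= /esym/eqP e.
  by rewrite e eqxx in ij.
split; first by apply/eqP => /pt_inj e; have := D_eq0 i20 j20; rewrite ij e // eqxx.
apply/forallP => -[z zS]; apply/forallP => -[t tS]; apply/implyP.
rewrite -(inj_eq val_inj) /=; have [l l20 ->] := dodecaP zS; have [m m20 ->] := dodecaP tS.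
rewrite dist_pt_le // ij lt0n D_eq0 //; apply: contra => /eqP -> //.
Qed.

Lemma S_edge_in x y : S_edge dodeca x y -> x \in dodeca /\ y \in dodeca.
Proof. by case/and4P. Qed.

Lemma S_length_pt i j n : (i < 20)%N -> (j < 20)%N ->
  S_length dodeca (pt i) (pt j) n <-> n = D i j.
Proof.
have ex m i0 j0 : (i0 < 20)%N -> (j0 < 20)%N -> D i0 j0 = m ->
    exists2 s, path (S_edge dodeca) (pt i0) s & last (pt i0) s = pt j0 /\ size s = m.
  elim: m i0 j0 => [|m IH] i0 j0 i20 j20 Dm.
    by exists [::] => //=; split=> //; congr pt; apply/eqP; rewrite -D_eq0 // Dm.
  have ij : i0 != j0 by rewrite -D_eq0 // Dm.
  have [l [l20 D1 DS]] := D_step i20 j20 ij; move: DS; rewrite Dm => -[/esym Dl].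
  have [s p [e sz]] := IH _ _ l20 j20 Dl.
  by exists (pt l :: s); rewrite /= ?S_edge_pt ?D1 //; split=> //; rewrite sz.
have lb s i0 : (i0 < 20)%N -> (j < 20)%N -> path (S_edge dodeca) (pt i0) s ->
    last (pt i0) s = pt j -> (D i0 j <= size s)%N.
  elim: s i0 => [|x s IH] i0 i20 j20 /=.
    by move=> _ /pt_inj -> //; rewrite leqn0 D_eq0.
  move=> /andP [e p] l; have [_ /dodecaP [m m20 xm]] := S_edge_in e.
  rewrite xm in e p l; move: e; rewrite S_edge_pt // => /eqP e.
  by apply: leq_trans (D_lipschitz i20 j20 m20 e) _; rewrite ltnS; apply: IH.
move=> i20 j20; split=> [[[s p [l <-]] h]|->].
  apply/eqP; rewrite eqn_leq lb // andbT.
  by have [s' p' [l' <-]] := ex _ _ _ i20 j20 erefl; apply: h.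
by split; [exact: ex | move=> s p l; exact: lb].
Qed.

Lemma zval_sum (f : nat -> zphi) (s : seq nat) :
  \sum_(i <- s) zval R (f i) = zval R (foldr (fun i => zadd (f i)) (0, 0) s).
Proof.
elim: s => [|i s IH]; first by rewrite big_nil zval0.
by rewrite big_cons IH -zvalD.
Qed.

Lemma S_center_dodeca : S_center dodeca = b.
Proof.
rewrite /S_center card_dodeca.
have -> : \sum_(x <- dodeca) x = \sum_(x <- pts) x.
  apply: perm_big; apply: uniq_perm; [exact: fset_uniq | exact: pts_uniq |].
  by move=> x; rewrite mem_dodeca.
rewrite big_map (eq_bigr _ (fun i _ => ptE i)) big_split /= -mulmx_suml.
(* The standard vertices are symmetric about the origin, so the center of the frame is [b]. *)
have -> : \sum_(i <- vtx) zvval R (dz i) = 0.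
  apply/rowP => c; rewrite summxE mxE.
  case: c => -[|[|[|]]] //= c3; under eq_bigr do rewrite mxE /=;
    rewrite zval_sum -(zval0 R); congr (zval R _); by vm_compute.
rewrite mul0mx add0r big_const_seq count_predT size_iota iter_addr addr0 -scaler_nat.
by rewrite scalerA mulVf ?scale1r // pnatr_eq0.
Qed.

Lemma isometry_code g : Defs.isometry g -> (forall i, (i < 20)%N -> g (pt i) \in dodeca) ->
  [seq idx (g (pt i)) | i <- vtx] \in isoms.
Proof.
move=> gi gV; rewrite isomsE.
apply: (@search_code D (fun i => idx (g (pt i)))) => [i i20|i j i20 j20 e|i j i20 j20].
- by apply: idx_lt; apply: gV.
- apply: (pt_inj i20 j20); apply: (isometry_inj gi).
  by rewrite -(ptK (gV _ i20)) e ptK ?gV.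
apply/eqP; rewrite -(dist_pt_eq (idx_lt (gV _ i20)) (idx_lt (gV _ j20)) i20 j20).
by rewrite (ptK (gV _ i20)) (ptK (gV _ j20)) gi eqxx.
Qed.

Lemma ap_code (h : nat -> nat) i : (i < 20)%N -> ap [seq h i | i <- vtx] i = h i.
Proof. by move=> i20; rewrite /ap (nth_map 0%N) ?size_iota // nth_iota. Qed.

Lemma pt_sub i j : pt i - pt j = zvval R (zvsub (dz i) (dz j)) *m A.
Proof. by rewrite zvvalB mulmxBl !ptE opprD addrACA subrr addr0. Qed.

(** In the frame all triple products carry the common nonzero factor [\det A], which cancels; what
    is left is the test that defines [rots]. *)
Lemma direct_code g : Defs.isometry g -> (forall i, (i < 20)%N -> g (pt i) \in dodeca) ->
  direct g -> [seq idx (g (pt i)) | i <- vtx] \in rots.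
Proof.
move=> gi gV gd; rewrite rotsE mem_filter isometry_code // andbT -(zval_eq R).
have := gd (pt 4) (pt 0) (pt 1) (pt 2).
rewrite -(ptK (gV 4 isT)) -(ptK (gV 0 isT)) -(ptK (gV 1 isT)) -(ptK (gV 2 isT)).
rewrite !pt_sub !triple_mulmx !ztripleE => /(mulIf (scaling_det kA)) e.
by rewrite /orient !(ap_code (fun i => idx (g (pt i)))) // e.
Qed.

Lemma rots_direct g s : Defs.isometry g -> s \in rots ->
  (forall i, (i < 20)%N -> g (pt i) = pt (ap s i)) -> direct g.
Proof.
move=> gi sR gp; apply: (@isometry_direct _ g (pt 4) (pt 0) (pt 1) (pt 2)) => //.
  rewrite !pt_sub triple_mulmx ztripleE mulf_neq0 ?(scaling_det kA) //.
  by rewrite -(zval0 R) zval_eq; vm_compute.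
rewrite !gp // !pt_sub !triple_mulmx !ztripleE; congr (_ * _).
by move: sR; rewrite rotsE mem_filter -(zval_eq R) => /andP [/eqP -> _].
Qed.

Lemma isoms_isometry s : s \in isoms -> exists2 g, Defs.isometry g &
  (forall i, (i < 20)%N -> g (pt i) = pt (ap s i)) /\ (s \in rots -> direct g).
Proof.
move=> sI; have [M M1 Ms] := isoms_linear R sI.
have [g gk gA] := scaling_map b b kA (scaling_mul M1 kA).
have gi : Defs.isometry g.
  by move=> x y; rewrite gk mul1r divff ?mul1r // lt0r_neq0 //; case: kA.
have gp i : (i < 20)%N -> g (pt i) = pt (ap s i) by move=> i20; rewrite !ptE gA mulmxA Ms.
by exists g => //; split=> // sR; exact: rots_direct gi sR gp.
Qed.

End Frame.

Section Frames.
Variable R : realType.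

Lemma dodecahedron_pointsE : dodecahedron_points R = [seq zvval R v | v <- coords].
Proof.
have e1 : zval R (1, 0) = 1 by rewrite /zval mul0r addr0.
have e2 : zval R (-1, 0) = -1 by rewrite /zval mul0r addr0.
have e3 : zval R (0, 1) = golden R by rewrite /zval mul1r add0r.
have e4 : zval R (0, -1) = - golden R by rewrite /zval mulN1r add0r.
have e5 : zval R (-1, 1) = (golden R)^-1 by rewrite golden_inv /zval mul1r addrC.
have e6 : zval R (1, -1) = - (golden R)^-1 by rewrite golden_inv /zval mulN1r opprB.
rewrite /dodecahedron_points /= /zvval /= e1 e2 e3 e4 e5 e6 !zval0.
by rewrite !mul1r !mulN1r.
Qed.

(** The determinant can be made positive by passing from [A] to [- A], because the standard vertices
    are stable under negation. The sign matters: turns and left orientation change under a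
    reflection. *)
Lemma dodecahedron_frame (S : {fset E3 R}) : regular_dodecahedron S ->
  exists k A b, [/\ scaling k A, 0 < \det A & S = dodeca A b].
Proof.
case=> g [k k0 gk] ->; have [A kA gA] := similarity_affine k0 gk.
have gd x : (x \in [fset g x | x in dodecahedron_points R]) =
    (x \in [seq zvval R v *m A + g 0 | v <- coords]).
  apply/imfsetP/mapP => [[y /=]|[v vc ->]].
    by rewrite dodecahedron_pointsE => /mapP [v vc ->] ->; exists v.
  by exists (zvval R v) => //=; rewrite dodecahedron_pointsE map_f.
have ptsE B c : pts B c = [seq zvval R v *m B + c | v <- coords].
  rewrite -[coords](mkseq_nth ((0, 0), (0, 0), (0, 0))) -map_comp.
  by apply: eq_map => i; rewrite ptE.
case: (ltrP 0 (\det A)) => dA.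
  by exists k, A, (g 0); split=> //; apply/fsetP => x; rewrite gd mem_dodeca ptsE.
exists k, (- A), (g 0); split.
- by case: kA => ? h; split=> //; rewrite linearN /= mulNmx mulmxN opprK.
- rewrite -scaleN1r detZ -signr_odd expr1 mulN1r oppr_gt0 lt_neqAle dA andbT.
  exact: scaling_det kA.
pose neg (v : zvec) : zvec := zvsub ((0, 0), (0, 0), (0, 0)) v.
have negE v : zvval R (neg v) = - zvval R v.
  rewrite zvvalB (_ : zvval R _ = 0) ?add0r //.
  by apply/rowP => c; rewrite !mxE; case: c => -[|[|[|]]] //= _; rewrite zval0.
have inC v : v \in coords -> neg v \in coords by move: v; apply/allP; vm_compute.
apply/fsetP => x; rewrite gd mem_dodeca ptsE; apply/mapP/mapP => -[v vc ->];
  by exists (neg v); rewrite ?inC // negE mulNmx ?mulmxN ?opprK.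
Qed.

End Frames.

(** * Automorphisms counted through their codes *)

Lemma card_codes (T : finType) (B : {set T}) (c : T -> seq nat) (L : seq (seq nat)) :
  {in B &, injective c} -> (forall x, x \in B -> c x \in L) -> (#|B| <= size L)%N.
Proof.
move=> cI cL; rewrite cardE -(size_map c); apply: uniq_leq_size.
  by rewrite map_inj_in_uniq ?enum_uniq // => x y; rewrite !mem_enum; exact: cI.
by move=> y /mapP [x]; rewrite mem_enum => xB ->; exact: cL.
Qed.

Lemma codes_card (T : finType) (B : {set T}) (c : T -> seq nat) (L : seq (seq nat)) :
  uniq L -> (forall s, s \in L -> exists2 x, x \in B & c x = s) -> (size L <= #|B|)%N.
Proof.
move=> uL h; rewrite cardE -(size_map c); apply: uniq_leq_size => // s /h [x xB <-].
by apply: map_f; rewrite mem_enum.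
Qed.

(** Pigeonhole: distinct codes taken from a list that is no longer than the set exhaust the list. *)
Lemma codes_all (T : finType) (B : {set T}) (c : T -> seq nat) (L : seq (seq nat)) :
  {in B &, injective c} -> (forall x, x \in B -> c x \in L) -> (size L <= #|B|)%N ->
  forall s, s \in L -> exists2 x, x \in B & c x = s.
Proof.
move=> cI cL LB s sL; pose L' := [seq c x | x <- enum B].
have uL' : uniq L'.
  by rewrite map_inj_in_uniq ?enum_uniq // => x y; rewrite !mem_enum; exact: cI.
have sub : {subset L' <= L} by move=> y /mapP [x]; rewrite mem_enum => xB ->; exact: cL.
have [|_ e] := uniq_min_size uL' sub; first by rewrite size_map -cardE.
by move: sL; rewrite -e => /mapP [x]; rewrite mem_enum => xB ->; exists x.
Qed.

Section Codes.
Variables (R : realType) (k : R) (A : 'M[R]_3) (b : E3 R).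
Hypothesis kA : scaling k A.
Local Notation pt := (pt A b).
Local Notation idx := (idx A b).

(** It realizes every permutation list on the vertices, in particular the automorphisms that come
    from no isometry. *)
Definition vmap (s : seq nat) (x : E3 R) : E3 R := pt (ap s (idx x)).

Lemma vmap_pt s i : (i < 20)%N -> vmap s (pt i) = pt (ap s i).
Proof. by move=> i20; rewrite /vmap (idxK b kA). Qed.

Lemma im_edge_vmap s i j : (i < 20)%N -> (j < 20)%N ->
  im_edge (vmap s) [fset pt i; pt j] = [fset pt (ap s i); pt (ap s j)].
Proof. by move=> i20 j20; rewrite im_edge2 !vmap_pt. Qed.

Variable Q : polyhedron R.
Hypothesis QV : pverts Q = dodeca A b.
Hypothesis sQ : subcomplex Q.

Definition code (a : poset_perm Q) : seq nat := [seq idx (vact a (pt i)) | i <- vtx].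

Lemma vact_dodeca (a : poset_perm Q) i : (i < 20)%N -> vact a (pt i) \in dodeca A b.
Proof. by move=> i20; rewrite -QV; apply: vact_in; rewrite QV; exact: pt_in. Qed.

Lemma code_lt (a : poset_perm Q) i : (i < 20)%N -> (ap (code a) i < 20)%N.
Proof.
by move=> i20; rewrite (ap_code (fun i => idx (vact a (pt i)))) // (idx_lt kA) // vact_dodeca.
Qed.

Lemma codeE (a : poset_perm Q) i : (i < 20)%N -> vact a (pt i) = pt (ap (code a) i).
Proof.
move=> i20; rewrite (ap_code (fun i => idx (vact a (pt i)))) //.
by rewrite (ptK kA) // vact_dodeca.
Qed.

Lemma code_vmap (a : poset_perm Q) s : size s = 20%N -> (forall i, (i < 20)%N -> ap s i < 20)%N ->
  (forall i, (i < 20)%N -> vact a (pt i) = pt (ap s i)) -> code a = s.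
Proof.
move=> s20 slt h; apply: (@eq_from_nth _ 0%N); first by rewrite size_map size_iota s20.
move=> i; rewrite size_map size_iota => i20.
suff : ap (code a) i = ap s i by [].
by apply: (pt_inj (b := b) kA (code_lt a i20) (slt _ i20)); rewrite -(codeE a i20) h.
Qed.

Lemma code_inj : {in Gamma Q &, injective code}.
Proof.
move=> a a' aG a'G e; apply: Gamma_eq => // x; rewrite QV => /dodecaP [i i20 ->].
by rewrite !codeE // e.
Qed.

Lemma code_mul (a a' : poset_perm Q) i : (i < 20)%N ->
  ap (code (a * a')%g) i = ap (code a') (ap (code a) i).
Proof.
move=> i20; have c20 := code_lt a i20.
apply: (pt_inj (b := b) kA (code_lt _ i20) (code_lt _ c20)).
by rewrite -(codeE _ i20) -(codeE _ c20) -(codeE _ i20) vactM // QV pt_in.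
Qed.

Lemma code_isoms (a : poset_perm Q) : a \in G Q -> code a \in isoms.
Proof.
move=> /(GP sQ) [_ [g [gi _] ag]].
have h i : (i < 20)%N -> vact a (pt i) = g (pt i).
  by move=> i20; apply: ag; rewrite QV pt_in.
have -> : code a = [seq idx (g (pt i)) | i <- vtx].
  by apply/eq_in_map => i; rewrite mem_iota => /= i20; rewrite h.
by apply: (isometry_code kA gi) => i i20; rewrite -h // vact_dodeca.
Qed.

Lemma code_autos (a : poset_perm Q) :
  (forall i j, (i < 20)%N -> (j < 20)%N -> ([fset pt i; pt j] \in pedges Q) = (D i j == 2%N)) ->
  a \in Gamma Q -> code a \in autos.
Proof.
move=> QE aG; rewrite autosE.
apply: (@search_code D2 (fun i => idx (vact a (pt i)))) => [i i20|i j i20 j20 e|i j i20 j20].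
- by apply: (idx_lt kA); apply: vact_dodeca.
- apply: (pt_inj (b := b) kA i20 j20); apply: (@vact_inj _ _ a); rewrite ?QV ?pt_in //.
  by rewrite -(ptK kA (vact_dodeca a i20)) e (ptK kA (vact_dodeca a j20)).
congr nat_of_bool; rewrite -!QE //; try by apply: (idx_lt kA); apply: vact_dodeca.
rewrite (ptK kA (vact_dodeca a i20)) (ptK kA (vact_dodeca a j20)) -im_edge2.
set e := [fset pt i; pt j].
have QE' : [fset im_edge (vact a) d | d in pedges Q] = pedges Q.
  by rewrite -[RHS](congr1 (@pedges R) (Gamma_im sQ aG)).
rewrite -[X in _ \in X]QE'; apply: (@mem_im_in _ _ _ (e |` pedges Q)).
- have sub d : d \in e |` pedges Q -> d `<=` pverts Q.
    rewrite !inE => /orP [/eqP ->|]; last exact: (proj1 sQ).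
    by apply/fsubsetP => x; rewrite !inE QV => /orP [] /eqP ->; rewrite pt_in.
  by move=> d d' /sub dV /sub d'V; apply: (im_inj_in (@vact_inj _ _ a)).
- exact: fsubsetU1.
- by rewrite !inE eqxx.
Qed.

End Codes.

(** * The polyhedron given by a list of faces *)

Section CyclePairs.
Variable T : eqType.
Implicit Type s : seq T.

(** The directed sides of a closed polygon, in a form suited to computation; for lists without
    repetition it agrees with [next]. *)
Definition cpairs s : seq (T * T) := zip s (rot 1 s).

Lemma map_next s : uniq s -> [seq next s x | x <- s] = rot 1 s.
Proof.
case: s => [|a s] us //; rewrite rot1_cons; apply: (@eq_from_nth _ a).
  by rewrite size_map size_rcons.
move=> i; rewrite size_map => is_; rewrite (nth_map a) // next_nth mem_nth // index_uniq //.
rewrite nth_rcons; case: ltngtP => // h; last by rewrite h nth_default.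
by rewrite ltnNge -ltnS is_ in h.
Qed.

Lemma cpairsE s : uniq s -> cpairs s = [seq (x, next s x) | x <- s].
Proof.
by move=> us; rewrite /cpairs -(map_next us) -{1}[s]map_id zip_map.
Qed.

Lemma cpairs_map (U : eqType) (f : T -> U) s :
  zip [seq f x | x <- s] (rot 1 [seq f x | x <- s]) = [seq (f p.1, f p.2) | p <- cpairs s].
Proof.
rewrite -map_rot /cpairs; elim: s (rot 1 s) => [|x s IH] [|y t] //=.
by rewrite IH.
Qed.

Lemma cpairs_mem s x y : (x, y) \in cpairs s -> x \in s /\ y \in s.
Proof.
move=> h; split; first by have := map_f fst h; rewrite -/unzip1 unzip1_zip ?size_rot.
by have := map_f snd h; rewrite -/unzip2 unzip2_zip ?size_rot // mem_rot.
Qed.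

End CyclePairs.

Lemma cycle_edges_cpairs (T : choiceType) (s : seq T) : uniq s ->
  cycle_edges s = [fset [fset p.1; p.2] | p in cpairs s].
Proof.
move=> us; rewrite cpairsE //; apply/fsetP => e; apply/imfsetP/imfsetP => /= -[x].
  by move=> xs ->; exists (x, next s x) => //; apply: map_f.
by move=> /mapP [y ys ->] ->; exists y.
Qed.

Definition inf (s : seq nat) (i j : nat) : bool :=
  ((i, j) \in cpairs s) || ((j, i) \in cpairs s).

Definition pairs20 : seq (nat * nat) :=
  Eval vm_compute in flatten [seq [seq (i, j) | j <- vtx & (i < j)%N && (D i j == 2%N)] | i <- vtx].

Lemma pairs20P i j : (i < 20)%N -> (j < 20)%N ->
  (D i j == 2%N) = ((i, j) \in pairs20) || ((j, i) \in pairs20).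
Proof.
by move=> i20 j20; apply/(@eqP bool); move: i j i20 j20; apply: all20_2; vm_compute.
Qed.

Lemma pairs20_lt p : p \in pairs20 -> (p.1 < 20)%N /\ (p.2 < 20)%N.
Proof. by move=> h; apply/andP; move: p h; apply/allP; vm_compute. Qed.

Definition face_ok (s : seq nat) :=
  [&& uniq s, (3 <= size s)%N, all (fun i => i < 20)%N s
    & all (fun p => D p.1 p.2 == 2%N) (cpairs s)].

Definition corner (s : seq nat) (j i l : nat) := if inf s j i then inf s i l else false.

(* [H] lists the vertices of the vertex-figures. *)
Definition complex_ok (F H : seq (seq nat)) :=
  [&& all face_ok F,
      all (fun s => all (fun s' => if s == s' then true else
        has (fun p => ~~ inf s' p.1 p.2) (cpairs s)) F) F,
      all (fun p => size [seq s <- F | inf s p.1 p.2] == 2%N) pairs20,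
      all (fun i => let h := nth [::] H i in
        [&& uniq h, size h == 6%N, all (fun j => if j < 20 then D i j == 2 else false)%N h
          & all (fun p => has (fun s => corner s p.1 i p.2) F) (cpairs h)]) vtx,
      all (fun s => all (fun i =>
        has (fun p => corner s p.1 i p.2) (cpairs (nth [::] H i))) s) F
    & uniq F].

Section Complex.
Variables (R : realType) (k : R) (A : 'M[R]_3) (b : E3 R).
Hypothesis kA : scaling k A.
Local Notation pt := (pt A b).
Local Notation idx := (idx A b).

Definition ed (p : nat * nat) : edge R := [fset pt p.1; pt p.2].

Definition fc (s : seq nat) : face R := [fset ed p | p in cpairs s].

Definition mkpoly (F : seq (seq nat)) : polyhedron R :=
  Polyhedron (dodeca A b) [fset ed p | p in pairs20] [fset fc s | s in F].

Lemma edE i j i' j' : (i < 20)%N -> (j < 20)%N -> (i' < 20)%N -> (j' < 20)%N ->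
  ([fset pt i; pt j] == [fset pt i'; pt j']) =
  ((i, j) == (i', j')) || ((i, j) == (j', i')).
Proof.
move=> i20 j20 i'20 j'20; apply/eqP/orP => [/fset2_eq|].
  by move=> [] [/(pt_inj kA) -> // /(pt_inj kA) -> //]; [left|right].
by move=> [] /eqP [-> ->] //; rewrite fsetUC.
Qed.

Lemma mem_edges i j : (i < 20)%N -> (j < 20)%N ->
  ([fset pt i; pt j] \in [fset ed p | p in pairs20]) = (D i j == 2%N).
Proof.
move=> i20 j20; rewrite pairs20P //; apply/imfsetP/orP => /= [[[i' j'] p /eqP]|].
  have [/= i'20 j'20] := pairs20_lt p; rewrite /ed /= edE // => /orP [] /eqP [-> ->].
    by left.
  by right.
by case=> h; [exists (i, j) | exists (j, i)] => //; rewrite /ed /= fsetUC.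
Qed.

Lemma edge_pt e : e \in [fset ed p | p in pairs20] ->
  exists i j, [/\ (i < 20)%N, (j < 20)%N, (i, j) \in pairs20 & e = [fset pt i; pt j]].
Proof.
by case/imfsetP => -[i j] /= p ->; exists i, j; have [] := pairs20_lt p.
Qed.

Lemma mem_fc s i j : all (fun i => i < 20)%N s -> (i < 20)%N -> (j < 20)%N ->
  ([fset pt i; pt j] \in fc s) = inf s i j.
Proof.
move=> /allP s20 i20 j20; apply/imfsetP/orP => /= [[[i' j'] p /eqP]|].
  have [/s20 /= i'20 /s20 /= j'20] := cpairs_mem p.
  by rewrite /ed /= edE // => /orP [] /eqP [-> ->]; [left|right].
by case=> h; [exists (i, j) | exists (j, i)] => //; rewrite /ed /= fsetUC.
Qed.

Lemma fc_edge s e : all (fun i => i < 20)%N s -> e \in fc s ->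
  exists i j, [/\ (i < 20)%N, (j < 20)%N, (i, j) \in cpairs s & e = [fset pt i; pt j]].
Proof.
move=> /allP s20 /imfsetP [[i j] /= p ->].
by exists i, j; have [/s20 ? /s20 ?] := cpairs_mem p.
Qed.

Lemma uniq_pt s : all (fun i => i < 20)%N s -> uniq s -> uniq [seq pt i | i <- s].
Proof.
move=> /allP s20 us; rewrite map_inj_in_uniq // => i j /s20 i20 /s20 j20.
exact: (pt_inj kA).
Qed.

Lemma fc_cycle_edges s : all (fun i => i < 20)%N s -> uniq s ->
  fc s = cycle_edges [seq pt i | i <- s].
Proof.
move=> s20 us; rewrite cycle_edges_cpairs ?uniq_pt // /cpairs cpairs_map.
apply/fsetP => e; apply/imfsetP/imfsetP => /= -[p].
  by move=> ps ->; exists (pt p.1, pt p.2) => //; apply: (map_f (fun p => (pt p.1, pt p.2))).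
by move=> /mapP [q qs ->] ->; exists q.
Qed.

Variables F H : seq (seq nat).
Hypothesis ok : complex_ok F H.
Local Notation P := (mkpoly F).

Lemma faceP f : f \in pfaces P -> exists2 s, s \in F & f = fc s.
Proof. by case/imfsetP => s /= sF ->; exists s. Qed.

Lemma fc_in s : s \in F -> fc s \in pfaces P.
Proof. by move=> sF; apply/imfsetP; exists s. Qed.

Lemma face_okF s : s \in F -> face_ok s.
Proof. by case/and5P: ok => /allP h _ _ _ _; exact: h. Qed.

Lemma F_lt s : s \in F -> all (fun i => i < 20)%N s.
Proof. by case/face_okF/and4P. Qed.

Lemma fc_cycle s : s \in F -> is_cycle (fc s).
Proof.
move=> sF; exists [seq pt i | i <- s]; have /and4P [us s3 s20 _] := face_okF sF.
by rewrite size_map uniq_pt // fc_cycle_edges.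
Qed.

Lemma fc_inj : {in F &, injective fc}.
Proof.
move=> s s' sF s'F e; case/and5P: ok => _ /allP /(_ _ sF) /allP /(_ _ s'F) h _ _ _.
case: eqP h => // _ /hasP [[i j] p /negP []].
have [/(allP (F_lt sF)) i20 /(allP (F_lt sF)) j20] := cpairs_mem p.
by rewrite -mem_fc ?F_lt // -e mem_fc ?F_lt //= /inf p.
Qed.

Lemma card_mkpoly_faces : #|` pfaces P| = size F.
Proof.
have uF : uniq F by case/and5P: ok => _ _ _ _ /andP [].
rewrite -(size_map fc F); apply/perm_size/uniq_perm; first exact: fset_uniq.
  by rewrite map_inj_in_uniq //; exact: fc_inj.
by move=> f; apply/imfsetP/mapP => /= -[s sF ->]; exists s.
Qed.

Lemma corner_fset s j i l : s \in F -> (j < 20)%N -> (i < 20)%N -> (l < 20)%N -> j != l ->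
  corner s j i l -> [fset e in fc s | pt i \in e] = [fset [fset pt j; pt i]; [fset pt i; pt l]].
Proof.
move=> sF j20 i20 l20 jl; rewrite /corner; case: ifP => // h1 h2.
apply: cycle_corner; rewrite ?mem_fc ?F_lt //; first exact: fc_cycle.
by apply: contra_neq jl; apply: (pt_inj kA).
Qed.

Let hex i := nth [::] H i.

Lemma hex_ok i : (i < 20)%N -> [/\ uniq (hex i), size (hex i) = 6%N,
  forall j, j \in hex i -> (j < 20)%N /\ D i j = 2%N &
  forall p, p \in cpairs (hex i) -> exists2 s, s \in F & corner s p.1 i p.2].
Proof.
move=> i20; case/and5P: ok => _ _ _ h _; have := all20 h i20.
case/and4P=> uh /eqP sz /allP h1 /allP h2; split=> // [j /h1|p /h2 /hasP //].
by case: ifP => // j20 /eqP.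
Qed.

Lemma uniq_spokes i : (i < 20)%N -> uniq [seq [fset pt j; pt i] | j <- hex i].
Proof.
move=> i20; have [uh _ hlt _] := hex_ok i20.
rewrite map_inj_in_uniq // => j l /hlt [j20 _] /hlt [l20 _] /eqP.
by rewrite edE // => /orP [] /eqP [] // -> <-.
Qed.

(** Both inclusions are tests of [complex_ok]: consecutive members of [hex i] bound a corner of some
    face, and every face through [i] has its corner there among these. *)
Lemma figure_hex i : (i < 20)%N ->
  vertex_figure P (pt i) = cycle_edges [seq [fset pt j; pt i] | j <- hex i].
Proof.
move=> i20; have [uh sz hlt hc] := hex_ok i20.
have neq j l : (j, l) \in cpairs (hex i) -> j != l.
  rewrite cpairsE // => /mapP [m mh [-> ->]].
  by have [] := next_next uh _ mh; rewrite ?sz // eq_sym.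
rewrite cycle_edges_cpairs ?uniq_spokes // /cpairs cpairs_map.
apply/fsetP => c; apply/imfsetP/imfsetP => /= -[].
  move=> f; rewrite !inE => /andP [/faceP [s sF ->] /bigfcupP [e /andP [es _] ie]] ->.
  have is_ : i \in s.
    move: ie; have [j [l [j20 l20 jl ->]]] := fc_edge (F_lt sF) es.
    have [js ls] := cpairs_mem jl.
    by rewrite !inE => /orP [] /eqP /(pt_inj kA) ->.
  have /hasP [[j l] jl cor] : has (fun p => corner s p.1 i p.2) (cpairs (hex i)).
    by case/and5P: ok => _ _ _ _ /andP [/allP /(_ _ sF) /allP /(_ _ is_)].
  have [/hlt [j20 _] /hlt [l20 _]] := cpairs_mem jl.
  exists ([fset pt j; pt i], [fset pt l; pt i]).
    by apply: (map_f (fun p => ([fset pt p.1; pt i], [fset pt p.2; pt i]))) jl.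
  by rewrite (corner_fset sF j20 i20 l20 (neq _ _ jl) cor) /= (fsetUC [fset pt l]).
move=> _ /mapP [[j l] jl ->] -> /=.
have [/hlt [j20 _] /hlt [l20 _]] := cpairs_mem jl; have [s sF cor] := hc _ jl.
exists (fc s); last first.
  by rewrite (corner_fset sF j20 i20 l20 (neq _ _ jl) cor) (fsetUC [fset pt l]).
rewrite !inE fc_in //=; apply/bigfcupP; exists [fset pt j; pt i].
  by move: cor; rewrite /corner; case: ifP => // h _; rewrite mem_fc ?F_lt // h.
by rewrite !inE eqxx orbT.
Qed.

Lemma edge_faces i j : (i, j) \in pairs20 ->
  #|` [fset f in pfaces P | [fset pt i; pt j] \in f]| = 2%N.
Proof.
move=> p; have [/= i20 j20] := pairs20_lt p.
case/and5P: ok => _ _ /allP /(_ _ p) /= sz _ /andP [_ uF].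
have := filter_uniq (fun s => inf s i j) uF.
have mF s : (s \in [seq s <- F | inf s i j]) = (inf s i j && (s \in F)) by rewrite mem_filter.
move: mF sz; case: [seq s <- F | inf s i j] => [|s [|s' [|]]] // mF _.
rewrite /= inE andbT => ss'.
have /andP [is_ sF] : inf s i j && (s \in F) by rewrite -mF inE eqxx.
have /andP [is' s'F] : inf s' i j && (s' \in F) by rewrite -mF !inE eqxx orbT.
have -> : [fset f in pfaces P | [fset pt i; pt j] \in f] = [fset fc s; fc s'].
  apply/fsetP => f; apply/idP/idP; rewrite !inE.
    case/andP=> /faceP [t tF ->]; rewrite mem_fc ?F_lt // => it.
    have : t \in [:: s; s'] by rewrite mF it.
    by rewrite !inE => /orP [] /eqP ->; rewrite eqxx ?orbT.
  by case/orP=> /eqP ->; apply/andP; split; rewrite ?fc_in // mem_fc ?F_lt.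
rewrite cardfs2; case: eqP => // /fc_inj e; move: ss'; rewrite e // eqxx //.
Qed.

(** Connectedness of the edge graph: any two vertices, even equal ones, are joined by exactly three
    steps. *)
Lemma reach i j : (i < 20)%N -> (j < 20)%N -> exists l m,
  [/\ (l < 20)%N, (m < 20)%N, D i l = 2%N, D l m = 2%N & D m j = 2%N].
Proof.
move=> i20 j20.
have /hasP [l] : has (fun l => if D i l == 2%N then
    has (fun m => if D l m == 2%N then D m j == 2%N else false) vtx else false) vtx.
  by move: i j i20 j20; apply: all20_2; vm_compute.
rewrite mem_iota => l20; case: ifP => // /eqP h1 /hasP [m]; rewrite mem_iota => m20.
by case: ifP => // /eqP h2 /eqP h3; exists l, m; split.
Qed.

Lemma mkpoly_polyhedron : is_polyhedron P.
Proof.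
split.
- by apply/fset0Pn; exists (pt 0); exact: pt_in.
- move=> e /edge_pt [i [j [i20 j20 p ->]]]; split.
    rewrite cardfs2; case: eqP => // /(pt_inj kA) e'.
    have := pairs20P i20 j20; rewrite p e' //=.
    by have /eqP -> : D j j == 0%N by rewrite D_eq0.
  by apply/fsubsetP => x /fset2P [] ->; apply: pt_in.
- move=> f /faceP [s sF ->]; split; first exact: fc_cycle.
  apply/fsubsetP => e /(fc_edge (F_lt sF)) [i [j [i20 j20 p ->]]].
  by rewrite mem_edges //; have /and4P [_ _ _ /allP /(_ _ p)] := face_okF sF.
- by move=> e /edge_pt [i [j [i20 j20 p ->]]]; exact: edge_faces.
split=> [x /dodecaP [i i20 ->]|x y /dodecaP [i i20 ->] /dodecaP [j j20 ->]].
  exists [seq [fset pt j; pt i] | j <- hex i]; split; last exact: figure_hex.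
    exact: uniq_spokes.
  by rewrite size_map; have [_ ->] := hex_ok i20.
have [l [m [l20 m20 h1 h2 h3]]] := reach i20 j20.
exists [:: pt l; pt m; pt j] => //=.
by rewrite /adjacent !mem_edges // h1 h2 h3.
Qed.

End Complex.

(** * Automorphisms and regularity of the two candidates *)

Definition ang (F : seq (seq nat)) (i j l : nat) : bool :=
  (j != l) && has (fun s => corner s j i l) F.

(** Circles around vertex [i] from neighbour to neighbour across the corners of faces, never turning
    back to [prev]. *)
Fixpoint hexwalk (F : seq (seq nat)) (i n prev cur : nat) : seq nat :=
  if n is n'.+1 then
    cur :: hexwalk F i n' cur (head 0%N [seq l <- vtx | (l != prev) && ang F i cur l])
  else [::].

(* The first vertex has no predecessor: 20 is not a vertex. *)
Definition hexes F : seq (seq nat) :=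
  [seq hexwalk F i 6 20 (head 0%N [seq j <- vtx | D i j == 2%N]) | i <- vtx].

Definition hexes1 : seq (seq nat) := Eval vm_compute in hexes F1.
Definition hexes2 : seq (seq nat) := Eval vm_compute in hexes F2.

Lemma complex_ok1 : complex_ok F1 hexes1. Proof. by vm_compute. Qed.
Lemma complex_ok2 : complex_ok F2 hexes2. Proof. by vm_compute. Qed.

Definition auto_ok (s : seq nat) :=
  [&& size s == 20%N, uniq s, all (fun i => i < 20)%N s
    & all (fun p => D (ap s p.1) (ap s p.2) == 2%N) pairs20].

Lemma autos_ok s : s \in autos -> auto_ok s.
Proof. by move: s; apply/allP; vm_compute. Qed.

Lemma autos_lt s i : s \in autos -> (i < 20)%N -> (ap s i < 20)%N.
Proof.
by move=> /autos_ok /and4P [/eqP s20 _ /allP h _] i20; apply/h/mem_nth; rewrite s20.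
Qed.

Lemma autos_inj s i j : s \in autos -> (i < 20)%N -> (j < 20)%N -> ap s i = ap s j -> i = j.
Proof.
move=> /autos_ok /and4P [/eqP s20 us _ _] i20 j20 /eqP.
by rewrite nth_uniq ?s20 // => /eqP.
Qed.

Lemma autos_pairs s p : s \in autos -> p \in pairs20 -> D (ap s p.1) (ap s p.2) == 2%N.
Proof. by move=> /autos_ok /and4P [_ _ _ /allP h]; exact: h. Qed.

Lemma autos_size s : s \in autos -> size s = 20%N.
Proof. by move=> /autos_ok /and4P [/eqP]. Qed.

Lemma isoms_autos s : s \in isoms -> s \in autos.
Proof. by move: s; apply/allP; vm_compute. Qed.

Lemma rots_isoms s : s \in rots -> s \in isoms.
Proof. by rewrite rotsE mem_filter => /andP []. Qed.

Lemma autos_uniq : uniq autos. Proof. by vm_compute. Qed.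
Lemma isoms_uniq : uniq isoms. Proof. by vm_compute. Qed.

Definition samef (u t : seq nat) : bool :=
  if all (fun p => inf t p.1 p.2) (cpairs u) then all (fun p => inf u p.1 p.2) (cpairs t)
  else false.

Definition invariant_faces (F : seq (seq nat)) :=
  all (fun s => all (fun t => has (samef [seq ap s i | i <- t]) F) F) autos.

(* [s] maps the flag of [t0] at its first two vertices to that of [t] at [i] and [j]. *)
Definition flag_reach (t0 : seq nat) (i j : nat) (t : seq nat) :=
  has (fun s => if ap s (nth 0%N t0 0) == i then if ap s (nth 0%N t0 1) == j then
    samef [seq ap s i | i <- t0] t else false else false) autos.

(** A flag is a face with a directed side, the vertex being its initial point; therefore each side
    is tested in both directions. *)
Definition flag_transitive (F : seq (seq nat)) :=
  all (fun t => all (fun p => if flag_reach (head [::] F) p.1 p.2 t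
    then flag_reach (head [::] F) p.2 p.1 t else false) (cpairs t)) F.

Lemma invariant_faces1 : invariant_faces F1. Proof. by vm_cast_no_check (erefl true). Qed.
Lemma invariant_faces2 : invariant_faces F2. Proof. by vm_cast_no_check (erefl true). Qed.
Lemma flag_transitive1 : flag_transitive F1. Proof. by vm_compute. Qed.
Lemma flag_transitive2 : flag_transitive F2. Proof. by vm_compute. Qed.

Section Symmetric.
Variables (R : realType) (k : R) (A : 'M[R]_3) (b : E3 R).
Hypothesis kA : scaling k A.
Local Notation pt := (pt A b).
Local Notation idx := (idx A b).
Local Notation ed := (ed A b).
Local Notation fc := (fc A b).
Local Notation vmap := (vmap A b).

Lemma imfset_stable (K : choiceType) (B : {fset K}) (h : K -> K) :
  {in B &, injective h} -> (forall x, x \in B -> h x \in B) -> [fset h x | x in B] = B.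
Proof.
move=> hI hB; apply/eqP; rewrite eqEfcard; apply/andP; split.
  by apply/fsubsetP => _ /imfsetP [x /= xB ->]; exact: hB.
by rewrite card_in_imfset.
Qed.

(** The sets being finite and the induced maps injective, inclusion of the image already gives
    equality. *)
Lemma im_poly_stable (P : polyhedron R) h : subcomplex P ->
  {in pverts P &, injective h} ->
  (forall x, x \in pverts P -> h x \in pverts P) ->
  (forall e, e \in pedges P -> im_edge h e \in pedges P) ->
  (forall f, f \in pfaces P -> im_face h f \in pfaces P) -> im_poly h P = P.
Proof.
move=> [sE sF] hI hV hE hF.
have IE : {in pedges P &, injective (im_edge h)}.
  by move=> e e' eP e'P; apply: (im_inj_in hI); apply: sE.
have IF : {in pfaces P &, injective (im_face h)}.
  by move=> f f' fP f'P; apply: (im_inj_in IE); apply: sF.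
case: P sE sF hI hV hE hF IE IF => V E F /= sE sF hI hV hE hF IE IF.
by rewrite /im_poly /=; congr Polyhedron; exact: imfset_stable.
Qed.

Lemma im_poly_eq (P : polyhedron R) h h' : subcomplex P ->
  {in pverts P, h =1 h'} -> im_poly h P = im_poly h' P.
Proof.
move=> [sE sF] hh; have hE e : e \in pedges P -> im_edge h e = im_edge h' e.
  by move=> eP; apply: eq_im_edge => x xe; apply: hh; move: x xe; apply/fsubsetP/sE.
rewrite /im_poly; congr Polyhedron; first exact: eq_im_edge.
- by apply: eq_in_imfset => e; exact: hE.
- apply: eq_in_imfset => f fP; apply: eq_in_imfset => e ef; apply: hE.
  by move: e ef; apply/fsubsetP/sF.
Qed.

Lemma samef_fc u t : samef u t -> fc u = fc t.
Proof.
rewrite /samef; case: ifP => // /allP h1 /allP h2.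
have sub u' t' : (forall p, p \in cpairs u' -> inf t' p.1 p.2) ->
    forall e, e \in fc u' -> e \in fc t'.
  move=> h e /imfsetP [[i j] /= /h /= /orP [] p ->]; apply/imfsetP.
    by exists (i, j).
  by exists (j, i); rewrite // /ed fsetUC.
by apply/fsetP => e; apply/idP/idP; apply: sub.
Qed.

Lemma fc_samef u t : all (fun i => i < 20)%N u -> all (fun i => i < 20)%N t ->
  fc u = fc t -> samef u t.
Proof.
move=> u20 t20 e; rewrite /samef.
have h u' t' : all (fun i => i < 20)%N u' -> all (fun i => i < 20)%N t' -> fc u' = fc t' ->
    all (fun p => inf t' p.1 p.2) (cpairs u').
  move=> u'20 t'20 e'; apply/allP => -[i j] p.
  have [/(allP u'20) i20 /(allP u'20) j20] := cpairs_mem p.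
  by rewrite /= -(mem_fc b kA) // -e' (mem_fc b kA) // /inf p.
by rewrite (h u t) // h.
Qed.

Lemma im_face_vmap s t : all (fun i => i < 20)%N t ->
  im_face (vmap s) (fc t) = fc [seq ap s i | i <- t].
Proof.
move=> /allP t20; rewrite /fc /cpairs cpairs_map.
have he p : p \in cpairs t -> im_edge (vmap s) (ed p) = ed (ap s p.1, ap s p.2).
  by case: p => i j /cpairs_mem [/t20 i20 /t20 j20]; rewrite (im_edge_vmap _ kA).
apply/fsetP => e; apply/imfsetP/imfsetP => /= -[].
  move=> _ /imfsetP [p /= pt ->] ->; exists (ap s p.1, ap s p.2); last exact: he.
  by apply: (map_f (fun p => (ap s p.1, ap s p.2))).
move=> _ /mapP [p pt ->] ->; exists (ed p); last by rewrite he.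
by apply/imfsetP; exists p.
Qed.

Variables F H : seq (seq nat).
Hypothesis ok : complex_ok F H.
Hypothesis inv : invariant_faces F.
Hypothesis tr : flag_transitive F.
Local Notation P := (mkpoly A b F).

Lemma mkpoly_sub : subcomplex P.
Proof. exact: polyhedron_subcomplex (mkpoly_polyhedron b kA ok). Qed.

Lemma vmap_inj s : s \in autos -> {in dodeca A b &, injective (vmap s)}.
Proof.
move=> sA x y /dodecaP [i i20 ->] /dodecaP [j j20 ->].
rewrite !(vmap_pt b kA) // => /(pt_inj kA (autos_lt sA i20) (autos_lt sA j20)).
by move/(autos_inj sA i20 j20) => ->.
Qed.

Lemma vmap_mkpoly s : s \in autos -> im_poly (vmap s) P = P.
Proof.
move=> sA; apply: (im_poly_stable mkpoly_sub); first exact: vmap_inj.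
- move=> x /dodecaP [i i20 ->]; rewrite (vmap_pt b kA) //.
  exact/pt_in/autos_lt.
- move=> e /(edge_pt) [i [j [i20 j20 p ->]]]; rewrite (im_edge_vmap _ kA) //.
  by rewrite (mem_edges b kA) ?autos_lt //; exact: (autos_pairs sA p).
move=> f /faceP [t tF ->]; rewrite im_face_vmap ?(F_lt ok) //.
move: inv => /allP /(_ _ sA) /allP /(_ _ tF) /hasP [t' t'F /samef_fc ->].
exact: fc_in.
Qed.

Lemma auto_Gamma s : s \in autos -> exists2 a, a \in Gamma P &
  (forall i, (i < 20)%N -> vact a (pt i) = pt (ap s i)) /\ code A b a = s.
Proof.
move=> sA; have [a aG ha] := Gamma_of mkpoly_sub (vmap_inj sA) (vmap_mkpoly sA).
have va i : (i < 20)%N -> vact a (pt i) = pt (ap s i).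
  by move=> i20; rewrite ha ?pt_in // (vmap_pt b kA).
exists a => //; split=> //.
apply: (code_vmap kA) => //; first exact: autos_size.
by move=> i; exact: autos_lt.
Qed.

Lemma isom_symmetry s : s \in isoms -> exists2 g, Defs.symmetry P g &
  (forall i, (i < 20)%N -> g (pt i) = pt (ap s i)) /\ (s \in rots -> direct g).
Proof.
move=> sI; have [g gi [gp gd]] := isoms_isometry b kA sI.
exists g => //; split=> //; rewrite -[RHS](vmap_mkpoly (isoms_autos sI)).
apply: (im_poly_eq mkpoly_sub) => x /dodecaP [i i20 ->].
by rewrite gp // (vmap_pt b kA).
Qed.

Lemma symmetry_dodeca (Q : polyhedron R) g : pverts Q = dodeca A b -> Defs.symmetry Q g ->
  forall i, (i < 20)%N -> g (pt i) \in dodeca A b.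
Proof.
move=> QV [_ gQ] i i20; rewrite -QV -gQ /=; apply/imfsetP; exists (pt i) => //.
by rewrite QV pt_in.
Qed.

Lemma card_Gamma_mkpoly : #|Gamma P| = 240%N.
Proof.
have -> : 240%N = size autos by vm_compute.
apply/eqP; rewrite eqn_leq; apply/andP; split.
  apply: (@card_codes (poset_perm P) _ (@code _ A b P) autos) => [|a]; first exact: (@code_inj R k A b kA P erefl mkpoly_sub).
  apply: (@code_autos R k A b kA P erefl mkpoly_sub) => i j; exact: (mem_edges b kA).
apply: (@codes_card (poset_perm P) _ (@code _ A b P) autos) autos_uniq _ => s sA.
by have [a aG [_ ca]] := auto_Gamma sA; exists a.
Qed.

Lemma card_G_mkpoly : #|G P| = 120%N.
Proof.
have GsG := G_sub_Gamma mkpoly_sub.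
have -> : 120%N = size isoms by vm_compute.
apply/eqP; rewrite eqn_leq; apply/andP; split.
  apply: (@card_codes (poset_perm P) _ (@code _ A b P) isoms) => [a a' aG a'G|a aG].
    by apply: (@code_inj R k A b kA P erefl mkpoly_sub); apply: (subsetP GsG).
  exact: (@code_isoms R k A b kA P erefl mkpoly_sub).
apply: (@codes_card (poset_perm P) _ (@code _ A b P) isoms) isoms_uniq _ => s sI.
have [a aG [va ca]] := auto_Gamma (isoms_autos sI); exists a => //.
have [g gS [gp _]] := isom_symmetry sI.
apply/(GP mkpoly_sub); split=> //; exists g => // x /dodecaP [i i20 ->].
by rewrite va // gp.
Qed.

Lemma index_mkpoly : #|Gamma P : G P|%g = 2%N.
Proof.
have -> : #|Gamma P : G P|%g =
    #|group (Gamma_group_set P) : group (G_group_set mkpoly_sub)|%g by [].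
rewrite -divgS; last exact: (G_sub_Gamma mkpoly_sub).
by rewrite card_Gamma_mkpoly card_G_mkpoly.
Qed.

Lemma mkpoly_regular : regular_map P.
Proof.
pose t0 := head [::] F.
have t0F : t0 \in F.
  have : F != [::].
    by apply/eqP => F0; case/and5P: ok => _ _ /allP /(_ _ (mem_head _ _)); rewrite F0.
  by rewrite /t0; case: (F) => // t l _; rewrite inE eqxx.
have /and4P [_ t03 /allP t020 _] := face_okF ok t0F.
have i020 : (nth 0 t0 0 < 20)%N by apply/t020/mem_nth/(leq_trans _ t03).
have j020 : (nth 0 t0 1 < 20)%N by apply/t020/mem_nth/(leq_trans _ t03).
set i0 := nth 0%N t0 0 in i020; set j0 := nth 0%N t0 1 in j020.
pose x0 : pverts P := [` pt_in A b i020].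
have e0P : [fset pt i0; pt j0] \in pedges P.
  apply: (face_edge (mkpoly_polyhedron b kA ok) (fc_in A b t0F)).
  rewrite (mem_fc b kA) ?(F_lt ok) //; apply/orP; left.
  have sz : (1 < size t0)%N by apply: leq_trans t03.
  apply/(nthP (0, 0)%N); exists 0%N; first by rewrite size_zip size_rot minnn (ltn_trans _ sz).
  rewrite nth_zip ?size_rot //; congr pair.
  by rewrite /j0; case: (t0) sz => [|? [|? ?]].
pose e0 : pedges P := [` e0P].
pose f0 : pfaces P := [` fc_in A b t0F].
(* Every flag is reached from one base flag; transitivity follows by going back to the base flag and
   out again. *)
have reach (x : pverts P) (e : pedges P) (f : pfaces P) : flag x e f ->
    exists2 a : poset_perm P, a \in Gamma P &
      [/\ a.1.1 x0 = x, a.1.2 e0 = e & a.2 f0 = f].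
  case/andP=> xe ef; have [t tF ft] := faceP (valP f); rewrite ft in ef.
  have [i [j [i20 j20 p ee]]] := fc_edge (F_lt ok tF) ef.
  suff main i' j' : (i' < 20)%N -> (j' < 20)%N -> val x = pt i' -> val e = [fset pt i'; pt j'] ->
      flag_reach t0 i' j' t ->
      exists2 a : poset_perm P, a \in Gamma P & [/\ a.1.1 x0 = x, a.1.2 e0 = e & a.2 f0 = f].
    have := allP (allP tr _ tF) _ p; rewrite -/t0; case: ifP => // r1 r2.
    move: xe; rewrite ee => /fset2P [] xE; [apply: (main i j) | apply: (main j i)] => //.
    by rewrite fsetUC.
  move=> i'20 j'20 xE eE /hasP [s sA]; case: eqP => // si; case: eqP => // sj st.
  have [a aG [va _]] := auto_Gamma sA; exists a => //; split; apply/val_inj.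
  - by rewrite -vactE va // si xE.
  - by rewrite (Gamma_edge mkpoly_sub) // im_edge2 !va // si sj eE.
  rewrite (Gamma_face mkpoly_sub) //= ft -(samef_fc st) -im_face_vmap ?(F_lt ok) //.
  apply: eq_im_face => d y; move=> /(fc_edge (F_lt ok t0F)) [m [n [m20 n20 _ ->]]].
  by move=> /fset2P [] ->; rewrite va // (vmap_pt b kA).
move=> x x' e e' f f' fl fl'.
have [a aG [a1 a2 a3]] := reach _ _ _ fl; have [a' a'G [b1 b2 b3]] := reach _ _ _ fl'.
exists (a^-1 * a')%g.
  have gG := groupM (G := group (Gamma_group_set P)); apply: gG => //.
  by rewrite (groupV (group (Gamma_group_set P))).
by rewrite /= -a1 -a2 -a3 !permM !permK b1 b2 b3.
Qed.

Lemma mkpoly_index2 : regular_index2 P.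
Proof.
split; [exact: (mkpoly_polyhedron b kA ok) | exact: mkpoly_regular | exact: index_mkpoly].
Qed.

Lemma edges_length2 : edges_of_length (dodeca A b) P 2.
Proof.
move=> x y xy; have [/dodecaP [i i20 xi] /dodecaP [j j20 yj] _] :=
  edge_vert (mkpoly_polyhedron b kA ok) xy.
rewrite xi yj in xy *; apply/(S_length_pt b kA) => //.
by move: xy; rewrite /= (mem_edges b kA) // => /eqP.
Qed.

(** Vertices 0 and 10 are at distance 2; this pair witnesses directedness and is the reference edge
    throughout. *)
Lemma rots_noswap s : s \in rots -> ap s 0 = 10%N -> ap s 10 != 0%N.
Proof.
move=> sR /eqP; apply/implyP; move: s sR.
by apply/allP; vm_compute.
Qed.

Lemma isoms_transitive i j : (i < 20)%N -> (j < 20)%N -> exists2 s, s \in isoms & ap s i = j.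
Proof.
move=> i20 j20.
have /hasP [s sI /eqP e] : has (fun s => ap s i == j) isoms.
  by move: i j i20 j20; apply: all20_2; vm_compute.
by exists s.
Qed.

Lemma mkpoly_directed : directed_type (dodeca A b) P.
Proof.
split; [|by exists 2; exact: edges_length2|].
  move=> x y /dodecaP [i i20 ->] /dodecaP [j j20 ->].
  have [s sI sij] := isoms_transitive i20 j20; have [g gS [gp _]] := isom_symmetry sI.
  by exists g => //; rewrite gp // sij.
exists (pt 0), (pt 10); split; first by rewrite (mem_edges b kA).
case=> g [gS gd] [g1 g2]; have gV := @symmetry_dodeca P g erefl gS.
have sR := direct_code kA (proj1 gS) gV gd.
have c i : (i < 20)%N -> ap [seq idx (g (pt i)) | i <- vtx] i = idx (g (pt i)).
  exact: (ap_code (fun i => idx (g (pt i)))).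
have := rots_noswap sR; rewrite !c // g1 g2 !(idxK b kA) // => /(_ erefl).
by rewrite eqxx.
Qed.

Lemma mkpoly_directed_on : directed_on (dodeca A b) P.
Proof. by split; [| exact: mkpoly_index2 | exact: mkpoly_directed]. Qed.

Lemma card_cycle_edges (T : choiceType) (s : seq T) :
  uniq s -> (3 <= size s)%N -> #|` cycle_edges s| = size s.
Proof.
move=> us s3; rewrite -(size_map (fun x => [fset x; next s x]) s).
apply/perm_size/uniq_perm; first exact: fset_uniq.
  rewrite map_inj_in_uniq // => x y xs ys /fset2_eq [[]|[xn nx]] //.
  by have [_] := next_next us s3 xs; rewrite nx -xn eqxx.
by move=> e; apply/imfsetP/mapP => /= -[x xs ->]; exists x.
Qed.

Lemma card_fc s : s \in F -> #|` fc s| = size s.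
Proof.
move=> sF; have /and4P [us s3 s20 _] := face_okF ok sF.
by rewrite (fc_cycle_edges b kA) // card_cycle_edges ?size_map // (uniq_pt b kA).
Qed.

Lemma card_edges : #|` pedges P| = 60%N.
Proof.
(* The table lists each unordered pair once, with the smaller vertex first, so distinct entries are
   distinct edges. *)
have lt p : p \in pairs20 -> (p.1 < p.2)%N by move: p; apply/allP; vm_compute.
have edI : {in pairs20 &, injective ed}.
  move=> [i j] [i' j'] p p'; have [/= i20 j20] := pairs20_lt p.
  have [/= i'20 j'20] := pairs20_lt p'; rewrite /ed /= => /eqP.
  rewrite (edE b kA) // => /orP [] /eqP [e1 e2]; first by rewrite e1 e2.
  have := lt _ p; have := lt _ p'; rewrite /= e1 e2 => h1 h2.
  by have := ltn_trans h1 h2; rewrite ltnn.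
have u20 : uniq pairs20 by vm_compute.
have -> : 60%N = size pairs20 by vm_compute.
rewrite -(size_map ed pairs20); apply/perm_size/uniq_perm; first exact: fset_uniq.
  by rewrite (map_inj_in_uniq edI).
by move=> e; apply/imfsetP/mapP => /= -[x xs ->]; exists x.
Qed.

Lemma card_star i : (i < 20)%N -> #|` star P (pt i)| = 6%N.
Proof.
move=> i20; pose n := [seq j <- vtx | D i j == 2%N].
have -> : 6%N = size n.
  by apply/esym/eqP; rewrite /n; move: i i20 {n}; apply: all20; vm_compute.
rewrite -(size_map (fun j => [fset pt i; pt j]) n).
apply/perm_size/uniq_perm; first exact: fset_uniq.
  rewrite map_inj_in_uniq ?filter_uniq ?iota_uniq // => j l.
  rewrite !mem_filter !mem_iota => /andP [_ j20] /andP [_ l20] /eqP.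
  by rewrite (edE b kA) // => /orP [] /eqP [] // -> ->.
move=> e; apply/idP/mapP; rewrite !inE /=.
  case/andP=> /edge_pt [j [l [j20 l20 p ->]]].
  have p' : D j l == 2%N by rewrite pairs20P // p.
  move=> /fset2P [] /(pt_inj kA) ij.
    have {}ij := ij i20 j20; exists l; last by rewrite ij.
    by rewrite mem_filter mem_iota l20 ij p'.
  have {}ij := ij i20 l20; exists j; last by rewrite ij fsetUC.
  by rewrite mem_filter mem_iota j20 ij D_sym // p'.
case=> j; rewrite mem_filter mem_iota => /andP [Dij j20] ->.
by rewrite !inE eqxx /= andbT; have := mem_edges b kA i20 j20; rewrite Dij => ->.
Qed.

Lemma mkpoly_type p : all (fun s => size s == p) F -> has_type P p 6.
Proof.
move=> /allP h; split=> [f /faceP [s sF ->]|x /dodecaP [i i20 ->]]; last exact: card_star.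
by rewrite card_fc //; apply/eqP/h.
Qed.

Lemma mkpoly_euler : euler_char P = 20%:Z - 60%:Z + (size F)%:Z.
Proof. by rewrite /euler_char (card_mkpoly_faces b kA ok) card_edges (card_dodeca b kA). Qed.

End Symmetric.

(** * Planarity, convexity and shapes of faces *)

Section CyclicIndices.
Variable T : eqType.
Implicit Type s : seq T.

Lemma nth_rot1 x s m : (m < size s)%N -> nth x (rot 1 s) m = nth x s (m.+1 %% size s).
Proof.
case: s => [|a s] //; rewrite rot1_cons /= ltnS leq_eqVlt => /orP [/eqP ->|ms].
  by rewrite modnn nth_rcons ltnn eqxx.
by rewrite modn_small // nth_rcons ms.
Qed.

Lemma cpairs_nth x s i : (0 < size s)%N ->
  (nth x s (i %% size s), nth x s (i.+1 %% size s)) \in cpairs s.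
Proof.
move=> s0; apply/(nthP (x, x)); exists (i %% size s)%N.
  by rewrite size_zip size_rot minnn ltn_mod.
by rewrite nth_zip ?size_rot // nth_rot1 ?ltn_mod // -addn1 modnDml addn1.
Qed.

Lemma nth_mod_neq x s i : uniq s -> (3 <= size s)%N ->
  nth x s (i %% size s) != nth x s (i.+2 %% size s).
Proof.
move=> us s3; have s0 : (0 < size s)%N by apply: leq_trans s3.
rewrite nth_uniq ?ltn_mod //.
by rewrite -{1}[i]addn0 -addn2 eqn_modDl mod0n modn_small.
Qed.

End CyclicIndices.

(** The test [ccw] in standard coordinates, where the center is the origin and [dz v] is the outward
    direction at v. *)
Definition ccz (v u x w : nat) : bool :=
  let d i := zvsub (dz i) (dz v) in
  (2 <= zpos (ztriple (dz v) (d u) (d x)) + zpos (ztriple (dz v) (d x) (d w))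
        + zpos (ztriple (dz v) (d w) (d u)))%N.

Definition turn_count (u v w : nat) : nat :=
  count (fun x => if D v x == 2%N then ccz v u x w else false) vtx.

Definition left_ok (i j : nat) : bool :=
  has (fun l => if D i l == 1%N then if D l j == 1%N then
    zpos (ztriple (dz l) (zvsub (dz l) (dz i)) (zvsub (dz j) (dz l)))
    else false else false) vtx.

(** [cs] records turns as ranks in Hr, Sr, Fw, Sl, Hl, so 2 means forward and 4 hard left. Entry m
    belongs to the vertex after the m-th, where the m-th side arrives. *)
Definition shape_ok (s cs : seq nat) : bool :=
  left_ok (nth 0%N s 0) (nth 0%N s 1) &&
  all (fun m => turn_count (nth 0%N s m) (nth 0%N s (m.+1 %% size s))
                  (nth 0%N s (m.+2 %% size s)) == nth 0%N cs m) (iota 0 (size s)).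

(** For a regular pentagon on a sphere about the origin, the sum of the vertices points along the
    axis and is thus normal to its plane. *)
Definition normal (s : seq nat) : zvec :=
  foldr (fun i v => (zadd (dz i).1.1 v.1.1, zadd (dz i).1.2 v.1.2, zadd (dz i).2 v.2))
    ((0, 0), (0, 0), (0, 0)) s.

(** The first condition guarantees that the proposed normal vector does not vanish. *)
Definition plane_ok (s : seq nat) : bool :=
  zpos (zdot (normal s) (dz (head 0%N s))) &&
  all (fun i => all (fun j =>
    zdot (normal s) (zvsub (dz i) (dz j)) == ((0, 0) : zphi)) s) s.

Definition side (s : seq nat) (i j l : nat) : zphi :=
  ztriple (normal s) (zvsub (dz j) (dz i)) (zvsub (dz l) (dz i)).

Definition same_sign (p q : zphi) : bool :=
  if zpos p then zpos q else zpos (zsub (0, 0) p) && zpos (zsub (0, 0) q).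

Definition convex_ok (s : seq nat) : bool :=
  all (fun i => all (fun j => if inf s i j then
    let s' := [seq l <- s | (l != i) && (l != j)] in
    all (fun l => all (fun m => same_sign (side s i j l) (side s i j m)) s') s'
    else true) s) s.

Definition equal_ok (s : seq nat) : bool :=
  all (fun p => D p.1 p.2 == D (nth 0%N s 0) (nth 0%N s 1)) (cpairs s).

Definition list_ok (s : seq nat) : bool :=
  [&& uniq s, (3 <= size s)%N & all (fun i => i < 20)%N s].

Definition convex_pentagon_ok (s : seq nat) : bool :=
  [&& list_ok s, size s == 5%N, plane_ok s & convex_ok s].

(* The vertices of a pentagram, reordered along the surrounding convex pentagon. *)
Definition hull (s : seq nat) : seq nat :=
  if s is [:: a; c; e; b; d] then [:: a; b; c; d; e] else [::].

Definition pentagram_ok (s : seq nat) : bool :=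
  [&& convex_pentagon_ok (hull s), equal_ok (hull s) & equal_ok s].

Definition skew (s : seq nat) : bool :=
  let d i := zvsub (dz (nth 0%N s i)) (dz (nth 0%N s 0)) in
  (3 < size s)%N && ~~ zeq (ztriple (d 1) (d 2) (d 3)) (0, 0).

Section Shapes.
Variables (R : realType) (k : R) (A : 'M[R]_3) (b : E3 R).
Hypothesis kA : scaling k A.
Hypothesis dA : 0 < \det A.
Local Notation pt := (pt A b).
Local Notation ed := (ed A b).
Local Notation fc := (fc A b).

Lemma face_verts_fc s x : all (fun i => i < 20)%N s -> x \in face_verts (fc s) ->
  exists i, [/\ i \in s, (i < 20)%N & x = pt i].
Proof.
move=> s20 /bigfcupP [e /andP [es _] xe].
have [i [j [i20 j20 p ee]]] := fc_edge s20 es; have [si sj] := cpairs_mem p.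
by move: xe; rewrite ee => /fset2P [] ->; [exists i | exists j].
Qed.

Lemma fc_face_verts s i : uniq s -> i \in s -> pt i \in face_verts (fc s).
Proof.
move=> us si; apply/bigfcupP; exists (ed (i, next s i)); last by rewrite !inE eqxx.
rewrite andbT; apply/imfsetP; exists (i, next s i) => //=.
by rewrite cpairsE //; apply: (map_f (fun x => (x, next s x))).
Qed.

Lemma triple_pt n i j l m :
  triple (zvval R n *m A) (pt i - pt j) (pt l - pt m) =
  zval R (ztriple n (zvsub (dz i) (dz j)) (zvsub (dz l) (dz m))) * \det A.
Proof. by rewrite !pt_sub triple_mulmx ztripleE. Qed.

(** The point where a positive determinant of the frame is used: orientations can be read off the
    standard coordinates. *)
Lemma triple_pt_gt0 n i j l m :
  (0 < triple (zvval R n *m A) (pt i - pt j) (pt l - pt m)) =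
  zpos (ztriple n (zvsub (dz i) (dz j)) (zvsub (dz l) (dz m))).
Proof. by rewrite triple_pt pmulr_lgt0 // zval_gt0. Qed.

Lemma same_sign_gt0 p q : same_sign p q -> 0 < zval R p * zval R q.
Proof.
rewrite /same_sign -!(zval_gt0 R) !zvalB zval0 !subr_gt0.
by case: ifP => [h1 h2|_ /andP [h1 h2]]; [rewrite mulr_gt0 | rewrite -mulrNN mulr_gt0 ?oppr_gt0].
Qed.

Lemma pt_center i : pt i - S_center (dodeca A b) = zvval R (dz i) *m A.
Proof. by rewrite (S_center_dodeca b kA) ptE addrK. Qed.

Lemma turn_pt F u v w : (u < 20)%N -> (v < 20)%N -> (w < 20)%N ->
  change_of_direction (dodeca A b) (mkpoly A b F) (pt u) (pt v) (pt w) =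
  nth Hl [:: Hr; Sr; Fw; Sl; Hl] (turn_count u v w).
Proof.
move=> u20 v20 w20; rewrite /change_of_direction pt_center.
pose c x := if D v x == 2%N then ccz v u x w else false.
have -> : turn_count u v w = size [seq x <- vtx | c x] by rewrite size_filter.
congr (nth _ _ _); rewrite -(size_map pt).
apply/perm_size/uniq_perm; first exact: fset_uniq.
  rewrite map_inj_in_uniq ?filter_uniq ?iota_uniq // => x y.
  rewrite !mem_filter !mem_iota => /andP [_ x20] /andP [_ y20].
  exact: (pt_inj kA x20 y20).
have cE x : (x < 20)%N -> c x = adjacent (mkpoly A b F) (pt v) (pt x) &&
    ccw (zvval R (dz v) *m A) (pt u - pt v) (pt x - pt v) (pt w - pt v).
  move=> x20; rewrite /adjacent (mem_edges b kA) // /ccw !triple_pt_gt0 /c /ccz.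
  by case: ifP.
move=> x; apply/imfsetP/mapP => -[].
  move=> y; rewrite inE => /andP [/dodecaP [i i20 ->] h] ->; exists i => //.
  by rewrite mem_filter mem_iota cE // h.
move=> i; rewrite mem_filter mem_iota => /andP [ci i20] ->; exists (pt i) => //.
by rewrite inE -cE // ci andbT; exact: (pt_in A b i20).
Qed.

Lemma left_pt i j : (i < 20)%N -> (j < 20)%N -> left_ok i j ->
  left_oriented (dodeca A b) (pt i) (pt j).
Proof.
move=> i20 j20 /hasP [l]; rewrite mem_iota => l20; case: ifP => // D1; case: ifP => // D2' h.
by exists (pt l); rewrite !(S_edge_pt b kA) // pt_center triple_pt_gt0.
Qed.

Lemma has_shape_fc F s cs a0 a1 a2 a3 : list_ok s -> shape_ok s cs ->
  (forall i, nth a0 [:: a0; a1; a2; a3] (i %% 4) =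
     nth Hl [:: Hr; Sr; Fw; Sl; Hl] (nth 0%N cs (i %% size s))) ->
  has_shape (dodeca A b) (mkpoly A b F) (fc s) a0 a1 a2 a3.
Proof.
move=> /and3P [us s3 /allP s20] /andP [lo /allP tc] ht.
have s0 : (0 < size s)%N by apply: leq_trans s3.
have n20 i : (nth 0 s (i %% size s) < 20)%N by apply/s20/mem_nth; rewrite ltn_mod.
exists (fun i => pt (nth 0%N s (i %% size s))); split=> [i||i].
- split; first by apply/imfsetP; exists (nth 0%N s (i %% size s), nth 0%N s (i.+1 %% size s));
    rewrite //= cpairs_nth.
  apply/eqP => /(pt_inj kA (n20 _) (n20 _)) /eqP.
  by rewrite (negbTE (nth_mod_neq _ _ us s3)).
- apply: left_pt => //; rewrite mod0n modn_small //; exact: leq_trans s3.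
rewrite turn_pt // ht.
have /tc /eqP <- : (i %% size s)%N \in iota 0 (size s) by rewrite mem_iota ltn_mod.
have -> : ((i %% size s).+1 %% size s = i.+1 %% size s)%N by rewrite -addn1 modnDml addn1.
by have -> : ((i %% size s).+2 %% size s = i.+2 %% size s)%N by rewrite -addn2 modnDml addn2.
Qed.

Lemma plane_fc s : list_ok s -> plane_ok s -> in_plane (fc s) (zvval R (normal s) *m A).
Proof.
move=> /and3P [us s3 s20] /andP [np /allP h]; split.
  apply/eqP => n0; have := dot_scaling (zvval R (normal s)) (zvval R (dz (head 0%N s))) kA.
  rewrite n0 zdotE dotE mul0mx mxE => /esym/eqP; rewrite mulf_eq0 => /orP [].
    by rewrite expf_eq0 /= gt_eqF //; case: kA.
  by rewrite gt_eqF // zval_gt0.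
move=> x y /(face_verts_fc s20) [i [si i20 ->]] /(face_verts_fc s20) [j [sj j20 ->]].
rewrite pt_sub (dot_scaling _ _ kA) zdotE.
by have /allP /(_ _ sj) /eqP -> := h _ si; rewrite zval0 mulr0.
Qed.

Lemma fc_is_cycle s : list_ok s -> is_cycle (fc s).
Proof.
move=> /and3P [us s3 s20]; exists [seq pt i | i <- s].
by rewrite (uniq_pt b kA) // size_map (fc_cycle_edges b kA).
Qed.

Lemma convex_fc s : list_ok s -> plane_ok s -> convex_ok s -> convex_polygon (fc s).
Proof.
move=> ls ps /allP cs; have /and3P [us s3 s20] := ls; split; first exact: fc_is_cycle.
exists (zvval R (normal s) *m A); first exact: plane_fc.
move=> x y z z' xy; rewrite !in_fsetD => /andP [zn /(face_verts_fc s20) [l [sl l20 zl]]].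
move=> /andP [z'n /(face_verts_fc s20) [m [sm m20 zm]]].
have [i [si i20 xi]] : exists i, [/\ i \in s, (i < 20)%N & x = pt i].
  by apply: (face_verts_fc s20); apply/bigfcupP; exists [fset x; y]; rewrite ?xy // !inE eqxx.
have [j [sj j20 yj]] : exists i, [/\ i \in s, (i < 20)%N & y = pt i].
  apply: (face_verts_fc s20); apply/bigfcupP; exists [fset x; y]; rewrite ?xy //.
  by rewrite !inE eqxx orbT.
rewrite xi yj zl zm in xy zn z'n *; rewrite !triple_pt mulrACA.
have d2 := mulr_gt0 dA dA.
rewrite (pmulr_lgt0 _ d2); apply: same_sign_gt0.
have nij q : q \in s -> pt q \notin [fset pt i; pt j] ->
    q \in [seq l <- s | (l != i) && (l != j)].
  move=> qs; rewrite mem_filter qs andbT !inE negb_or => /andP [h1 h2].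
  by apply/andP; split; [apply: contraNneq h1 | apply: contraNneq h2] => ->.
have := allP (cs _ si) _ sj; rewrite -(mem_fc b kA) // xy.
move/allP => /(_ _ (nij l sl zn)) /allP; apply; exact: nij.
Qed.

Lemma equilateral_fc s : list_ok s -> equal_ok s -> equilateral (fc s).
Proof.
move=> /and3P [us s3 s20] /allP h.
have n20 i : (i < 3)%N -> (nth 0 s i < 20)%N.
  by move=> i3; apply: (allP s20); apply: mem_nth; apply: leq_trans s3.
suff main x y : [fset x; y] \in fc s -> edist x y = edist (pt (nth 0%N s 0)) (pt (nth 0%N s 1)).
  by move=> x y z t /main -> /main ->.
move=> /(fc_edge s20) [i [j [i20 j20 p]]]; have Dp := eqP (h _ p).
move=> /fset2_eq [] [-> ->]; apply/eqP.
  by rewrite (dist_pt_eq b kA) ?n20 // Dp.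
by rewrite (dist_pt_eq b kA) ?n20 // D_sym // Dp.
Qed.

Lemma card_fc5 s : list_ok s -> size s = 5%N -> #|` fc s| = 5%N.
Proof.
move=> /and3P [us s3 s20] s5.
by rewrite (fc_cycle_edges b kA) // card_cycle_edges ?size_map ?s5 // (uniq_pt b kA).
Qed.

Lemma convex_pentagon_fc s : convex_pentagon_ok s -> convex_pentagon (fc s).
Proof.
move=> /and4P [ls /eqP s5 ps cs]; split; [exact: convex_fc | exact: card_fc5].
Qed.

Lemma pentagram_fc s : list_ok s -> pentagram_ok s -> pentagram (fc s).
Proof.
move=> ls /and3P [cp eh es].
have := cp; move: ls cp eh es; case: s => [|a [|c [|e [|b' [|d [|]]]]]] // ls cp eh es.
case/and4P=> lh _ _ _; have /and3P [uh _ h20] := lh; have /and3P [us _ s20] := ls.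
exists (pt a), (pt b'), (pt c), (pt d), (pt e).
have Eh := fc_cycle_edges b kA h20 uh; have Es := fc_cycle_edges b kA s20 us.
split; first exact: (uniq_pt b kA h20 uh).
- by have := convex_pentagon_fc cp; rewrite Eh.
- by have := equilateral_fc lh eh; rewrite Eh.
- exact: Es.
- exact: equilateral_fc.
Qed.

Lemma planar_fc s : list_ok s -> plane_ok s -> planar (fc s).
Proof. by move=> ls ps; exists (zvval R (normal s) *m A); exact: plane_fc. Qed.

(** A normal of the plane would be orthogonal to three linearly independent differences of vertices,
    hence zero. *)
Lemma skew_fc s : list_ok s -> skew s -> ~ planar (fc s).
Proof.
move=> /and3P [us s3 s20] /andP [s4 sk] [n [n0 hn]]; move/eqP: n0; apply.
pose d i := pt (nth 0%N s i) - pt (nth 0%N s 0).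
have dn i : (i < 4)%N -> dot n (d i) = 0.
  by move=> i4; apply: hn; apply: fc_face_verts => //; apply: mem_nth; apply: leq_trans s4.
pose M := \matrix_(i < 3) d i.+1.
have dM : \det M != 0.
  rewrite triple_rows /d !pt_sub triple_mulmx ztripleE mulf_neq0 ?(scaling_det kA) //.
  by rewrite -(zval0 R) zval_eq.
have uM : M^T \in unitmx by rewrite unitmx_tr unitmxE unitfE.
apply: (can_inj (mulmxK uM)); rewrite mul0mx; apply/rowP => i; rewrite !mxE.
have i4 : (i.+1 < 4)%N by rewrite ltnS ltn_ord.
rewrite -[RHS](dn _ i4).
by apply: eq_bigr => j _; rewrite !mxE.
Qed.

End Shapes.

Lemma data1 : all (fun s => [&& list_ok s, pentagram_ok s, plane_ok s
  & shape_ok s [:: 4; 4; 4; 4; 4]%N]) pentagrams.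
Proof. by vm_compute. Qed.

Lemma data1' : all (fun s => [&& list_ok s, convex_pentagon_ok s, plane_ok s
  & shape_ok s [:: 2; 2; 2; 2; 2]%N]) pentagons.
Proof. by vm_compute. Qed.

Lemma data2 : all (fun s => [&& list_ok s, skew s, size s == 4%N
  & shape_ok s [:: 4; 2; 4; 2]%N]) F2.
Proof. by vm_compute. Qed.

(** * Faces traced from four consecutive vertices; Petrie duality; face orbits *)

Definition oriented (F : seq (seq nat)) : seq (seq nat) :=
  flatten [seq [seq rot n s | n <- iota 0 (size s)] ++ [seq rot n (rev s) | n <- iota 0 (size s)]
          | s <- F].

Definition oriented1 := Eval vm_compute in oriented F1.
Definition oriented2 := Eval vm_compute in oriented F2.

(* In [O] an oriented face is determined by its first three vertices. *)
Definition trace_ok (F O : seq (seq nat)) : bool :=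
  [&& all list_ok O, all (fun t => 3 < size t)%N O, all (fun t => has (samef t) F) O
    & all (fun t => all (fun t' =>
        if nth 0%N t' 0 == nth 0%N t 1 then if nth 0%N t' 1 == nth 0%N t 2 then
        if nth 0%N t' 2 == nth 0%N t 3 then t' == rot 1 t else true else true else true) O) O].

(** As [O] contains all rotations and reversals of the faces, these are all runs of four consecutive
    vertices along faces, in both senses. *)
Definition quads (O : seq (seq nat)) : seq (seq nat) := [seq take 4 t | t <- O].
Definition quads1 := Eval vm_compute in quads oriented1.
Definition quads2 := Eval vm_compute in quads oriented2.

Lemma trace_ok1 : trace_ok F1 oriented1. Proof. by vm_compute. Qed.
Lemma trace_ok2 : trace_ok F2 oriented2. Proof. by vm_compute. Qed.

Definition cor (F : seq (seq nat)) (j i l : nat) : bool := has (fun s => corner s j i l) F.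

Definition cor3 (F : seq (seq nat)) (i j l m : nat) : bool :=
  has (fun s => if corner s i j l then inf s l m else false) F.

Definition petrie_step (i j l m : nat) : bool :=
  [&& cor F1 i j l, cor F1 j l m & ~~ cor3 F1 i j l m].

Definition adj20 (i : nat) := [seq j <- vtx | D i j == 2%N].

(** Any four consecutive vertices of a Petrie polygon of [F1] run along a face of [F2]; with [trace]
    the whole polygon is such a face. *)
Lemma petrie_quads : all (fun i => all (fun j => all (fun l => if i == l then true else
    all (fun m => if j == m then true else
      if cor F1 i j l then if cor F1 j l m then
      if cor3 F1 i j l m then true else [:: i; j; l; m] \in quads2 else true else true)
    (adj20 l)) (adj20 j)) (adj20 i)) vtx.
Proof. by vm_compute. Qed.

Lemma quads_petrie : all (fun s => all (fun n => let v p := nth 0%N s ((n + p) %% 4) in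
    petrie_step (v 0) (v 1) (v 2) (v 3)) (iota 0 4)%N) F2.
Proof. by vm_compute. Qed.

Section Trace.
Variables (R : realType) (k : R) (A : 'M[R]_3) (b : E3 R).
Hypothesis kA : scaling k A.
Local Notation pt := (pt A b).
Local Notation idx := (idx A b).
Local Notation fc := (fc A b).

Lemma nth_iter_rot (s : seq nat) i m : (m < size s)%N ->
  nth 0%N (iter i (rot 1) s) m = nth 0%N s ((m + i) %% size s).
Proof.
elim: i s m => [|i IH] s m ms; first by rewrite addn0 modn_small.
have s0 : (0 < size s)%N by apply: leq_ltn_trans ms.
rewrite iterSr IH ?size_rot // nth_rot1 ?ltn_mod // -addn1 modnDml.
by rewrite addn1 addnS.
Qed.

Lemma fc_walk s e : (0 < size s)%N ->
  e \in fc s <-> exists i, e = [fset pt (nth 0%N s (i %% size s)); pt (nth 0%N s (i.+1 %% size s))].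
Proof.
move=> s0; split=> [/imfsetP [p /= /(nthP (0, 0)%N) [i]]|[i ->]].
  rewrite size_zip size_rot minnn => is_ <- ->; exists i.
  by rewrite nth_zip ?size_rot // /ed (nth_rot1 _ is_) (modn_small is_).
apply/imfsetP; exists (nth 0%N s (i %% size s), nth 0%N s (i.+1 %% size s)) => //=.
exact: cpairs_nth.
Qed.

(** Two successive runs overlap in three vertices, and these determine an oriented face. So the
    second run starts the first face rotated by one step, and the walk never leaves it. *)
Lemma trace (F O : seq (seq nat)) (w : nat -> nat) : trace_ok F O ->
  (forall i, [:: w i; w i.+1; w i.+2; w i.+3] \in quads O) ->
  exists2 t, t \in O & forall i, w i = nth 0%N t (i %% size t).
Proof.
move=> /and4P [/allP lO /allP sO _ /allP uO] wq.
have quad i : exists2 t, t \in O & [/\ w i = nth 0%N t 0, w i.+1 = nth 0%N t 1,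
    w i.+2 = nth 0%N t 2 & w i.+3 = nth 0%N t 3].
  have /mapP [t tO e] := wq i; exists t => //; have := sO _ tO.
  by move: e; case: t {tO} => [|? [|? [|? [|? t]]]] //= [-> -> -> ->].
have [t0 t0O [e0 e1 e2 e3]] := quad 0%N.
suff main i : iter i (rot 1) t0 \in O /\ [/\ w i = nth 0%N (iter i (rot 1) t0) 0,
    w i.+1 = nth 0%N (iter i (rot 1) t0) 1, w i.+2 = nth 0%N (iter i (rot 1) t0) 2
    & w i.+3 = nth 0%N (iter i (rot 1) t0) 3].
  exists t0 => // i; have [_ [-> _ _ _]] := main i.
  by rewrite nth_iter_rot // (leq_trans _ (sO _ t0O)).
elim: i => [|i [IO [_ i1 i2 i3]]]; first by [].
have [t' t'O [f0 f1 f2 f3]] := quad i.+1.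
have := allP (uO _ IO) _ t'O; rewrite -f0 -f1 -f2 i1 i2 i3 !eqxx => /eqP e.
by rewrite iterS -e -i1 -i2 -i3.
Qed.

Lemma trace_face (F O : seq (seq nat)) (w : nat -> nat) (f : face R) : trace_ok F O ->
  (forall i, [:: w i; w i.+1; w i.+2; w i.+3] \in quads O) ->
  (forall e, e \in f <-> exists i, e = [fset pt (w i); pt (w i.+1)]) ->
  exists2 s, s \in F & f = fc s.
Proof.
move=> tok wq fw; have [t tO wt] := trace tok wq.
have /and4P [_ /allP /(_ _ tO) t3 /allP /(_ _ tO) /hasP [s sF ts] _] := tok.
exists s => //; rewrite -(samef_fc A b ts).
have t0 : (0 < size t)%N by apply: leq_trans t3.
apply/fsetP => e; apply/idP/idP => [/fw|/(fc_walk _ t0)] [i ->].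
  by apply/(fc_walk _ t0); exists i; rewrite !wt.
by apply/fw; exists i; rewrite !wt.
Qed.

Local Notation P1 := (mkpoly A b F1).
Local Notation P2 := (mkpoly A b F2).

Lemma mem_corner s j i l : all (fun i => i < 20)%N s -> (j < 20)%N -> (i < 20)%N -> (l < 20)%N ->
  ([fset pt j; pt i] \in fc s) && ([fset pt i; pt l] \in fc s) = corner s j i l.
Proof. by move=> s20 *; rewrite !(mem_fc b kA) // /corner; case: inf. Qed.

Lemma mem_cor F H j i l : complex_ok F H -> (j < 20)%N -> (i < 20)%N -> (l < 20)%N ->
  (exists2 f, f \in pfaces (mkpoly A b F) &
     ([fset pt j; pt i] \in f) && ([fset pt i; pt l] \in f)) <-> cor F j i l.
Proof.
move=> ok j20 i20 l20; split=> [[f /faceP [s sF ->]]|/hasP [s sF c]].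
  by rewrite mem_corner ?(F_lt ok) // => c; apply/hasP; exists s.
by exists (fc s); [exact: fc_in | rewrite mem_corner ?(F_lt ok)].
Qed.

Lemma mem_cor3 F H i j l m : complex_ok F H ->
  (i < 20)%N -> (j < 20)%N -> (l < 20)%N -> (m < 20)%N ->
  (exists2 f, f \in pfaces (mkpoly A b F) & [&& [fset pt i; pt j] \in f,
     [fset pt j; pt l] \in f & [fset pt l; pt m] \in f]) <-> cor3 F i j l m.
Proof.
move=> ok i20 j20 l20 m20; split=> [[f /faceP [s sF ->]]|/hasP [s sF]].
  rewrite andbA mem_corner ?(F_lt ok) // (mem_fc b kA) ?(F_lt ok) // => /andP [c h].
  by apply/hasP; exists s => //; rewrite c.
case: ifP => // c h; exists (fc s); first exact: fc_in.
by rewrite andbA mem_corner ?(F_lt ok) // c (mem_fc b kA) ?(F_lt ok).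
Qed.

Lemma petrie_dual12 : petrie_dual P1 P2.
Proof.
have [ok1 ok2] := (complex_ok1, complex_ok2).
split; [by []|by []|move=> f; split].
  case/faceP=> s sF ->; have /allP /(_ _ sF) /and4P [ls _ /eqP s4 _] := data2.
  have /and3P [us s3 s20] := ls; pose w i := nth 0%N s (i %% 4).
  have w20 i : (w i < 20)%N by apply: (allP s20); apply: mem_nth; rewrite s4 ltn_mod.
  have wp i : petrie_step (w i) (w i.+1) (w i.+2) (w i.+3).
    have := allP (allP quads_petrie _ sF) (i %% 4)%N; rewrite mem_iota ltn_mod => /(_ isT).
    by rewrite /w !modnDml addn0 addn1 addn2 addn3.
  have we e : e \in fc s <-> exists i, e = [fset pt (w i); pt (w i.+1)].
    by rewrite /w -s4; apply: fc_walk; apply: leq_trans s3.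
  exists (fun i => pt (w i)); split; [| | |exact: we]; move=> i.
  - split; last first.
      apply/eqP => /(pt_inj kA (w20 _) (w20 _)) /eqP; apply/negP.
      by rewrite /w -s4; exact: nth_mod_neq.
    apply: (face_edge (mkpoly_polyhedron b kA ok2) (fc_in A b sF)).
    by apply/we; exists i.
  - by apply: (proj2 (mem_cor ok1 (w20 _) (w20 _) (w20 _))); case/and3P: (wp i).
  move=> /(proj1 (mem_cor3 ok1 (w20 _) (w20 _) (w20 _) (w20 _))); apply/negP.
  by case/and3P: (wp i).
case=> v [vE vA vN ve]; pose w i := idx (v i).
have vV i : v i \in dodeca A b.
  by have [] := edge_vert (mkpoly_polyhedron b kA ok1) (proj1 (vE i)).
have vw i : v i = pt (w i) by rewrite /w (ptK kA).
have w20 i : (w i < 20)%N by apply: (idx_lt kA).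
have wD i : D (w i) (w i.+1) == 2%N.
  by have := proj1 (vE i); rewrite /= !vw (mem_edges b kA).
have [s sF ->] : exists2 s, s \in F2 & f = fc s; last exact: fc_in.
apply: (@trace_face _ oriented2 w) trace_ok2 _ _ => [i|e]; last first.
  by rewrite ve; split=> -[i ->]; exists i; rewrite !vw.
have h1 j : cor F1 (w j) (w j.+1) (w j.+2).
  apply: (proj1 (mem_cor ok1 (w20 _) (w20 _) (w20 _))).
  by have [h hP hv] := vA j; exists h; rewrite -?vw.
have h3 : cor3 F1 (w i) (w i.+1) (w i.+2) (w i.+3) = false.
  apply/negP => /(proj2 (mem_cor3 ok1 (w20 _) (w20 _) (w20 _) (w20 _))) [g gP hg].
  by apply: (vN i); exists g; rewrite ?vw.
have nw j : (w j == w j.+2) = false.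
  by apply/eqP => e; have := proj2 (vE j); rewrite !vw e eqxx.
have inA j : w j.+1 \in adj20 (w j) by rewrite mem_filter wD mem_iota w20.
have := all20 petrie_quads (w20 i).
move=> /allP /(_ _ (inA i)) /allP /(_ _ (inA i.+1)); rewrite nw.
by move=> /allP /(_ _ (inA i.+2)); rewrite nw !h1 h3.
Qed.

Lemma orbit_fc F H s t : complex_ok F H -> invariant_faces F -> s \in F -> t \in F ->
  (fc t \in face_orbit (dodeca A b) (mkpoly A b F) (fc s)) =
  has (fun r => samef [seq ap r i | i <- s] t) rots.
Proof.
move=> ok inv sF tF; have s20 := F_lt ok sF; have t20 := F_lt ok tF.
have im_fc g r : (forall i, (i < 20)%N -> g (pt i) = pt (ap r i)) ->
    im_face g (fc s) = fc [seq ap r i | i <- s].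
  move=> gr; rewrite -(im_face_vmap b kA) //; apply: eq_im_face => d y.
  by move=> /(fc_edge s20) [i [j [i20 j20 _ ->]]] /fset2P [] ->; rewrite gr // (vmap_pt b kA).
apply/imfsetP/hasP => /= [[f]|[r rR rs]].
  rewrite inE => /andP [_ /asboolP [g [gi gd gS] gf]] ft.
  have gV i : (i < 20)%N -> g (pt i) \in dodeca A b.
    by move=> i20; rewrite -gS; apply/imfsetP; exists (pt i) => //; exact: (pt_in A b i20).
  exists [seq idx (g (pt i)) | i <- vtx]; first exact: (direct_code kA gi gV gd).
  have rlt i : (i < 20)%N -> (ap [seq idx (g (pt i)) | i <- vtx] i < 20)%N.
    by move=> i20; rewrite (ap_code (fun i => idx (g (pt i)))) // (idx_lt kA) // gV.
  apply: (fc_samef (b := b) kA) => //.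
    by apply/allP => _ /mapP [i /(allP s20) i20 ->]; exact: rlt.
  rewrite ft -gf; apply/esym/im_fc => i i20.
  by rewrite (ap_code (fun i => idx (g (pt i)))) // (ptK kA) // gV.
have [g [gi gP] [gp gd]] := isom_symmetry b kA ok inv (rots_isoms rR).
exists (fc t) => //; rewrite inE fc_in //=; apply/asboolP; exists g.
  by split; [exact: gi | exact: gd | exact: (congr1 (@pverts R) gP)].
by rewrite (im_fc _ _ gp); exact: samef_fc.
Qed.

End Trace.

(** The exclusive or with a negation says that both faces are pentagrams or neither is: the
    rotations keep the two kinds apart and are transitive on each. *)
Lemma orbits1 : all (fun s => all (fun t =>
  has (fun r => samef [seq ap r i | i <- s] t) rots == (s \in pentagrams) (+) (t \notin pentagrams))
  F1) F1.
Proof. by vm_compute. Qed.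

Lemma orbits2 : all (fun s => all (fun t =>
  has (fun r => samef [seq ap r i | i <- s] t) rots) F2) F2.
Proof. by vm_compute. Qed.

(** * Group-theoretic and local checks for the classification *)

Definition comp_code (r s : seq nat) : seq nat := [seq ap s i | i <- r].

Lemma ap_comp r s i : (i < size r)%N -> ap (comp_code r s) i = ap s (ap r i).
Proof. by move=> ir; rewrite /ap (nth_map 0%N). Qed.

Lemma isoms_size s : s \in isoms -> size s = 20%N.
Proof. by move=> /isoms_autos /autos_size. Qed.

Lemma eq_ap r s : size r = 20%N -> size s = 20%N ->
  (forall i, (i < 20)%N -> ap r i = ap s i) -> r = s.
Proof.
move=> r20 s20 h; apply: (@eq_from_nth _ 0%N); first by rewrite r20.
by move=> i; rewrite r20; exact: h.
Qed.

Lemma isoms_comp r s : r \in isoms -> s \in isoms -> comp_code r s \in isoms.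
Proof.
move=> rI sI; have rl i (i20 : (i < 20)%N) := isoms_lt rI i20.
have sl i (i20 : (i < 20)%N) := isoms_lt sI i20.
have -> : comp_code r s = [seq ap s (ap r i) | i <- vtx].
  apply: (@eq_from_nth _ 0%N); first by rewrite !size_map isoms_size // size_iota.
  move=> i; rewrite size_map isoms_size // => i20.
  by rewrite -/(ap _ i) ap_comp ?isoms_size // (nth_map 0%N) ?size_iota // nth_iota.
have hD i j : (i < 20)%N -> (j < 20)%N -> D (ap s (ap r i)) (ap s (ap r j)) = D i j.
  by move=> i20 j20; rewrite !isoms_D ?rl.
rewrite isomsE; apply: (@search_code D (fun i => ap s (ap r i))) => // [i i20|i j i20 j20 e].
  by apply/sl/rl.
by apply/eqP; rewrite -D_eq0 // -hD // e D_eq0 // sl // rl.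
Qed.

Definition squares : seq (seq nat) := Eval vm_compute in undup [seq comp_code r r | r <- isoms].

Lemma squaresP s : s \in squares -> exists2 r, r \in isoms & s = comp_code r r.
Proof.
move=> h; suff /mapP [r rI ->] : s \in [seq comp_code r r | r <- isoms] by exists r.
by move: s h; apply/allP; vm_compute.
Qed.

(** Rotations of order 1, 3 or 5 have odd order and are squares; a half-turn is a product of two
    squares. The images of 0 and 1 are compared first, to save comparisons of whole lists. *)
Lemma rots_squares : all (fun r => has (fun s => has (fun t =>
  if ap t (ap s 0) == ap r 0 then if ap t (ap s 1) == ap r 1 then r == comp_code s t
  else false else false) squares) squares) rots.
Proof. by vm_compute. Qed.

Lemma rots_swap i j : (i < 20)%N -> (j < 20)%N -> i != j -> D i j != 2%N ->
  exists2 r, r \in rots & ap r i = j /\ ap r j = i.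
Proof.
move=> i20 j20 ij Dij.
have /hasP [r rR /andP [/eqP h1 /eqP h2]] : has (fun r => (ap r i == j) && (ap r j == i)) rots.
  move: Dij; apply/implyP; move: ij; apply/implyP; move: i j i20 j20.
  by apply: all20_2; vm_compute.
by exists r.
Qed.

(** Up to reversal, every pair at distance 2 can be moved by rotations from the reference pair 0, 10
    and back to it. *)
Lemma rots_edges i j : (i < 20)%N -> (j < 20)%N -> D i j = 2%N ->
  (exists2 r, r \in rots & (ap r 0 = i /\ ap r 10 = j) \/ (ap r 0 = j /\ ap r 10 = i)) /\
  (exists2 r, r \in rots & (ap r i = 0 /\ ap r j = 10) \/ (ap r i = 10 /\ ap r j = 0))%N.
Proof.
move=> i20 j20 /eqP Dij.
have /andP [/hasP [r rR h] /hasP [s sR h']] :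
    has (fun r => (ap r 0 == i) && (ap r 10 == j) || (ap r 0 == j) && (ap r 10 == i)) rots &&
    has (fun r => (ap r i == 0) && (ap r j == 10) || (ap r i == 10) && (ap r j == 0))%N rots.
  move: Dij; apply/implyP; move: i j i20 j20; apply: all20_2; by vm_compute.
by split; [exists r | exists s] => //; [move: h | move: h'] => /orP [] /andP [/eqP -> /eqP ->];
  auto.
Qed.

(** At vertex 0 the faces of [F1] join 10 to 1 and to 2, by a pentagon and a pentagram. All angles
    of [F1] are images of either one, the kinds being exchanged by automorphisms that are not
    isometries. *)
Lemma good_orbit l0 : l0 \in [:: 1; 2]%N -> all (fun i => all (fun j => all (fun l =>
    if cor F1 j i l && (j != l) then
      has (fun s => if ap s 0 == i then if ap s 10 == j then ap s l0 == l else false else false) autos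
    else true) (adj20 i)) (adj20 i)) vtx.
Proof. by rewrite !inE => /orP [] /eqP ->; vm_compute. Qed.

Lemma good_two : all (fun i => all (fun j =>
  size [seq l <- adj20 i | cor F1 j i l && (j != l)] == 2%N) (adj20 i)) vtx.
Proof. by vm_compute. Qed.

(* Angles whose repetition closes up to a triangle of spokes at vertex 0. *)
Definition triad (j : nat) : bool := j \in [:: 10; 14; 18]%N.

(** The automorphisms fixing vertex 0 carry one angle inside a triad to every ordered pair of
    distinct neighbours inside either triad. *)
Lemma triad_orbit l0 : l0 \in [:: 14; 18]%N -> all (fun j => all (fun l =>
    if (triad j == triad l) && (j != l) then
      has (fun s => if ap s 0 == 0 then if ap s 10 == j then ap s l0 == l else false else false)%N autos
    else true) (adj20 0)) (adj20 0).
Proof. by rewrite !inE => /orP [] /eqP ->; vm_compute. Qed.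

(** The run 1, 0, 10, 15 lies on a pentagon; the runs along pentagrams are in its orbit too, since
    automorphisms exchange the two kinds of faces. *)
Lemma quads_orbit1 :
  all (fun q => has (fun s => q == [seq ap s i | i <- [:: 1; 0; 10; 15]%N]) autos) quads1.
Proof. by vm_compute. Qed.

Lemma quads_orbit2 :
  all (fun q => has (fun s => q == [seq ap s i | i <- [:: 1; 0; 10; 16]%N]) autos) quads2.
Proof. by vm_compute. Qed.

(* Every angle extends to a quad of [O], and every face starts with one. *)
Definition quads_cover (F O : seq (seq nat)) : bool :=
  all (fun s => take 4 s \in quads O) F &&
  all (fun i => all (fun j => all (fun l => if cor F1 j i l && (j != l) then
    has (fun q => if q is [:: j'; i'; l'; m] then
      if j' == j then if i' == i then if l' == l then
        (m < 20)%N && (i != m) else false else false else false else false) (quads O)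
    else true) (adj20 i)) (adj20 i)) vtx.

Lemma quads_cover1 : quads_cover F1 oriented1. Proof. by vm_compute. Qed.
Lemma quads_cover2 : quads_cover F2 oriented2. Proof. by vm_compute. Qed.

(** * Classification of the polyhedra of directed type *)

Section Classification.
Variables (R : realType) (k : R) (A : 'M[R]_3) (b : E3 R).
Hypothesis kA : scaling k A.
Local Notation pt := (pt A b).
Local Notation idx := (idx A b).
Local Notation fc := (fc A b).
Variable Q : polyhedron R.
Hypothesis QV : pverts Q = dodeca A b.
Hypothesis polyQ : is_polyhedron Q.
Hypothesis regQ : regular_map Q.
Hypothesis indQ : #|Gamma Q : G Q|%g = 2%N.
Hypothesis dirQ : directed_type (dodeca A b) Q.

Local Notation code := (@code R A b Q).

Let sQ : subcomplex Q := polyhedron_subcomplex polyQ.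

Definition code_G (s : seq nat) := exists2 a, a \in G Q & code a = s.

Lemma card_Gamma_G : #|Gamma Q| = (#|G Q| * 2)%N.
Proof.
rewrite -indQ.
exact/esym/(@Lagrange _ (group (Gamma_group_set Q)) (group (G_group_set sQ)) (G_sub_Gamma sQ)).
Qed.

(** There are at least 20 m * 2 flags, hence as many automorphisms, and G is half of Gamma. *)
Lemma card_G_ge m : (forall x, x \in pverts Q -> m <= #|` star Q x|)%N -> (20 * m <= #|G Q|)%N.
Proof.
move=> hm; have hE e : e \in pedges Q -> #|` [fset f in pfaces Q | e \in f]| = 2%N.
  by case: polyQ => _ _ _ h _; exact: h.
have := leq_trans (flags_ge hE hm) (regular_flags_le regQ).
by rewrite QV (card_dodeca b kA) card_Gamma_G mulnA leq_pmul2r.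
Qed.

Lemma code_G_mul r s : code_G r -> code_G s -> code_G (comp_code r s).
Proof.
move=> [a aG <-] [a' a'G <-]; exists (a * a')%g.
  exact: (@groupM _ (group (G_group_set sQ))).
apply: eq_ap; rewrite ?size_map ?size_iota // => i i20.
by rewrite (code_mul kA QV) // ap_comp // size_map size_iota.
Qed.

Lemma code_G_div (a a' : poset_perm Q) r : size r = 20%N -> a \in G Q -> a' \in G Q ->
  comp_code (code a) r = code a' -> code_G r.
Proof.
move=> r20 aG a'G e; exists (a^-1 * a')%g.
  by apply: (@groupM _ (group (G_group_set sQ))); rewrite ?(groupV (group (G_group_set sQ))).
apply: eq_ap => // i i20.
rewrite (code_mul kA QV) // -e ap_comp; last by rewrite size_map size_iota (code_lt kA QV).
rewrite -(code_mul kA QV) // mulVg; congr (ap r _).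
by apply: (pt_inj (b := b) kA (code_lt kA QV _ i20) i20); rewrite -(codeE kA QV) // vact1.
Qed.

Lemma comp_inj r s t : r \in isoms -> s \in isoms -> t \in isoms ->
  comp_code s r = comp_code t r -> s = t.
Proof.
move=> rI sI tI e; apply: eq_ap => [||i i20]; try exact: isoms_size.
apply: (autos_inj (isoms_autos rI)); try exact: isoms_lt.
by rewrite -!ap_comp ?isoms_size // e.
Qed.

(* If r is not in H, then H and H r are disjoint and fill up the symmetry group,
   and r^2 cannot lie in H r. *)
Lemma code_G_square r : r \in isoms -> code_G (comp_code r r).
Proof.
move=> rI; pose L := [seq code a | a <- enum (G Q)].
have LP s : s \in L <-> code_G s.
  split=> [/mapP [a]|[a aG <-]]; first by rewrite mem_enum => aG ->; exists a.
  by apply: map_f; rewrite mem_enum.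
have LI s : s \in L -> s \in isoms.
  by move=> /LP [a aG <-]; exact: (code_isoms kA QV sQ).
have [rL|rL] := boolP (r \in L); first by apply: code_G_mul; exact/LP.
(* Three edges at each of the twenty vertices suffice for this bound, half the order 120 of the full
   group. *)
have L60 : (60 <= size L)%N.
  rewrite size_map -cardE; apply: leq_trans (card_G_ge (m := 3) _) => // x xP.
  exact: star_ge3.
have uL : uniq L.
  rewrite map_inj_in_uniq ?enum_uniq // => a a'; rewrite !mem_enum => aG a'G.
  by apply: (code_inj kA QV sQ); apply: (subsetP (G_sub_Gamma sQ)).
pose L' := [seq comp_code l r | l <- L].
have uLL : uniq (L ++ L').
  rewrite cat_uniq uL map_inj_in_uniq ?uL ?andbT => [|l l' /LI lI /LI l'I]; last exact: comp_inj.
  apply/hasPn => _ /mapP [l /LP [a aG <-] ->]; apply: contra rL => /LP [a' a'G e].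
  by apply/LP; apply: (code_G_div (isoms_size rI) aG a'G); rewrite e.
have sLL : {subset L ++ L' <= isoms}.
  move=> s; rewrite mem_cat => /orP [/LI //|/mapP [l /LI lI ->]]; exact: isoms_comp.
have [|_ e] := uniq_min_size uLL sLL.
  have sL' : size L' = size L by exact: size_map.
  have -> : size isoms = (60 + 60)%N by vm_compute.
  by rewrite size_cat sL' leq_add.
have := isoms_comp rI rI; rewrite -e mem_cat => /orP [/LP //|/mapP [l lL]].
by move/(comp_inj rI rI (LI _ lL)) => rl; rewrite rl lL in rL.
Qed.

Lemma code_G_rots r : r \in rots -> code_G r.
Proof.
move=> /(allP rots_squares) /hasP [s /squaresP [s' s'I ->]] /hasP [t /squaresP [t' t'I ->]].
case: ifP => // _; case: ifP => // _ /eqP ->.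
by apply: code_G_mul; exact: code_G_square.
Qed.

Lemma rot_symmetry r : r \in rots -> exists2 g, rotation_symmetry Q g &
  forall i, (i < 20)%N -> g (pt i) = pt (ap r i).
Proof.
move=> rR; have [a aG ca] := code_G_rots rR; have [_ [g gS ag]] := proj1 (GP sQ a) aG.
have gp i : (i < 20)%N -> g (pt i) = pt (ap r i).
  by move=> i20; rewrite -ag ?QV ?pt_in // (codeE kA QV) // ca.
by exists g => //; split=> //; exact: rots_direct kA _ _ (proj1 gS) rR gp.
Qed.

Lemma Q_edge_pt i j : [fset pt i; pt j] \in pedges Q -> (i < 20)%N -> (j < 20)%N -> i != j.
Proof.
move=> e i20 j20; have [_ _] := edge_vert polyQ e.
by apply: contraNneq => ->.
Qed.

(** If the common length were not 2, the edge that no rotation symmetry reverses would be reversed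
    by a rotation of S, and all of these are symmetries of [Q]. *)
Lemma Q_length : edges_of_length (dodeca A b) Q 2.
Proof.
case: dirQ => _ [n len] [u [v [uv ns]]].
have [] := edge_vert polyQ uv; rewrite QV => /dodecaP [i i20 ui] /dodecaP [j j20 vj] _.
rewrite ui vj in uv ns; have nD := proj1 (S_length_pt b kA n i20 j20) (len _ _ uv).
have [D2'|D2'] := eqVneq (D i j) 2%N; first by rewrite nD D2' in len.
case: ns; have [r rR [r1 r2]] := rots_swap i20 j20 (Q_edge_pt uv i20 j20) D2'.
by have [g gR gp] := rot_symmetry rR; exists g; rewrite // !gp // r1 r2.
Qed.

Lemma rot_edge r i j : r \in rots -> (i < 20)%N -> (j < 20)%N ->
  [fset pt i; pt j] \in pedges Q -> [fset pt (ap r i); pt (ap r j)] \in pedges Q.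
Proof.
move=> rR i20 j20 e; have [g [[_ gQ] _] gp] := rot_symmetry rR.
rewrite -!gp // -im_edge2 -gQ /=; apply/imfsetP; exists [fset pt i; pt j] => //.
Qed.

(** Rotations carry some edge of [Q] to the reference pair 0, 10, and from there to every pair at
    distance 2. *)
Lemma Q_edges i j : (i < 20)%N -> (j < 20)%N -> ([fset pt i; pt j] \in pedges Q) = (D i j == 2%N).
Proof.
move=> i20 j20; apply/idP/eqP => [/Q_length /(S_length_pt b kA 2 i20 j20) //|Dij].
case: dirQ => _ _ [u [v [uv _]]].
have [] := edge_vert polyQ uv; rewrite QV => /dodecaP [i0 i020 ui] /dodecaP [j0 j020 vj] _.
rewrite ui vj in uv; have D0 := esym (proj1 (S_length_pt b kA 2 i020 j020) (Q_length uv)).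
have [_ [r rR h]] := rots_edges i020 j020 D0; have [[s sR h'] _] := rots_edges i20 j20 Dij.
have e0 : [fset pt 0; pt 10] \in pedges Q.
  by have := rot_edge rR i020 j020 uv; case: h => -[-> ->] //; rewrite fsetUC.
by have := rot_edge (i := 0%N) (j := 10%N) sR isT isT e0; case: h' => -[-> ->] //; rewrite fsetUC.
Qed.

Lemma Q_pedges : pedges Q = pedges (mkpoly A b F1).
Proof.
apply/fsetP => e; apply/idP/idP => [eQ|/edge_pt [i [j [i20 j20 p ->]]]].
  have c2 : #|` [fset f in pfaces Q | e \in f]| = 2%N by case: polyQ => _ _ _ h _; exact: h.
  have [f fe] : exists f, f \in [fset f in pfaces Q | e \in f].
    by apply/fset0Pn; rewrite -cardfs_eq0 c2.
  move: fe; rewrite !inE => /andP [fP ef].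
  have [x [y [_ ee]]] : exists x y, x != y /\ e = [fset x; y].
    by apply: (cycle_edge _ ef); case: polyQ => _ _ h _ _; have [] := h _ fP.
  rewrite ee in eQ *; have [] := edge_vert polyQ eQ.
  rewrite QV => /dodecaP [i i20 xi] /dodecaP [j j20 yj] _.
  by rewrite xi yj in eQ *; rewrite Q_edges // in eQ; rewrite (mem_edges b kA).
by rewrite Q_edges // pairs20P // p.
Qed.

(** Each vertex now lies on six edges, so Gamma has at least 240 elements; their codes are distinct
    and lie in a list of length 240. *)
Lemma autos_Q s : s \in autos -> exists2 a, a \in Gamma Q & code a = s.
Proof.
apply: (@codes_all (poset_perm Q) (Gamma Q) code autos).
- exact: (code_inj kA QV sQ).
- by move=> a aG; apply: (code_autos kA QV sQ) aG => i j; exact: Q_edges.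
have -> : size autos = (120 * 2)%N by vm_compute.
rewrite card_Gamma_G leq_pmul2r //.
apply: leq_trans (card_G_ge (m := 6) _) => // x; rewrite QV => /dodecaP [i i20 ->].
have := card_star b kA F1 i20; rewrite /star Q_pedges => ->; by [].
Qed.

Definition Qang (j i l : nat) := angle Q (pt j) (pt i) (pt l).

Definition Qquad (q : seq nat) :=
  if q is [:: i; j; l; m] then
    exists2 f, f \in pfaces Q & [/\ [fset pt i; pt j] \in f, [fset pt j; pt l] \in f
      & [fset pt l; pt m] \in f]
  else False.

Lemma autos_face s f : s \in autos -> f \in pfaces Q -> exists2 f', f' \in pfaces Q &
  forall i j, (i < 20)%N -> (j < 20)%N -> [fset pt i; pt j] \in f ->
    [fset pt (ap s i); pt (ap s j)] \in f'.
Proof.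
move=> /autos_Q [a aG ca] fP; exists (im_face (vact a) f).
  by rewrite -(congr1 (@pfaces R) (Gamma_im sQ aG)) /=; apply/imfsetP; exists f.
move=> i j i20 j20 e; rewrite -ca -!(codeE kA QV) // -im_edge2.
by apply/imfsetP; exists [fset pt i; pt j].
Qed.

Lemma autos_Qang s j i l : s \in autos -> (j < 20)%N -> (i < 20)%N -> (l < 20)%N ->
  Qang j i l -> Qang (ap s j) (ap s i) (ap s l).
Proof.
move=> sA j20 i20 l20 [jl [f fP [h1 h2]]]; have [f' f'P hf] := autos_face sA fP.
split; last by exists f' => //; split; apply: hf.
apply: contra_neq jl => /(pt_inj kA (autos_lt sA j20) (autos_lt sA l20)).
by move=> /(autos_inj sA j20 l20) ->.
Qed.

Lemma autos_Qquad s q : s \in autos -> all (fun i => i < 20)%N q ->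
  Qquad q -> Qquad [seq ap s i | i <- q].
Proof.
move=> sA; case: q => [|i [|j [|l [|m [|]]]]] //= /and5P [i20 j20 l20 m20 _].
move=> [f fP [h1 h2 h3]]; have [f' f'P hf] := autos_face sA fP.
by exists f' => //; split; apply: hf.
Qed.

Lemma Qang_lt j i l : (j < 20)%N -> (i < 20)%N -> (l < 20)%N -> Qang j i l ->
  [/\ j \in adj20 i, l \in adj20 i & j != l].
Proof.
move=> j20 i20 l20 [jl [f fP [h1 h2]]].
have D1 : D j i == 2%N by rewrite -Q_edges //; exact: (face_edge polyQ fP).
have D2' : D i l == 2%N by rewrite -Q_edges //; exact: (face_edge polyQ fP).
by rewrite !mem_filter !mem_iota D_sym // D1 D2' j20 l20; split=> //; apply: contraNneq jl => ->.
Qed.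

Lemma Qang_two j i : (i < 20)%N -> (j < 20)%N -> D i j = 2%N ->
  exists l1 l2, [/\ (l1 < 20)%N /\ (l2 < 20)%N, Qang j i l1, Qang j i l2, l1 != l2
    & forall l, (l < 20)%N -> Qang j i l -> l = l1 \/ l = l2].
Proof.
move=> i20 j20 Dij.
have e : [fset pt j; pt i] \in pedges Q by rewrite Q_edges // D_sym // Dij.
have [z1 [z2 [a1 a2 z12 az]]] := edge_angles polyQ e.
have inV z : angle Q (pt j) (pt i) z -> exists2 l, (l < 20)%N & z = pt l.
  move=> [_ [f fP [_ h]]]; have [_] := edge_vert polyQ (face_edge polyQ fP h).
  by rewrite QV => /dodecaP.
have [l1 l120 e1] := inV _ a1; have [l2 l220 e2] := inV _ a2.
exists l1, l2; rewrite /Qang -e1 -e2; split=> //.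
  by apply: contraNneq z12 => l12; rewrite e1 e2 l12.
by move=> l l20 /az; rewrite e1 e2 => -[] /(pt_inj kA) ->; auto.
Qed.

Lemma Qang_unique j i l1 l2 l : (i < 20)%N -> (j < 20)%N -> (l1 < 20)%N -> (l2 < 20)%N ->
  (l < 20)%N -> Qang j i l1 -> Qang j i l2 -> l1 != l2 -> Qang j i l -> l = l1 \/ l = l2.
Proof.
move=> i20 j20 l120 l220 l20 q1 q2 l12 q; have [jA _ _] := Qang_lt j20 i20 l120 q1.
have Dij : D i j = 2%N by move: jA; rewrite mem_filter => /andP [/eqP].
have [m1 [m2 [_ _ _ _ h]]] := Qang_two i20 j20 Dij.
case: (h _ l20 q) (h _ l120 q1) (h _ l220 q2) l12 => -> [] -> [] ->; rewrite ?eqxx //; auto.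
Qed.

(** One angle inside a triad would make all such pairs angles. Each neighbour would then have both
    its angles inside its own triad, contrary to the connectedness of the vertex-figure. *)
Lemma triad_contra l0 : l0 \in [:: 14; 18]%N -> ~ Qang 10 0 l0.
Proof.
move=> hl0 q0.
have l020 : (l0 < 20)%N by move: hl0; rewrite !inE => /orP [] /eqP ->.
have even j l : j \in adj20 0 -> l \in adj20 0 -> triad j = triad l -> j != l -> Qang j 0 l.
  move=> jA lA tjl jl; have := allP (allP (triad_orbit hl0) _ jA) _ lA.
  rewrite tjl eqxx jl => /hasP [s sA]; case: eqP => // s0; case: eqP => // s10 /eqP sl.
  by have := autos_Qang (j := 10%N) (i := 0%N) sA isT isT l020 q0; rewrite s0 s10 sl.
have lt20 j : j \in adj20 0 -> (j < 20)%N.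
  by rewrite mem_filter mem_iota => /and3P [].
have triad_two j : j \in adj20 0 -> exists l1 l2, [/\ l1 \in adj20 0, l2 \in adj20 0, l1 != l2 &
    [/\ triad j = triad l1, triad j = triad l2, j != l1 & j != l2]].
  rewrite mem_filter mem_iota => /andP [Dj /andP [_ j20]].
  have /hasP [l1 l1A /hasP [l2 l2A]] : has (fun l1 => has (fun l2 => [&& l1 != l2,
      triad j == triad l1, triad j == triad l2, j != l1 & j != l2]) (adj20 0)) (adj20 0).
    by move: Dj; apply/implyP; move: j j20; apply: all20; vm_compute.
  by case/and5P=> h1 /eqP h2 /eqP h3 h4 h5; exists l1, l2.
have cst x z : angle Q x (pt 0) z -> triad (idx x) = triad (idx z).
  move=> axz; have [_ [f fP [h1 h2]]] := axz.
  have [] := edge_vert polyQ (face_edge polyQ fP h1); rewrite QV => /dodecaP [j j20 xj] _ _.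
  have [_] := edge_vert polyQ (face_edge polyQ fP h2); rewrite QV => /dodecaP [l l20 zl] _.
  rewrite xj zl in axz *; rewrite !(idxK b kA) //.
  have [jA lA jl] := Qang_lt (i := 0%N) j20 isT l20 axz.
  have [l1 [l2 [l1A l2A l12 [t1 t2 n1 n2]]]] := triad_two j jA.
  have := Qang_unique (i := 0%N) isT j20 (lt20 _ l1A) (lt20 _ l2A) l20 (even _ _ jA l1A t1 n1)
    (even _ _ jA l2A t2 n2) l12 axz.
  by case=> ->.
(* 10 and 1 are neighbours of 0 in different triads. *)
have := angle_const polyQ cst (x := pt 10) (z := pt 1).
by rewrite !Q_edges // !(idxK b kA) // => /(_ isT isT).
Qed.

(** The neighbours of 0 other than 10 are 1, 2, 4, 14, 18. The last two are excluded, and of two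
    different angles at most one leads to 4. *)
Lemma good_Qang0 : exists2 l, l \in [:: 1; 2]%N & Qang 10 0 l.
Proof.
have [l1 [l2 [[l120 l220] q1 q2 l12 _]]] := Qang_two (isT : (0 < 20)%N) (isT : (10 < 20)%N) erefl.
have cases l : (l < 20)%N -> Qang 10 0 l -> l \in [:: 1; 2]%N \/ l = 4%N.
  move=> l20 q; have [_ lA nl] := Qang_lt (j := 10%N) (i := 0%N) isT isT l20 q.
  have : l \in [:: 1; 2; 4; 14; 18]%N.
    move: nl; apply/implyP; move: l lA {l20 q}; apply/allP; by vm_compute.
  rewrite !inE => /or4P [|||/orP []] /eqP e; rewrite e ?eqxx ?orbT; auto;
    by have := @triad_contra l; rewrite e => /(_ isT); rewrite e in q => /(_ q).
case: (cases _ l120 q1) => [h|e1]; first by exists l1.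
case: (cases _ l220 q2) => [h|e2]; first by exists l2.
by rewrite e1 e2 eqxx in l12.
Qed.

Lemma good_Qang j i l : (i < 20)%N -> j \in adj20 i -> l \in adj20 i -> j != l ->
  cor F1 j i l -> Qang j i l.
Proof.
move=> i20 jA lA jl c; have [l0 hl0 q0] := good_Qang0.
have := allP (allP (all20 (good_orbit hl0) i20) _ jA) _ lA.
rewrite c jl => /hasP [s sA]; case: eqP => // s0; case: eqP => // s10 /eqP sl.
have l020 : (l0 < 20)%N by move: hl0; rewrite !inE => /orP [] /eqP ->.
by have := autos_Qang (j := 10%N) (i := 0%N) sA isT isT l020 q0; rewrite s0 s10 sl.
Qed.

(** The two angles of [F1] at an edge end are angles of [Q], and [Q] has just two there. *)
Lemma Qang_good j i l : (j < 20)%N -> (i < 20)%N -> (l < 20)%N -> Qang j i l ->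
  cor F1 j i l.
Proof.
move=> j20 i20 l20 q; have [jA lA jl] := Qang_lt j20 i20 l20 q.
have := allP (all20 good_two i20) _ jA.
have : uniq [seq l <- adj20 i | cor F1 j i l && (j != l)] by rewrite !filter_uniq // iota_uniq.
have mF m : m \in [seq l <- adj20 i | cor F1 j i l && (j != l)] ->
    [/\ cor F1 j i m, (m < 20)%N & Qang j i m].
  rewrite mem_filter => /andP [/andP [c jm] mA]; split=> //; last exact: good_Qang.
  by move: mA; rewrite mem_filter mem_iota => /and3P [].
case: [seq _ <- _ | _] mF => [|l1 [|l2 [|]]] // mF /andP [l12 _] _.
have [c1 l120 q1] := mF l1 (mem_head _ _).
have [c2 l220 q2] : [/\ cor F1 j i l2, (l2 < 20)%N & Qang j i l2].
  by apply: mF; rewrite !inE eqxx orbT.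
rewrite inE in l12.
by case: (Qang_unique i20 j20 l120 l220 l20 q1 q2 l12 q) => ->.
Qed.

(** One run of four vertices along a face of [Q] decides between the two polyhedra, since the
    automorphisms carry it to all runs of [F1] or all of [F2]. *)
Lemma Qquads : (forall q, q \in quads1 -> Qquad q) \/ (forall q, q \in quads2 -> Qquad q).
Proof.
have [jl [f fP [h1 h2]]] : Qang 1 0 10 by apply: good_Qang; vm_compute.
have cf : is_cycle f by case: polyQ => _ _ h _ _; have [] := h _ fP.
have [z nz h3] := cycle_ext cf h2.
have [_] := edge_vert polyQ (face_edge polyQ fP h3); rewrite QV => /dodecaP [m m20 zm] _.
rewrite zm in h3 nz; have q : Qang 0 10 m by split=> //; exists f.
have [_ mA _] := Qang_lt (j := 0%N) (i := 10%N) isT isT m20 q; have := Qang_good (j := 0%N) (i := 10%N) isT isT m20 q.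
have Qq : Qquad [:: 1; 0; 10; m]%N by exists f.
have orb O : all (fun q => has (fun s => q == [seq ap s i | i <- [:: 1; 0; 10; m]%N]) autos) O ->
    forall q, q \in O -> Qquad q.
  move=> /allP h q' /h /hasP [s sA /eqP ->]; apply: autos_Qquad => //.
  by rewrite /= m20.
have [_ _ n0m] := Qang_lt (j := 0%N) (i := 10%N) isT isT m20 q.
(* The face with the angle 1, 0, 10 continues to 15, along a pentagon, or to 16, along a skew
   quadrangle. *)
have mE : cor F1 0 10 m ==> (0 != m)%N ==> (m \in [:: 15; 16]%N).
  by move: m mA {zm h3 nz q m20 Qq orb n0m}; apply/allP; vm_compute.
move=> c; move: mE; rewrite c n0m /= !inE => /orP [] /eqP e; rewrite e in orb.
  by left; apply: orb; exact: quads_orbit1.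
by right; apply: orb; exact: quads_orbit2.
Qed.

(** Any three consecutive vertices on a face of [Q] extend to a run from [O], which by uniqueness of
    the face at an angle lies on that same face. So faces of [Q] trace faces of [F]. *)
Lemma Q_eq F H O : complex_ok F H -> trace_ok F O -> quads_cover F O ->
  (forall q, q \in quads O -> Qquad q) -> Q = mkpoly A b F.
Proof.
move=> ok tok /andP [/allP c1 c2] Qq.
have faceF f : f \in pfaces Q -> exists2 s, s \in F & f = fc s.
  move=> fP; have cf : is_cycle f by case: polyQ => _ _ h _ _; have [] := h _ fP.
  have [v [vE ve]] := cycle_walk cf; pose w i := idx (v i).
  have vV i : v i \in dodeca A b.
    by rewrite -QV; have [] := edge_vert polyQ (face_edge polyQ fP (proj1 (vE i))).
  have vw i : v i = pt (w i) by rewrite /w (ptK kA).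
  have w20 i : (w i < 20)%N by apply: (idx_lt kA).
  apply: (trace_face (b := b) (w := w) tok) => [i|e]; last first.
    by rewrite ve; split=> -[n ->]; exists n; rewrite !vw.
  have qi : Qang (w i) (w i.+1) (w i.+2).
    split; first by rewrite -!vw; exact: (proj2 (vE i)).
    by exists f; rewrite // -!vw; split; exact: (proj1 (vE _)).
  have [iA lA il] := Qang_lt (w20 _) (w20 _) (w20 _) qi.
  have := allP (allP (all20 c2 (w20 i.+1)) _ iA) _ lA.
  rewrite (Qang_good (w20 _) (w20 _) (w20 _) qi) il => /hasP [q].
  case: q => [|j' [|i' [|l' [|m [|]]]]] //; move=> qO.
  case: eqP => // ej; case: eqP => // ei; case: eqP => // el /andP [m20 im].
  rewrite ej ei el in qO; have [f' f'P [g1 g2 g3]] := Qq _ qO.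
  have ef n : [fset pt (w n); pt (w n.+1)] \in f by have := proj1 (vE n); rewrite !vw.
  have nf n : pt (w n) != pt (w n.+2) by have := proj2 (vE n); rewrite !vw.
  have ff' : f = f' := angle_face polyQ fP f'P (nf i) (ef i) (ef i.+1) g1 g2.
  rewrite -ff' in g3; have nm : pt (w i.+1) != pt m.
    by apply: contraNneq im => /(pt_inj kA (w20 _) m20) <-.
  have /(pt_inj kA (w20 _) m20) -> := cycle_deg cf (ef i.+1) (ef i.+2) g3 (nf i.+1) nm.
  by [].
have PF := mkpoly_polyhedron b kA ok.
case EQ: Q => [V E Fs]; rewrite /mkpoly; congr Polyhedron.
- by rewrite -[V](congr1 (@pverts R) EQ).
- by rewrite -[E](congr1 (@pedges R) EQ) Q_pedges.
rewrite -[Fs](congr1 (@pfaces R) EQ) => {V E Fs EQ}.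
apply/fsetP => f; apply/idP/imfsetP => [/faceF [s sF ->]|[s /= sF ->]]; first by exists s.
(* Conversely, the first four vertices of a face of [F] lie on a face of [Q]. This is a face of [F]
   by the first half, and it shares an angle with the given one. *)
have := Qq _ (c1 _ sF); have /and4P [us s3 s20 _] := face_okF ok sF.
have cs i : [fset pt (nth 0%N s (i %% size s)); pt (nth 0%N s (i.+1 %% size s))] \in fc s.
  by apply/fc_walk; [apply: leq_trans s3 | exists i].
move: us s3 s20 cs (fc_in A b sF); case: s sF => [|i [|j [|l s]]] // sF us s3 s20 cs fcs.
case: s us s20 cs fcs sF s3 => [|m s] us s20 cs fcs sF s3 //.
rewrite /= take0 => -[f' f'P [g1 g2 _]]; have [s' s'F e] := faceF _ f'P.
suff -> : fc [:: i, j, l, m & s] = f' by [].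
have := cs 0%N; have := cs 1%N; rewrite !modn_small //= => e2 e1.
have [i20 l20] : (i < 20)%N /\ (l < 20)%N by move: s20 => /= /and4P [-> _ ->].
apply: (angle_face PF fcs _ _ e1 e2 g1 g2); first by rewrite e; exact: fc_in.
apply: contraTneq us => /(pt_inj kA i20 l20) ->.
by rewrite /= !inE eqxx !orbT.
Qed.

Lemma classification : Q = mkpoly A b F1 \/ Q = mkpoly A b F2.
Proof.
case: Qquads => h; [left|right].
  exact: Q_eq complex_ok1 trace_ok1 quads_cover1 h.
exact: Q_eq complex_ok2 trace_ok2 quads_cover2 h.
Qed.

End Classification.

(* Consistently oriented: the pentagons run against the pentagrams. *)
Definition F1o := pentagrams ++ [seq rev s | s <- pentagons].

Lemma complex_ok1o : complex_ok F1o hexes1. Proof. by vm_compute. Qed.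

Lemma F1o_F1 : all (fun s => has (samef s) F1o) F1. Proof. by vm_compute. Qed.

Definition orient_ok (F : seq (seq nat)) : bool :=
  all (fun s => all (fun i => all (fun j => if inf s i j then
    [&& ((i, j) \in cpairs s) == ((j, i) \notin cpairs s),
        all (fun l => if inf s j l then if i == l then true else
          ((i, j) \in cpairs s) == ((j, l) \in cpairs s) else true) s
      & all (fun s' => if inf s' i j then if s == s' then true else
          ((i, j) \in cpairs s) == ((j, i) \in cpairs s') else true) F]
    else true) s) s) F.

Lemma orient_ok1 : orient_ok F1o. Proof. by vm_compute. Qed.

(* A Moebius band of faces: the last face is the first one traversed backwards. *)
Definition moebius : seq (seq nat) :=
  [:: [:: 0; 10; 16; 1]; [:: 10; 16; 1; 0]; [:: 16; 10; 17; 8]; [:: 10; 17; 8; 16];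
      [:: 17; 8; 16; 10]; [:: 8; 16; 10; 17]; [:: 16; 8; 2; 3]; [:: 8; 2; 3; 16];
      [:: 2; 8; 14; 0]; [:: 8; 14; 0; 2]; [:: 14; 0; 2; 8]; [:: 0; 2; 8; 14];
      [:: 2; 0; 10; 15]; [:: 0; 10; 15; 2]; [:: 10; 0; 1; 16]]%N.

Definition face2 (t : seq nat) : bool :=
  [&& has (samef t) F2, all (fun i => i < 20)%N t & inf t (nth 0%N t 0) (nth 0%N t 1)].

(** A step passes to the next side of the same face, or to the common side run backwards in the face
    beyond it. An orientation takes equal values before and after either step. *)
Definition band_step (t t' : seq nat) : bool :=
  [&& face2 t, face2 t', nth 0%N t' 0 == nth 0%N t 1
    & if samef t t' then [&& nth 0%N t' 1 == nth 0%N t 2, inf t (nth 0%N t 1) (nth 0%N t 2)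
        & nth 0%N t 0 != nth 0%N t 2]
      else nth 0%N t' 1 == nth 0%N t 0].

Lemma moebius_band : path band_step (head [::] moebius) (behead moebius).
Proof. by vm_compute. Qed.

(** * Orientability and genus *)

Section Orientation.
Variables (R : realType) (k : R) (A : 'M[R]_3) (b : E3 R).
Hypothesis kA : scaling k A.
Local Notation pt := (pt A b).
Local Notation idx := (idx A b).
Local Notation fc := (fc A b).

Lemma fc_edge2 s x y : all (fun i => i < 20)%N s -> [fset x; y] \in fc s ->
  exists i j, [/\ i \in s /\ j \in s, (i < 20)%N, (j < 20)%N, x = pt i /\ y = pt j & inf s i j].
Proof.
move=> s20 /(fc_edge s20) [i [j [i20 j20 p /fset2_eq e]]]; have [si sj] := cpairs_mem p.
by case: e => -[-> ->]; [exists i, j | exists j, i]; split; rewrite // /inf p ?orbT.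
Qed.

Lemma orientable1 : orientable (mkpoly A b F1).
Proof.
have ok := complex_ok1o.
pose o (f : face R) x y := has (fun s => (f == fc s) && ((idx x, idx y) \in cpairs s)) F1o.
have oE s i j : s \in F1o -> (i < 20)%N -> (j < 20)%N ->
    o (fc s) (pt i) (pt j) = ((i, j) \in cpairs s).
  move=> sF i20 j20; rewrite /o !(idxK b kA) //; apply/hasP/idP => [[t tF /andP [/eqP e h]]|h].
    by rewrite (fc_inj kA ok sF tF e).
  by exists s; rewrite // eqxx.
have faces f : f \in pfaces (mkpoly A b F1) -> exists2 s, s \in F1o & f = fc s.
  case/faceP=> s sF ->; have /hasP [t tF st] := allP F1o_F1 _ sF.
  by exists t => //; exact: samef_fc.
have chk s i j : s \in F1o -> i \in s -> j \in s -> inf s i j ->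
    [/\ ((i, j) \in cpairs s) == ((j, i) \notin cpairs s),
        forall l, l \in s -> inf s j l -> i != l -> ((i, j) \in cpairs s) = ((j, l) \in cpairs s)
      & forall s', s' \in F1o -> inf s' i j -> s != s' ->
          ((i, j) \in cpairs s) = ((j, i) \in cpairs s')].
  move=> sF si sj h; have := allP (allP (allP orient_ok1 _ sF) _ si) _ sj.
  rewrite h => /and3P [c1 /allP c2 /allP c3]; split=> // [l sl h2 il|s' s'F h2 ss'].
    by have := c2 _ sl; rewrite h2 (negbTE il) => /eqP.
  by have := c3 _ s'F; rewrite h2 (negbTE ss') => /eqP.
exists o; split.
- move=> f x y /faces [s sF ->] /(fc_edge2 (F_lt ok sF)) [i [j [[si sj] i20 j20 [-> ->] h]]].
  by rewrite !oE //; have [/eqP] := chk _ _ _ sF si sj h.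
- move=> f x y z /faces [s sF ->] /(fc_edge2 (F_lt ok sF)) [i [j [[si sj] i20 j20 [-> ->] h]]].
  move=> /(fc_edge2 (F_lt ok sF)) [j' [l [[_ sl] j'20 l20 [/(pt_inj kA j20 j'20) <- ->] h2]]] xz.
  rewrite !oE //; have [_ c _] := chk _ _ _ sF si sj h; apply: c => //.
  by apply: contraNneq xz => ->.
move=> f f' x y /faces [s sF ->] /faces [s' s'F ->] ff'.
move=> /(fc_edge2 (F_lt ok sF)) [i [j [[si sj] i20 j20 [-> ->] h]]].
rewrite (mem_fc b kA) ?(F_lt ok) // => h2.
rewrite !oE //; have [_ _ c] := chk _ _ _ sF si sj h; apply: c => //.
by apply: contraNneq ff' => ->.
Qed.

Lemma nonorientable2 : ~ orientable (mkpoly A b F2).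
Proof.
case=> o [o1 o2 o3]; pose oo (t : seq nat) := o (fc t) (pt (nth 0%N t 0)) (pt (nth 0%N t 1)).
have fP t : face2 t -> fc t \in pfaces (mkpoly A b F2).
  by case/and3P=> /hasP [s sF /(samef_fc A b) ->] _ _; exact: fc_in.
have f20 t : face2 t -> all (fun i => i < 20)%N t by case/and3P.
have inf_lt t i j : all (fun i => i < 20)%N t -> inf t i j -> (i < 20)%N /\ (j < 20)%N.
  by move=> /allP h /orP [] /cpairs_mem [/h ? /h ?].
have fE t i j : face2 t -> inf t i j -> [fset pt i; pt j] \in fc t.
  move=> ft h; have [i20 j20] := inf_lt _ _ _ (f20 _ ft) h.
  by rewrite (mem_fc b kA) ?f20.
have f01 t : face2 t -> inf t (nth 0%N t 0) (nth 0%N t 1) by case/and3P.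
have step t t' : band_step t t' -> oo t = oo t'.
  case/and4P=> ft ft' /eqP e0; case: ifP => [st /and3P [/eqP e1 h n]|st /eqP e1].
    rewrite /oo -(samef_fc A b st) e0 e1; apply: o2; [exact: fP | exact/fE/f01 | exact: fE |].
    have [i20 _] := inf_lt _ _ _ (f20 _ ft) (f01 _ ft).
    have [_ l20] := inf_lt _ _ _ (f20 _ ft) h.
    by apply: contra_neq n; exact: (pt_inj kA i20 l20).
  have h' := f01 _ ft'; rewrite e0 e1 in h'; rewrite /oo e0 e1; apply: o3.
  - exact: fP.
  - exact: fP.
  - by apply: contraFneq st => /(fc_samef kA (f20 _ ft) (f20 _ ft')).
  - exact/fE/f01.
  - by rewrite fsetUC; exact: fE.
have walk t l : path band_step t l -> oo t = oo (last t l).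
  by elim: l t => //= t' l IH t /andP [/step -> /IH].
have := walk _ _ moebius_band.
have -> : last (head [::] moebius) (behead moebius) = [:: 10; 0; 1; 16]%N by [].
have st : samef [:: 0; 10; 16; 1]%N [:: 10; 0; 1; 16]%N by vm_compute.
have ft : face2 [:: 0; 10; 16; 1]%N by vm_compute.
(* The band has come back to its first face with the side 0, 10 reversed, whereas an orientation
   distinguishes the two directions of a side. *)
rewrite /oo /= -(samef_fc A b st) (o1 _ (pt 0)); first by case: (o _ _ _).
  exact: fP.
exact: (fE _ 0%N 10%N ft).
Qed.

(** 20 - 60 + 24 = -16 = 2 - 2 * 9. *)
Lemma genus1 : has_genus (mkpoly A b F1) 9.
Proof.
rewrite /has_genus asboolT; last exact: orientable1.
by rewrite (mkpoly_euler b kA complex_ok1).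
Qed.

(** 20 - 60 + 30 = -10 = 2 - 12. *)
Lemma genus2 : has_genus (mkpoly A b F2) 12.
Proof.
rewrite /has_genus asboolF; last exact: nonorientable2.
by rewrite (mkpoly_euler b kA complex_ok2).
Qed.

End Orientation.

(** * Similarity of the polyhedra in different frames *)

Section Similarity.
Variable R : realType.

Lemma im_mkpoly (A A' : 'M[R]_3) (b b' : E3 R) g F :
  (forall i, g (pt A b i) = pt A' b' i) -> im_poly g (mkpoly A b F) = mkpoly A' b' F.
Proof.
move=> gp; have ge p : im_edge g (ed A b p) = ed A' b' p by rewrite im_edge2 !gp.
have gf s : im_face g (fc A b s) = fc A' b' s.
  apply/fsetP => e; apply/imfsetP/imfsetP => /= -[].
    by move=> _ /imfsetP [p /= ps ->] ->; exists p.
  by move=> p ps ->; exists (ed A b p) => //; apply/imfsetP; exists p.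
rewrite /im_poly /mkpoly /=; congr Polyhedron; apply/fsetP => x.
- apply/imfsetP/idP => /= [[_ /dodecaP [i i20 ->] ->]|/dodecaP [i i20 ->]].
    by rewrite gp; exact: (pt_in A' b' i20).
  by exists (pt A b i) => //; exact: (pt_in A b i20).
- apply/imfsetP/imfsetP => /= -[].
    by move=> _ /imfsetP [p /= ps ->] ->; exists p.
  by move=> p ps ->; exists (ed A b p) => //; apply/imfsetP; exists p.
apply/imfsetP/imfsetP => /= -[].
  by move=> _ /imfsetP [s /= sF ->] ->; exists s.
by move=> s sF ->; exists (fc A b s) => //; exact: fc_in.
Qed.

Lemma similar_mkpoly k k' (A A' : 'M[R]_3) (b b' : E3 R) F :
  scaling k A -> scaling k' A' -> similar_poly (mkpoly A b F) (mkpoly A' b' F).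
Proof.
move=> kA kA'; have [g gk gA] := scaling_map b b' kA kA'; exists g.
  by exists (k' / k) => //; rewrite divr_gt0 //; [case: kA' | case: kA].
by apply: im_mkpoly => i; rewrite !ptE gA.
Qed.

Lemma similarity_inj (g : E3 R -> E3 R) : similarity g -> injective g.
Proof.
case=> k k0 gk x y e; apply: edist0_eq; apply/eqP.
by have := gk x y; rewrite e edistxx => /esym/eqP; rewrite mulf_eq0 gt_eqF.
Qed.

Lemma similar_type (P P' : polyhedron R) p q p' q' : similar_poly P P' ->
  has_type P p q -> has_type P' p' q' -> pfaces P != fset0 -> p = p'.
Proof.
case=> g /similarity_inj gI <- [h _] [h' _] /fset0Pn [f fP].
rewrite -(h f fP) -(h' (im_face g f)); last by apply/imfsetP; exists f.
rewrite /im_face card_imfset // => e e' ee'.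
by apply: (im_inj_in (V := e `|` e') (h := g)) ee'; rewrite ?fsubsetUl ?fsubsetUr // => ? ? _ _; exact: gI.
Qed.

End Similarity.

(** * Face orbits and the final assembly *)

Section Orbits.
Variables (R : realType) (k : R) (A : 'M[R]_3) (b : E3 R).
Hypothesis kA : scaling k A.
Local Notation fc := (fc A b).

Definition faces_of (L : seq (seq nat)) : {fset face R} := [fset fc s | s in L].

Lemma pentagons_notin s : s \in pentagons -> s \notin pentagrams.
Proof. by move: s; apply/allP; vm_compute. Qed.

Lemma orbit1 s : s \in F1 -> face_orbit (dodeca A b) (mkpoly A b F1) (fc s) =
  faces_of (if s \in pentagrams then pentagrams else pentagons).
Proof.
move=> sF; apply/fsetP => f.
have orb t : t \in F1 -> (fc t \in face_orbit (dodeca A b) (mkpoly A b F1) (fc s)) =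
    (s \in pentagrams) (+) (t \notin pentagrams).
  move=> tF; rewrite (orbit_fc b kA complex_ok1 invariant_faces1 sF tF).
  exact/eqP/(allP (allP orbits1 _ sF) _ tF).
apply/idP/imfsetP => /= [fo|[t tL ->]].
  have : f \in pfaces (mkpoly A b F1) by move: fo; rewrite inE => /andP [].
  case/faceP=> t tF ft; rewrite ft orb // in fo; exists t => //.
  move: tF fo; rewrite mem_cat.
  by case: (s \in pentagrams); case: (t \in pentagrams) => //= ->.
have tF : t \in F1 by move: tL; rewrite mem_cat; case: ifP => _ ->; rewrite ?orbT.
rewrite orb //; move: tL; case: ifP => _ tL; first by rewrite tL.
by rewrite (pentagons_notin tL).
Qed.

Lemma orbits_F1 : face_orbits (dodeca A b) (mkpoly A b F1) =
  [fset faces_of pentagrams; faces_of pentagons].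
Proof.
apply/fsetP => X; apply/imfsetP/fset2P => /= [[f /faceP [s sF ->] ->]|].
  by rewrite orbit1 //; case: ifP => _; [left | right].
have h0 : nth [::] F1 0 \in F1 by vm_compute.
(* Twelve pentagrams come first in [F1], so entry 12 is a pentagon. *)
have h12 : nth [::] F1 12 \in F1 by vm_compute.
case=> ->.
  by exists (fc (nth [::] F1 0)); [exact: fc_in | rewrite orbit1].
by exists (fc (nth [::] F1 12)); [exact: fc_in | rewrite orbit1].
Qed.

Lemma pentagrams_neq : faces_of pentagrams != faces_of pentagons.
Proof.
pose s := nth [::] F1 0; have sF : s \in F1 by vm_compute.
have sp : s \in pentagrams by vm_compute.
apply/eqP => /fsetP /(_ (fc s)) e.
have : fc s \in faces_of pentagons by rewrite -e; apply/imfsetP; exists s.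
case/imfsetP=> t /= tp /(fc_inj kA complex_ok1 sF) st.
have tF : t \in F1 by rewrite mem_cat tp orbT.
by have := pentagons_notin tp; rewrite -st // sp.
Qed.

Lemma orbits_F2 : #|` face_orbits (dodeca A b) (mkpoly A b F2)| = 1%N.
Proof.
have orb s : s \in F2 ->
    face_orbit (dodeca A b) (mkpoly A b F2) (fc s) = pfaces (mkpoly A b F2).
  move=> sF; apply/fsetP => f; apply/idP/idP => [|/faceP [t tF ->]].
    by rewrite inE => /andP [].
  rewrite (orbit_fc b kA complex_ok2 invariant_faces2 sF tF).
  exact: (allP (allP orbits2 _ sF) _ tF).
suff -> : face_orbits (dodeca A b) (mkpoly A b F2) = [fset pfaces (mkpoly A b F2)].
  exact: cardfs1.
apply/fsetP => X; apply/imfsetP/fset1P => /= [[f /faceP [s sF ->] ->]|->]; first exact: orb.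
have s0 : nth [::] F2 0 \in F2 by vm_compute.
by exists (fc (nth [::] F2 0)); [exact: fc_in | rewrite orb].
Qed.

End Orbits.

Theorem theorem7p1 (R : realType) (S : {fset E3 R})
    (dodecS : regular_dodecahedron S) :
  exists P1 P2 : polyhedron R,
    [/\ [/\ directed_on S P1, directed_on S P2, ~ similar_poly P1 P2
          & forall (S' : {fset E3 R}) (Q : polyhedron R),
              regular_dodecahedron S' -> directed_on S' Q ->
              similar_poly P1 Q \/ similar_poly P2 Q],
        edges_of_length S P1 2%N /\ edges_of_length S P2 2%N,
        [/\ has_type P1 5%N 6%N, has_genus P1 9%N, orientable P1,
            forall f : face R, f \in pfaces P1 -> planar f
          & exists A B : {fset face R},
              [/\ A != B, face_orbits S P1 = [fset A; B],
                  forall f : face R, f \in A ->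
                    pentagram f /\ has_shape S P1 f Hl Hl Hl Hl
                & forall f : face R, f \in B ->
                    convex_pentagon f /\ has_shape S P1 f Fw Fw Fw Fw]],
        petrie_dual P1 P2
      & [/\ has_type P2 4%N 6%N, has_genus P2 12%N, ~ orientable P2,
            forall f : face R, f \in pfaces P2 -> ~ planar f /\ has_shape S P2 f Hl Fw Hl Fw
          & #|` face_orbits S P2| = 1%N]].
Proof.
have [k [A [b [kA dA ->]]]] := dodecahedron_frame dodecS.
exists (mkpoly A b F1), (mkpoly A b F2).
have t1 : has_type (mkpoly A b F1) 5 6 by apply: (mkpoly_type b kA complex_ok1); vm_compute.
have t2 : has_type (mkpoly A b F2) 4 6 by apply: (mkpoly_type b kA complex_ok2); vm_compute.
(* Shapes have period 4 and pentagons period 5; the two indexings agree because all turns of such a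
   face are equal. *)
have hl i : nth Hl [:: Hl; Hl; Hl; Hl] (i %% 4) =
    nth Hl [:: Hr; Sr; Fw; Sl; Hl] (nth 0%N [:: 4; 4; 4; 4; 4]%N (i %% 5)).
  move: (i %% 4)%N (i %% 5)%N (ltn_pmod i (isT : 0 < 4)%N) (ltn_pmod i (isT : 0 < 5)%N).
  by move=> [|[|[|[|m]]]] // [|[|[|[|[|n]]]]].
have fw i : nth Fw [:: Fw; Fw; Fw; Fw] (i %% 4) =
    nth Hl [:: Hr; Sr; Fw; Sl; Hl] (nth 0%N [:: 2; 2; 2; 2; 2]%N (i %% 5)).
  move: (i %% 4)%N (i %% 5)%N (ltn_pmod i (isT : 0 < 4)%N) (ltn_pmod i (isT : 0 < 5)%N).
  by move=> [|[|[|[|m]]]] // [|[|[|[|[|n]]]]].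
have hf i : nth Hl [:: Hl; Fw; Hl; Fw] (i %% 4) =
    nth Hl [:: Hr; Sr; Fw; Sl; Hl] (nth 0%N [:: 4; 2; 4; 2]%N (i %% 4)).
  by move: (i %% 4)%N (ltn_pmod i (isT : 0 < 4)%N) => [|[|[|[|m]]]].
have size5 s : s \in F1 -> size s = 5%N.
  by move=> h; apply/eqP; move: s h; apply/allP; vm_compute.
split.
- split.
  + exact: (mkpoly_directed_on b kA complex_ok1 invariant_faces1 flag_transitive1).
  + exact: (mkpoly_directed_on b kA complex_ok2 invariant_faces2 flag_transitive2).
  + move=> sim; have s0 : nth [::] F1 0 \in F1 by vm_compute.
    have ne : pfaces (mkpoly A b F1) != fset0.
      by apply/fset0Pn; exists (fc A b (nth [::] F1 0)); exact: fc_in.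
    by have := similar_type sim t1 t2 ne.
  (* [Q] is classified in the frame of its own dodecahedron, and one list of faces gives similar
     polyhedra in any two frames. *)
  + move=> S' Q /dodecahedron_frame [k' [A' [b' [kA' _ ->]]]] [QV [polyQ regQ indQ] dirQ].
    have [->|->] := classification kA' QV polyQ regQ indQ dirQ; [left | right];
      exact: similar_mkpoly kA kA'.
- by split; [exact: (edges_length2 kA complex_ok1) | exact: (edges_length2 kA complex_ok2)].
- split; first exact: t1.
  + exact: (genus1 b kA).
  + exact: (orientable1 b kA).
  + move=> f /faceP [s + ->]; rewrite mem_cat => /orP [sF|sF].
      have /and4P [ls _ ps _] := allP data1 _ sF; exact: (planar_fc b kA).
    have /and4P [ls _ ps _] := allP data1' _ sF; exact: (planar_fc b kA).
  exists (faces_of A b pentagrams), (faces_of A b pentagons); split.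
  + exact: (pentagrams_neq b kA).
  + exact: (orbits_F1 b kA).
  + move=> f /imfsetP [s /= sF ->]; have /and4P [ls ps _ sh] := allP data1 _ sF.
    split; first exact: (pentagram_fc b kA dA).
    have s5 : size s = 5%N by apply: size5; rewrite mem_cat sF.
    by apply: (has_shape_fc b kA dA F1 ls sh) => i; rewrite s5; exact: hl.
  + move=> f /imfsetP [s /= sF ->]; have /and4P [ls ps _ sh] := allP data1' _ sF.
    split; first exact: (convex_pentagon_fc b kA dA).
    have s5 : size s = 5%N by apply: size5; rewrite mem_cat sF orbT.
    by apply: (has_shape_fc b kA dA F1 ls sh) => i; rewrite s5; exact: fw.
- exact: (petrie_dual12 b kA).
split; first exact: t2.
- exact: (genus2 b kA).
- exact: (nonorientable2 kA).
- move=> f /faceP [s sF ->]; have /and4P [ls sk /eqP s4 sh] := allP data2 _ sF.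
  split; first exact: (skew_fc kA).
  by apply: (has_shape_fc b kA dA F2 ls sh) => i; rewrite s4; exact: hf.
- exact: (orbits_F2 b kA).
Qed.
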